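(* Let $S$ be a connected graph other than $P_3$. Then the implication ''for every 2-connected claw-$f$-heavy graph $G$, if $G$ is $S$-$o$-heavy then $G$ is Hamiltonian'' holds if and only if (up to isomorphism) $S$ is one of $P_4,P_5,C_3,Z_1,Z_2,B,N,W$.
   Context: All graphs are finite and simple. $d(v)$ denotes the degree of $v$ in $G$, and $d_{G'}(u,v)$ denotes the distance between $u$ and $v$ in a graph $G'$. A graph is Hamiltonian if it has a cycle through all its vertices. $o$-heavy: Let $G$ be a graph on $n$ vertices. For a given graph $H$, $G$ is $H$-$o$-heavy if for every induced subgraph $G'$ of $G$ isomorphic to $H$ there exist two nonadjacent vertices $x,y\in V(G')$ such that $d(x)+d(y)\geq n$ (degrees taken in $G$). $f$-heavy: Let $G$ be a graph on $n$ vertices. For a given graph $H$, $G$ is $H$-$f$-heavy if for every induced subgraph $G'$ of $G$ isomorphic to $H$ and every two vertices $u,v\in V(G')$, $d_{G'}(u,v)=2$ implies $\max\{d(u),d(v)\}\geq n/2$ (degrees taken in $G$). Claw-$f$-heavy means $K_{1,3}$-$f$-heavy. Particular graphs: $P_i$ is the path on $i$ vertices; $C_3$ is the triangle; $Z_i$ is obtained from a triangle by attaching a path with $i$ edges at one of its vertices; $B$ (bull) is obtained from a triangle by attaching one pendant edge at each of two of its vertices; $N$ (net) is obtained from a triangle by attaching one pendant edge at each of its three vertices; $W$ (wounded) has vertices $a_1,a_2,a_3,b_1,b_2,c_1$ and edges $a_1a_2,a_2a_3,a_3a_1,a_1b_1,b_1c_1,a_2b_2$.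
   Formalization: S is assumed to have at least 3 vertices: for S = K_1 or K_2 no 2-connected G is S-o-heavy, so the implication holds vacuously although K_1 and K_2 are not in the list. *)

(* Defs.v *)
From mathcomp Require Import all_boot.

Set Implicit Arguments.
Unset Strict Implicit.
Unset Printing Implicit Defensive.

(* Finite simple graphs. *)
Record sgraph := SGraph {
  vertex :> finType;
  adj : rel vertex;
  adj_sym : symmetric adj;
  adj_irrefl : irreflexive adj }.

Definition deg (G : sgraph) (v : G) : nat := #|[set u | adj v u]|.

Definition isomorphic (G H : sgraph) : Prop :=
  exists f : G -> H, bijective f /\ forall x y, adj (f x) (f y) = adj x y.

Section Induced.
Variables (G : sgraph) (A : {set G}).

Definition induced_rel : rel {x : G | x \in A} :=
  fun x y => adj (val x) (val y).

Fact induced_sym : symmetric induced_rel.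
Proof. by move=> x y; apply: adj_sym. Qed.

Fact induced_irrefl : irreflexive induced_rel.
Proof. by move=> x; apply: adj_irrefl. Qed.

Definition induced : sgraph := SGraph induced_sym induced_irrefl.

End Induced.

(* The graph without vertices is not connected. *)
Definition connected (G : sgraph) : Prop :=
  0 < #|G| /\ forall x y : G, connect (@adj G) x y.

Definition two_connected (G : sgraph) : Prop :=
  [/\ 2 < #|G|, connected G & forall v : G, connected (induced [set~ v])].

(* A cycle has at least three vertices; without this bound, [cycle] would
   accept a single edge traversed back and forth. *)
Definition hamiltonian (G : sgraph) : Prop :=
  exists c : seq G, [/\ 2 < size c, ucycle (@adj G) c & forall x, x \in c].

(* [p] lists the vertices of the path after its initial vertex [x], so that
   [size p] is the number of edges. *)
Definition path_between (G : sgraph) (x y : G) (p : seq G) : Prop :=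
  [/\ path (@adj G) x p, uniq (x :: p) & last x p = y].

(* d_G(x, y) = k; no [k] qualifies when [x] and [y] are not connected. *)
Definition has_dist (G : sgraph) (x y : G) (k : nat) : Prop :=
  (exists2 p, path_between x y p & size p = k) /\
  (forall p, path_between x y p -> k <= size p).

Definition o_heavy (H G : sgraph) : Prop :=
  forall A : {set G}, isomorphic (induced A) H ->
  exists x y : G, [/\ x \in A, y \in A, x != y, ~~ adj x y &
                      #|G| <= deg x + deg y].

(* Distances are taken in the induced subgraph, degrees in [G]; the last line
   is max{d(u), d(v)} >= |G| / 2 with the denominator cleared. *)
Definition f_heavy (H G : sgraph) : Prop :=
  forall A : {set G}, isomorphic (induced A) H ->
  forall u v : induced A, has_dist u v 2 ->
  #|G| <= 2 * maxn (deg (val u)) (deg (val v)).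

(* The graph on {0, ..., n-1} whose edges are the pairs listed in [s], in
   either order. *)
Section GraphOf.
Variables (n : nat) (s : seq (nat * nat)).

Definition graph_of_rel : rel 'I_n := fun i j =>
  (i != j) && (((i : nat, j : nat) \in s) || ((j : nat, i : nat) \in s)).

Fact graph_of_sym : symmetric graph_of_rel.
Proof. by move=> i j; rewrite /graph_of_rel eq_sym orbC. Qed.

Fact graph_of_irrefl : irreflexive graph_of_rel.
Proof. by move=> i; rewrite /graph_of_rel eqxx. Qed.

Definition graph_of : sgraph := SGraph graph_of_sym graph_of_irrefl.

End GraphOf.

Definition claw : sgraph := graph_of 4 [:: (0, 1); (0, 2); (0, 3)].

Definition Pgraph (n : nat) : sgraph :=
  graph_of n [seq (k, k.+1) | k <- iota 0 n.-1].

Definition triangle_edges : seq (nat * nat) := [:: (0, 1); (1, 2); (2, 0)].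

Definition C3 : sgraph := graph_of 3 triangle_edges.

(* The attached path is 2, 3, ..., i + 2. *)
Definition Zgraph (i : nat) : sgraph :=
  graph_of (i + 3) (triangle_edges ++ [seq (k, k.+1) | k <- iota 2 i]).

Definition bull : sgraph := graph_of 5 (triangle_edges ++ [:: (0, 3); (1, 4)]).

Definition net : sgraph :=
  graph_of 6 (triangle_edges ++ [:: (0, 3); (1, 4); (2, 5)]).

(* a_1, a_2, a_3, b_1, b_2, c_1 are numbered 0, ..., 5. *)
Definition wounded : sgraph :=
  graph_of 6 (triangle_edges ++ [:: (0, 3); (3, 5); (1, 4)]).

(* Main.v *)
Require Import Defs.
From mathcomp Require Import all_boot zify.

(* Sufficiency: every listed graph embeds in the net or in the wounded graph.
   Call two vertices o-adjacent if they are adjacent or their degrees sum to at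
   least n. A cycle of o-adjacent vertices never beats the longest cycles, as in
   the Bondy-Chvatal closure. In a nonhamiltonian G take a longest cycle and a
   shortest path outside it, with ends u and v on the cycle. Around u and around
   v grow regions which have spanning paths between any two of three terminals
   and are joined by three disjoint paths. Maximality of the cycle forbids
   o-edges between the pieces, so by adding degrees one of the regions has no
   nonadjacent o-pair, and there a shortest path leads to an induced net and to
   an induced wounded graph without a heavy pair.
   Necessity: S embeds in every nonhamiltonian 2-connected claw-f-heavy graph,
   which would otherwise be vacuously S-o-heavy. Two claw-free ones on 9 vertices
   leave the listed graphs, P3 and P6; one on 14 vertices, in which every induced
   P6 has a heavy pair, excludes P6. *)

(** The conclusion asks for six vertices whose nonadjacent pairs are not even o-pairs, whereas
    exchange arguments on a longest cycle yield pairs that are only o-adjacent. Passing to a closure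
    is no remedy, since it changes the induced subgraphs. Claw-heaviness enters only in this form:
    of three independent neighbours of a vertex, two are o-adjacent. The triangles found in this way
    at the ends of the outside path may have a mere o-edge as third side. Hence the regions carry
    their spanning paths in the o-graph but are connected in [G], and they are enlarged until the
    vertices hanging off them are pendant even for o-adjacency; a region without nonadjacent o-pairs
    then behaves like a claw-free graph with three pendant vertices. The outside path is never
    absorbed, so the pair of its ends, and an end together with the second interior vertex, need a
    separate degree count. *)

(** * Induced embeddings and heredity of heaviness *)

Definition embeds (H G : sgraph) : Prop :=
  exists2 f : H -> G, injective f & forall x y, adj (f x) (f y) = adj x y.

Lemma isomorphic_embeds (H G : sgraph) : isomorphic H G -> embeds H G.
Proof. by case=> f [/bij_inj fI fP]; exists f. Qed.

Lemma isomorphic_sym (H G : sgraph) : isomorphic H G -> isomorphic G H.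
Proof.
case=> f [[g fK gK] fP]; exists g; split; first by exists f.
by move=> x y; rewrite -fP !gK.
Qed.

(** Allows [necessity] to obtain an embedding from the absurdity of its absence. *)
Lemma embeds_decidable (H G : sgraph) : decidable (embeds H G).
Proof.
apply: (@decP _ [exists f : {ffun H -> G}, injectiveb f &&
  [forall x, forall y, adj (f x) (f y) == adj x y]]).
apply: (iffP existsP) => [[f /andP[/injectiveP fI /forallP fP]]|[f fI fP]].
  by exists f => // x y; apply/eqP; move/forallP: (fP x).
exists (finfun f); apply/andP; split.
  by apply/injectiveP => x y; rewrite !ffunE => /fI.
by apply/forallP=> x; apply/forallP=> y; rewrite !ffunE fP.
Qed.

Lemma embeds_trans (F G H : sgraph) : embeds F G -> embeds G H -> embeds F H.
Proof.
case=> f fI fP [g gI gP]; exists (g \o f); first exact: inj_comp.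
by move=> x y; rewrite /= gP fP.
Qed.

Lemma embeds_card_isomorphic (H G : sgraph) :
  embeds H G -> #|G| <= #|H| -> isomorphic H G.
Proof.
case=> f fI fP le; exists f; split=> //; exact: inj_card_bij.
Qed.

Lemma embeds_induced (H G : sgraph) (A : {set G}) :
  isomorphic (induced A) H -> embeds H G.
Proof.
move/isomorphic_sym=> [f [/bij_inj fI fP]].
exists (fun x => val (f x)) => [x y /val_inj/fI //|x y]; exact: (fP x y).
Qed.

Lemma induced_image (H G : sgraph) (f : H -> G) :
  injective f -> (forall x y, adj (f x) (f y) = adj x y) ->
  isomorphic (induced [set f x | x : H]) H.
Proof.
move=> fI fP; apply: isomorphic_sym.
have fin x : f x \in [set f x | x : H] by apply: imset_f.
exists (fun x => exist _ (f x) (fin x) : induced _); split; last first.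
  by move=> x y; rewrite -fP.
apply: inj_card_bij => [x y [/fI //]|].
by rewrite card_sig card_imset.
Qed.

(** A copy of [H] contains a copy of [H'], whose heavy pair serves for the larger copy. *)
Lemma o_heavy_of_embeds (H' H G : sgraph) :
  embeds H' H -> o_heavy H' G -> o_heavy H G.
Proof.
case=> f fI fP oH A /isomorphic_sym [g [/bij_inj gI gP]].
have hI : injective (fun x => val (g (f x))) by move=> x y /val_inj/gI/fI.
have hP x y : adj (val (g (f x))) (val (g (f y))) = adj x y.
  by rewrite -fP -gP.
have [x [y [/imsetP[x' _ ->] /imsetP[y' _ ->] ne na le]]] :=
  oH _ (induced_image H' G _ hI hP).
by exists (val (g (f x'))), (val (g (f y'))); split=> //; exact: valP.
Qed.

(** * Graphs on numbers and verified searches *)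

Definition edge (s : seq (nat * nat)) : rel nat :=
  fun i j => (i != j) && (((i, j) \in s) || ((j, i) \in s)).

Lemma edge_sym s : symmetric (edge s).
Proof. by move=> i j; rewrite /edge eq_sym orbC. Qed.

Lemma edge_irrefl s : irreflexive (edge s).
Proof. by move=> i; rewrite /edge eqxx. Qed.

Lemma adj_graph_of n s (i j : graph_of n s) :
  adj i j = edge s (i : 'I_n) (j : 'I_n).
Proof. by []. Qed.

(** The relation is tabulated once for the searches; [lookup] answers [false] outside the range, so
    the cached relation stays symmetric and irreflexive. *)
Definition table n (e : rel nat) : seq (seq bool) :=
  [seq [seq e i j | j <- iota 0 n] | i <- iota 0 n].

Definition lookup t (i j : nat) : bool := nth false (nth [::] t i) j.

Lemma lookupE n (e : rel nat) i j :
  lookup (table n e) i j = [&& i < n, j < n & e i j].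
Proof.
rewrite /lookup; case: (ltnP i n) => [lti|gei]; last first.
  by rewrite [nth [::] _ i]nth_default ?size_map ?size_iota // nth_nil.
rewrite (nth_map 0) ?size_iota // nth_iota //.
case: (ltnP j n) => [ltj|gej]; last by rewrite nth_default ?size_map ?size_iota.
by rewrite (nth_map 0) ?size_iota // nth_iota.
Qed.

Lemma lookup_table n (e : rel nat) i j :
  i < n -> j < n -> lookup (table n e) i j = e i j.
Proof. by rewrite lookupE => -> ->. Qed.

Lemma lookup_sym n s : symmetric (lookup (table n (edge s))).
Proof. by move=> i j; rewrite !lookupE edge_sym; case: (i < n); case: (j < n). Qed.

Lemma lookup_irrefl n s : irreflexive (lookup (table n (edge s))).
Proof. by move=> i; rewrite lookupE edge_irrefl !andbF. Qed.

Section Search.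
Variables (a b : rel nat) (T : seq nat).
Hypotheses (a_sym : symmetric a) (b_sym : symmetric b).

Definition compatible (p q : nat * nat) :=
  (p.2 != q.2) && (b p.2 q.2 == a p.1 q.1).

(* [M] is the graph of the part of the embedding found so far. *)
Fixpoint embedb (P : pred (seq (nat * nat))) (L : seq nat)
    (M : seq (nat * nat)) : bool :=
  if L is l :: L' then
    has (fun t => if all (compatible (l, t)) M then embedb P L' ((l, t) :: M)
                  else false) T
  else P M.

(** Stated for a partial map on [M] so that the induction goes through; vertices move from [L] to
    the top of [M], whence [catrev] in the final test. *)
Lemma embedb_complete (P : pred (seq (nat * nat))) (f : nat -> nat) (L M : seq nat) :
  uniq (L ++ M) -> {in L, forall x, f x \in T} ->
  {in L ++ M &, injective f} ->
  {in L ++ M &, forall x y, b (f x) (f y) = a x y} ->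
  P [seq (x, f x) | x <- catrev L M] ->
  embedb P L [seq (x, f x) | x <- M].
Proof.
elim: L M => [//|l L IH] M uL fT fI fP PM /=.
have Pm : perm_eq (L ++ l :: M) (l :: (L ++ M)) by rewrite -(cat1s l M) perm_catCA.
have sub x : x \in L ++ l :: M -> x \in (l :: L) ++ M by rewrite (perm_mem Pm).
apply/hasP; exists (f l); first by rewrite fT ?mem_head.
rewrite ifT; last first.
  apply/allP=> _ /mapP[x xM ->]; rewrite /compatible /= fP ?eqxx ?andbT //=;
    rewrite ?inE ?eqxx ?mem_cat ?xM ?orbT //.
  apply/negP=> /eqP /fI E; move: uL; rewrite E ?inE ?eqxx ?mem_cat ?xM ?orbT //.
  by rewrite /= mem_cat xM orbT.
apply: (IH (l :: M)).
- by rewrite (perm_uniq Pm).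
- by move=> x xL; rewrite fT ?inE ?xL ?orbT.
- by move=> x y /sub xL /sub yL; apply: fI.
- by move=> x y /sub xL /sub yL; apply: fP.
- exact: PM.
Qed.

Lemma embedb_sound (P : pred (seq (nat * nat))) L M :
  embedb P L M -> pairwise compatible M -> all (fun p => p.2 \in T) M ->
  exists M', [/\ map fst M' = catrev L (map fst M), pairwise compatible M'
               & all (fun p => p.2 \in T) M'].
Proof.
elim: L M => [|l L IH] M /=; first by exists M.
case/hasP=> t tT; case: ifP => // lM eM pM aM.
by apply: IH eM _ _; rewrite /= ?lM ?tT.
Qed.

Lemma compatible_mem M p q :
  pairwise compatible M -> p \in M -> q \in M -> p != q -> compatible p q.
Proof.
have symc r r' : compatible r r' = compatible r' r.
  by rewrite /compatible eq_sym a_sym b_sym.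
elim: M => //= r M IH /andP[/allP rM /IH{}IH]; rewrite !inE.
case/predU1P=> [->|pM] /predU1P[->|qM]; rewrite ?eqxx // => ne.
- exact: rM.
- by rewrite symc rM.
- exact: IH.
Qed.

Lemma embedbP L : uniq L -> irreflexive a -> irreflexive b ->
  reflect (exists f : nat -> nat, [/\ {in L, forall x, f x \in T},
     {in L &, injective f} & {in L &, forall x y, b (f x) (f y) = a x y}])
  (embedb predT L [::]).
Proof.
move=> uL a0 b0; apply: (iffP idP) => [/embedb_sound|[f [fT fI fP]]]; last first.
  by apply: (@embedb_complete predT f L [::]); rewrite ?cats0.
case=> // M [ML pM aM]; rewrite catrevE cats0 in ML.
pose f l := nth 0 (map snd M) (index l (map fst M)).
have fM l : l \in L -> (l, f l) \in M.
  rewrite -mem_rev -ML => lM; rewrite /f.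
  have lt : index l (map fst M) < size M by rewrite -(size_map fst) index_mem.
  rewrite (nth_map (0, 0)) //.
  rewrite -[X in (X, _)](nth_index 0 lM) (nth_map (0, 0)) // -surjective_pairing.
  exact: mem_nth.
exists f; split.
- by move=> l /fM lM; have := allP aM _ lM.
- move=> x y xL yL E; apply/eqP/negP=> /negP ne.
  have := compatible_mem M _ _ pM (fM x xL) (fM y yL).
  by rewrite xpair_eqE (negPf ne) /compatible /= E eqxx => /(_ isT).
- move=> x y xL yL; have [->|ne] := eqVneq x y; first by rewrite a0 b0.
  have := compatible_mem M _ _ pM (fM x xL) (fM y yL).
  by rewrite xpair_eqE (negPf ne) /compatible /= => /(_ isT)/andP[_ /eqP].
Qed.
End Search.

Definition embeds_in (e : rel nat) (L : seq nat) n s :=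
  let t := table n (edge s) in embedb e (lookup t) (iota 0 n) predT L [::].

(** * An abstract graph carried by a list of numbers *)

Section Carried.
Variables (S : sgraph) (e : rel nat) (h : S -> nat).
Hypotheses (e_sym : symmetric e) (e_irrefl : irreflexive e).
Hypothesis hI : injective h.
Hypothesis hP : forall x y, e (h x) (h y) = adj x y.
Variable L : seq nat.
Hypotheses (uL : uniq L) (hL : forall l, (l \in L) <-> exists x, l = h x).

Lemma embeds_inP n s :
  reflect (embeds S (graph_of n s)) (embeds_in e L n s).
Proof.
have hmem x : h x \in L by apply/hL; exists x.
apply: (equivP (embedbP _ _ _ e_sym (lookup_sym n s) L uL
  e_irrefl (lookup_irrefl n s))).
split=> [[f [fT fI fP]]|[k kI kP]].
  have lt x : f (h x) < n by move: (fT _ (hmem x)); rewrite mem_iota.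
  exists (fun x => Ordinal (lt x) : graph_of n s) => [x y /(congr1 val) /=|x y].
    by move=> E; apply: hI; apply: fI E.
  by rewrite -hP -fP // lookup_table.
(* If [S] is empty then so is [L] and any map will do; otherwise [x0] is the default value of the
   inverse [g] of [h]. *)
have [x0 _|noS] := pickP (@predT S); last first.
  by exists id; split=> [l|l m|l m] /hL [x]; have := noS x.
pose g l := odflt x0 [pick x | h x == l].
have gK x : g (h x) = x.
  rewrite /g; case: pickP => [y /eqP/hI //|/(_ x)]; by rewrite eqxx.
exists (fun l => k (g l) : 'I_n); split.
- by move=> l _; rewrite mem_iota ltn_ord.
- by move=> _ _ /hL[x ->] /hL[y ->]; rewrite !gK => /val_inj/kI ->.
- by move=> _ _ /hL[x ->] /hL[y ->]; rewrite !gK hP -kP lookup_table ?ltn_ord.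
Qed.

Lemma card_carried : #|S| = size L.
Proof.
rewrite cardE -(size_map h); apply/perm_size/uniq_perm => // [|l].
  by rewrite map_inj_uniq ?enum_uniq.
apply/idP/idP => [/mapP[x _ ->]|/hL[x ->]]; first by apply/hL; exists x.
by rewrite map_f ?mem_enum.
Qed.

Lemma isomorphic_list n s :
  embeds_in e L n s -> n <= size L -> isomorphic S (graph_of n s).
Proof.
move/embeds_inP=> emb le; apply: embeds_card_isomorphic => //.
by rewrite card_ord card_carried.
Qed.

Lemma connected_list (K : seq nat) :
  connected S -> has (mem K) L -> 
  all (fun l => (l \in K) || all (fun k => ~~ e l k) K) L ->
  {subset L <= K}.
Proof.
case=> _ con /hasP[_ /hL[x ->] /= xK] /allP clK _ /hL[y ->].
apply: contraT => yK; have /negP[] := yK.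
have cl : closed (@adj S) [pred z | h z \in K].
  apply: intro_closed; first exact: (sym_connect_sym (@adj_sym S)).
  move=> z w zw; rewrite !inE => zK; apply: contraT => wK.
  have /clK : h w \in L by apply/hL; exists w.
  by rewrite (negPf wK) => /allP /(_ _ zK); rewrite hP adj_sym zw.
by have := closed_connect cl (con x y); rewrite !inE xK.
Qed.

Definition grow (K : seq nat) := [seq l <- L | (l \in K) || has (e l) K].

Definition reached := iter (size L) grow [:: head 0 L].

Definition connected_test := all (mem reached) L.

Lemma reachedP : connected_test -> 0 < size L -> connected S.
Proof.
move=> test L0; split; first by rewrite card_carried.
have [x0 hx0] : exists x, head 0 L = h x by apply/hL; rewrite -nth0 mem_nth.
suff main k l : l \in iter k grow [:: head 0 L] ->
    exists2 x, l = h x & connect (@adj S) x0 x.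
  have con x : connect (@adj S) x0 x.
    have /(allP test) xL : h x \in L by apply/hL; exists x.
    by have [y /hI ->] := main _ _ xL.
  move=> x y; apply: connect_trans (con y).
  by rewrite (sym_connect_sym (@adj_sym S)).
elim: k l => [|k IH] l /=; first by rewrite inE hx0 => /eqP->; exists x0.
rewrite mem_filter => /andP[/orP[/IH //|/hasP[m /IH[y -> yc]]] + /hL[x lx]].
rewrite lx hP => xy; exists x => //; apply: connect_trans yc (connect1 _).
by rewrite adj_sym.
Qed.

(** That [size L] rounds of [grow] exhaust a component is never proved; the test checks directly
    that no edge leaves [reached]. *)
Definition disconnected_test :=
  ~~ connected_test &&
  all (fun l => (l \in reached) || all (fun k => ~~ e l k) reached) L.

Lemma disconnectedP : disconnected_test -> ~ connected S.
Proof.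
case/andP=> notc cl con; have /negP := notc; apply; apply/allP.
suff hasL : has (mem reached) L.
  by move=> l lL; exact: (connected_list reached con hasL cl l lL).
have [x _] : exists x : S, true.
  by case: con => /card_gt0P[x _]; exists x.
have L0 : 0 < size L.
  by rewrite -card_carried; apply/card_gt0P; exists x.
apply/hasP; exists (head 0 L); first by rewrite -nth0 mem_nth.
rewrite /= /reached; elim: (size L) => [|k IH] /=; first by rewrite inE eqxx.
by rewrite mem_filter IH /= -nth0 mem_nth.
Qed.

End Carried.

Fixpoint sublists (s : seq nat) : seq (seq nat) :=
  if s is x :: s' then
    let r := sublists s' in r ++ [seq x :: l | l <- r]
  else [:: [::]].

Lemma filter_sublists p s : filter p s \in sublists s.
Proof.
elim: s => //= x s IH; rewrite mem_cat; case: (p x); last by rewrite IH.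
by rewrite map_f ?orbT.
Qed.

(** The value [v = n] is no vertex, so that deleting it tests the connectedness of the whole
    graph. *)
Definition two_connected_test n r :=
  (2 < n) && all (fun v => let L := [seq l <- iota 0 n | l != v] in
                           connected_test (edge r) L) (iota 0 n.+1).

Lemma two_connected_graph_of n r :
  two_connected_test n r -> two_connected (graph_of n r).
Proof.
case/andP=> n2 /allP test.
have con v : v \in iota 0 n.+1 -> connected_test (edge r) [seq l <- iota 0 n | l != v].
  by move/test.
have sz v : v \in iota 0 n.+1 -> 0 < size [seq l <- iota 0 n | l != v].
  move=> _; rewrite size_filter -has_count.
  by apply/hasP; case: (eqVneq v 0) => [->|v0]; [exists 1|exists 0];
    rewrite ?mem_iota //= ?(ltnW n2) ?(ltnW (ltnW n2)) // eq_sym.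
split; first by rewrite card_ord.
  have n_in : n \in iota 0 n.+1 by rewrite mem_iota /= ltnS.
  apply: (@reachedP (graph_of n r) (edge r) (fun x => nat_of_ord x) _ _ _ _ _ (con _ n_in) (sz _ n_in)).
  - exact: val_inj.
  - by [].
  - by rewrite filter_uniq ?iota_uniq.
  move=> l; rewrite mem_filter mem_iota /=; split=> [/andP[_ lt]|[x ->]].
    by exists (Ordinal lt).
  by rewrite ltn_ord andbT neq_ltn ltn_ord.
move=> v; have v_in : nat_of_ord v \in iota 0 n.+1.
  by rewrite mem_iota /= ltnS ltnW.
apply: (@reachedP (induced [set~ v]) (edge r) (fun x => nat_of_ord (val x)) _ _ _ _ _ (con _ v_in) (sz _ v_in)).
- by move=> x y /val_inj/val_inj.
- by [].
- by rewrite filter_uniq ?iota_uniq.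
move=> l; rewrite mem_filter mem_iota /=; split=> [/andP[ne lt]|[[x /= xv] ->]].
  have xv : (Ordinal lt : graph_of n r) \in [set~ v] by rewrite !inE.
  by exists (exist (fun x => x \in [set~ v]) _ xv).
by rewrite ltn_ord andbT; rewrite !inE in xv.
Qed.

(** Depth-first search for a Hamiltonian cycle: [k] vertices are still to be appended to a path
    ending in [v], which must finally close up at [z]. The conditional, in place of a conjunction,
    keeps call-by-value evaluation from exploring rejected branches. *)
Fixpoint search (e : rel nat) (T : seq nat) (k z v : nat) (vis : seq nat) :=
  if k is k'.+1 then
    has (fun u => if e v u && (u \notin vis)
                  then search e T k' z u (u :: vis) else false) T
  else e v z.

Lemma search_complete n (e : rel nat) z v vis (p : seq 'I_n) :
  path (fun x y : 'I_n => e x y) v p -> uniq p ->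
  {in p, forall x : 'I_n, (x : nat) \notin vis} -> e (last v p) z ->
  search e (iota 0 n) (size p) z v vis.
Proof.
elim: p v vis => //= u p IH v vis /andP[vu up] /andP[unp pu] np lz.
apply/hasP; exists (nat_of_ord u); first by rewrite mem_iota ltn_ord.
rewrite vu np ?mem_head //=; apply: IH => // x xp.
rewrite inE negb_or np ?inE ?xp ?orbT // andbT.
by apply: contraNN unp => /eqP/val_inj <-.
Qed.

Definition hamiltonian_test n r z :=
  let t := table n (edge r) in search (lookup t) (iota 0 n) n.-1 z z [:: z].

Lemma hamiltonian_graph_of n r (z : 'I_n) :
  hamiltonian (graph_of n r) -> hamiltonian_test n r z.
Proof.
case=> c [c2 /andP[cyc uc] call].
have [i c' E] := rot_to (call z).
have cyc' : cycle (@adj (graph_of n r)) (z :: c') by rewrite -E rot_cycle.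
have uc' : uniq (z :: c') by rewrite -E rot_uniq.
have szc : size c' = n.-1.
  have : size (z :: c') = #|'I_n|.
    rewrite -E size_rot; have /card_uniqP <- := uc.
    by apply: eq_card => x; rewrite call.
  by rewrite card_ord /= => eq_n; rewrite -[in RHS]eq_n.
rewrite /hamiltonian_test -szc; move: cyc' uc' => /=.
rewrite rcons_path => /andP[pc lc] /andP[zc uc'].
apply: search_complete => // [|x xc|].
- rewrite -(eq_path (e := @adj (graph_of n r))) // => x y.
  by rewrite lookup_table ?ltn_ord.
- rewrite inE; by apply: contraNN zc => /eqP/val_inj <-.
- by rewrite lookup_table ?ltn_ord.
Qed.

Definition degree n r v := count (edge r v) (iota 0 n).

Lemma deg_graph_of n r (v : graph_of n r) : deg v = degree n r (v : 'I_n).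
Proof.
rewrite /deg /degree -val_enum_ord count_map cardE size_filter enumT.
by apply: eq_count => u; rewrite !inE.
Qed.

(** The pairs at distance 2 in a claw are its pairs of leaves, hence the loop over nonadjacent
    neighbours [u], [v] of a centre; the inner [all] says that no third leaf completes them. *)
Definition claw_test n r :=
  let T := iota 0 n in
  all (fun c =>
    let N := [seq u <- T | edge r c u] in
    all (fun u => all (fun v =>
      all (fun w => [|| u == w, v == w, edge r u w | edge r v w]) N
      || (n <= 2 * maxn (degree n r u) (degree n r v)))
      [seq v <- N | (u != v) && ~~ edge r u v]) N) T.

Lemma claw_f_heavy_graph_of n r : claw_test n r -> f_heavy claw (graph_of n r).
Proof.
move=> test A [f [[g fK gK] fP]] u v [[p [up _ lastp] sz] dist].
pose nv (x : induced A) : nat := nat_of_ord (val x).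
have mem x : nv x \in iota 0 n by rewrite mem_iota ltn_ord.
have ne : u != v by apply/eqP => E; have := dist [::] (And3 isT isT E).
have na : ~~ adj u v.
  apply/negP=> uv; suff /dist : path_between u v [:: v] by [].
  by split; rewrite //= ?andbT ?inE //; exact: uv.
have nef : f u != f v by rewrite (inj_eq (can_inj fK)).
have naf : ~~ adj (f u) (f v) by rewrite fP.
pose c : claw := (ord0 : 'I_4).
have [k [cu cv ck [ku kv] [nuk nvk]]] : exists k : claw,
  [/\ adj c (f u), adj c (f v), adj c k,
      f u != k /\ f v != k & ~~ adj (f u) k /\ ~~ adj (f v) k].
  pose o i (lt : i < 4) : claw := Ordinal lt.
  move: (f u) (f v) nef naf => [[|[|[|[|//]]]] ltu] [[|[|[|[|//]]]] ltv] // _ _;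
  by [exists (o 1 isT)|exists (o 2 isT)|exists (o 3 isT)].
have gP x y : adj (g x) (g y) = adj x y by rewrite -fP !gK.
have vne (x y : induced A) : x != y -> nv x != nv y.
  by move=> xy; rewrite /nv !(inj_eq val_inj).
have gne x : f x != k -> x != g k.
  by apply: contraNneq => ->; rewrite gK.
rewrite !deg_graph_of card_ord.
have edgeE (x y : induced A) :
  edge r (nv x) (nv y) = adj (f x) (f y) by rewrite fP.
have nbr x : adj c (f x) ->
  (nv x) \in [seq l <- iota 0 n | edge r (nv (g c)) l].
  by move=> cx; rewrite mem_filter mem edgeE gK cx.
have vu : (nv v) \in
    [seq l <- [seq l <- iota 0 n | edge r (nv (g c)) l]
      | (nv u != l) && ~~ edge r (nv u) l].
  by rewrite mem_filter vne // nbr // edgeE naf.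
move/allP/(_ _ (mem (g c)))/allP/(_ _ (nbr _ cu))/allP/(_ _ vu): test.
case/orP=> // /allP/(_ (nv (g k))).
rewrite nbr ?gK // !edgeE gK (negPf nuk) (negPf nvk).
by rewrite !(negPf (vne _ _ (gne _ _))) // => /(_ isT).
Qed.

Definition heavy_pair n r (i j : nat) :=
  [&& i != j, ~~ edge r i j & n <= degree n r i + degree n r j].

Definition o_heavy_test m s n r :=
  let t := table n (edge r) in
  let h := table n (heavy_pair n r) in
  ~~ embedb (edge s) (lookup t) (iota 0 n)
       (fun M => ~~ has (fun p => has (fun q => lookup h p.2 q.2) M) M)
       (iota 0 m) [::].

Lemma o_heavy_graph_of m s n r :
  o_heavy_test m s n r -> o_heavy (graph_of m s) (graph_of n r).
Proof.
move=> test A [f [[g fK gK] fP]].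
have gP x y : adj (g x) (g y) = adj x y by rewrite -fP !gK.
(* [inord] needs an index type of the form ['I_m.+1]. For [m = 0] the test is false, since the empty
   copy has no heavy pair. *)
case: m => [|m] in f g fK gK fP gP test *; first by [].
pose h i : 'I_n := val (g (inord i)).
pose M := [seq (x, nat_of_ord (h x)) | x <- catrev (iota 0 m.+1) [::]].
have [/hasP[p pM /hasP[q qM]]|nh] :=
  boolP (has (fun p => has (fun q => lookup (table n (heavy_pair n r)) p.2 q.2) M) M).
  case/mapP: pM qM => i _ -> /mapP[j _ ->] /=.
  rewrite lookup_table ?ltn_ord // => /and3P[ne na le].
  exists (h i), (h j); split=> //; first exact: valP; first exact: valP.
  by rewrite card_ord !deg_graph_of.
case/negP: test; apply: (@embedb_complete _ _ _ _ h _ [::]) => //.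
- by rewrite cats0 iota_uniq.
- by move=> x _; rewrite mem_iota ltn_ord.
- move=> x y; rewrite !cats0 !mem_iota /= => xm ym /val_inj/val_inj/(can_inj gK).
  by move=> /(congr1 val); rewrite /= !inordK.
- move=> x y; rewrite !cats0 !mem_iota /= => xm ym.
  have := gP (inord x) (inord y); rewrite !adj_graph_of !inordK // => <-.
  by rewrite lookup_table ?ltn_ord.
Qed.

(** * The nonhamiltonian examples and necessity *)

Definition two_triangles := triangle_edges ++ [:: (3, 4); (4, 5); (5, 3)].

(** This is P_{3,3,3}, and [triangle_ties] is P_{T,T,T}, in Brousek's family of minimal 2-connected
    nonhamiltonian claw-free graphs. *)
Definition long_ties := two_triangles ++
  [:: (0, 6); (6, 3); (1, 7); (7, 4); (2, 8); (8, 5)].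

Definition triangle_ties := long_ties ++ [:: (0, 3); (1, 4); (2, 5)].

(* The triangle 0, 1, 2 of [triangle_ties] is replaced by three independent
   vertices joined to a clique 9, ..., 13. *)
Definition heavy_ties :=
  [:: (3, 4); (4, 5); (5, 3)] ++ drop 6 triangle_ties ++
  [seq (i, j) | i <- [:: 0; 1; 2; 9; 10; 11; 12; 13], j <- iota 9 5].

(** The vertices 6, 7, 8 have degree 2, so a Hamiltonian cycle would run along all three ties and
    pass between the triangles an odd number of times. *)
Lemma triangle_ties_facts :
  [&& two_connected_test 9 triangle_ties, claw_test 9 triangle_ties
    & ~~ hamiltonian_test 9 triangle_ties 6].
Proof. by vm_compute. Qed.

Lemma long_ties_facts :
  [&& two_connected_test 9 long_ties, claw_test 9 long_ties
    & ~~ hamiltonian_test 9 long_ties 6].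
Proof. by vm_compute. Qed.

Definition path_edges n := [seq (k, k.+1) | k <- iota 0 n.-1].

(** With a clique of order k, its vertices and 0, 1, 2 have degree k + 2 in a graph of order k + 9;
    k = 5 is the least value for which this reaches half the order. The leaves of every claw are 0,
    1, 2, and an induced path on six vertices meets two of these three. The parity argument for the
    ties is unchanged. *)
Lemma heavy_ties_facts :
  [&& two_connected_test 14 heavy_ties, claw_test 14 heavy_ties
    & ~~ hamiltonian_test 14 heavy_ties 9]
  && o_heavy_test 6 (path_edges 6) 14 heavy_ties.
Proof. by vm_compute. Qed.

(** The first eight entries are the graphs of the theorem in its order; the two last ones are
    excluded by hypothesis and by [heavy_ties]. *)
Definition sporadic : seq (nat * seq (nat * nat)) :=
  [:: (4, path_edges 4); (5, path_edges 5); (3, triangle_edges);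
      (1 + 3, triangle_edges ++ [seq (k, k.+1) | k <- iota 2 1]);
      (2 + 3, triangle_edges ++ [seq (k, k.+1) | k <- iota 2 2]);
      (5, triangle_edges ++ [:: (0, 3); (1, 4)]);
      (6, triangle_edges ++ [:: (0, 3); (1, 4); (2, 5)]);
      (6, triangle_edges ++ [:: (0, 3); (3, 5); (1, 4)]);
      (3, path_edges 3); (6, path_edges 6)].

Definition triangle_ties_adj := lookup (table 9 (edge triangle_ties)).

(** A graph embedded in [triangle_ties] occupies one of 512 vertex subsets, which makes the
    classification a finite check; at equal orders an embedding is an isomorphism. *)
Lemma common_induced_subgraphs :
  all (fun L => if (size L < 3) || disconnected_test triangle_ties_adj L then true
    else if embeds_in triangle_ties_adj L 9 long_ties then
      has (fun ns => if ns.1 == size L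
                     then embeds_in triangle_ties_adj L ns.1 ns.2 else false)
        sporadic
    else true)
    (sublists (iota 0 9)).
Proof. by vm_compute. Qed.

Lemma nonhamiltonian_embeds (S : sgraph) n r (z : 'I_n) :
  (forall G : sgraph, two_connected G -> f_heavy claw G ->
     o_heavy S G -> hamiltonian G) ->
  [&& two_connected_test n r, claw_test n r & ~~ hamiltonian_test n r z] ->
  ~ o_heavy S (graph_of n r).
Proof.
move=> imp /and3P[/two_connected_graph_of G2 /claw_f_heavy_graph_of Gc].
by move=> /negP nh /(imp _ G2 Gc) /(hamiltonian_graph_of _ _ z).
Qed.

Lemma necessity (S : sgraph) : connected S -> 3 <= #|S| ->
  ~ isomorphic S (Pgraph 3) ->
  (forall G : sgraph, two_connected G -> f_heavy claw G ->
     o_heavy S G -> hamiltonian G) ->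
  isomorphic S (Pgraph 4) \/ isomorphic S (Pgraph 5) \/ isomorphic S C3 \/
  isomorphic S (Zgraph 1) \/ isomorphic S (Zgraph 2) \/
  isomorphic S bull \/ isomorphic S net \/ isomorphic S wounded.
Proof.
move=> con S3 nP3 imp.
have emb r : [&& two_connected_test 9 r, claw_test 9 r
    & ~~ hamiltonian_test 9 r 6] -> embeds S (graph_of 9 r).
  move=> ok; have [//|nemb] := embeds_decidable S (graph_of 9 r).
  case: (nonhamiltonian_embeds S 9 r (@Ordinal 9 6 isT) imp ok).
  by move=> A /embeds_induced.
have [h hI hP] := emb _ triangle_ties_facts.
pose a := triangle_ties_adj; pose k x := nat_of_ord (h x).
(* The numbers occupied by the copy of [S], in increasing order, so that they form one of the
   enumerated sublists. *)
pose L := [seq i <- iota 0 9 | i \in [seq k x | x : S]].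
have uL : uniq L by rewrite filter_uniq ?iota_uniq.
have LP l : l \in L <-> exists x, l = k x.
  rewrite mem_filter; split=> [/andP[/imageP[x _ ->]] _|[x ->]]; first by exists x.
  by rewrite image_f // mem_iota ltn_ord.
have kI : injective k by move=> x y /val_inj/hI.
have kP x y : a (k x) (k y) = adj x y.
  by rewrite -hP /a /triangle_ties_adj lookup_table ?ltn_ord.
have a_sym : symmetric a := lookup_sym _ _.
have a_irr : irreflexive a := lookup_irrefl _ _.
have sizeL := card_carried S k kI L uL LP.
have isoL n s : n == size L -> embeds_in a L n s -> isomorphic S (graph_of n s).
  move/eqP=> nL emb_in.
  by apply: (isomorphic_list S a k a_sym a_irr kI kP L uL LP) => //; rewrite nL.
have := allP common_induced_subgraphs _ (filter_sublists _ _ : L \in _).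
rewrite -sizeL ltnNge S3 orFb.
case: ifP => [dis _|_].
  by case: (disconnectedP S a k kI kP L uL LP dis con).
case: ifP => [_|]; last first.
  move/negP; case; apply/(embeds_inP S a k a_sym a_irr kI kP L uL LP).
  exact: emb long_ties_facts.
have P6 : ~ isomorphic S (graph_of 6 (path_edges 6)).
  move=> iso; have /andP[ok o] := heavy_ties_facts.
  case: (nonhamiltonian_embeds S 14 heavy_ties (@Ordinal 14 9 isT) imp ok).
  apply: o_heavy_of_embeds (o_heavy_graph_of _ _ _ _ o).
  exact/isomorphic_embeds/isomorphic_sym.
rewrite sizeL => /hasP[ns ns_in]; case: ifP => // n_eq /(isoL _ _ n_eq).
move: ns_in {n_eq}; rewrite !inE.
do 8! [case/predU1P=> [->|]; first by tauto].
by case/predU1P=> [-> //|/eqP-> //].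
Qed.

Set Implicit Arguments.
Unset Strict Implicit.
Unset Printing Implicit Defensive.

(** Equality of multisets becomes linear arithmetic in the counts of an arbitrary predicate. *)
Ltac perm_count :=
  let a := fresh "a" in
  apply/permP => a;
  repeat match goal with
    | H : is_true (perm_eq _ _) |- _ => move/permP/(_ a): H
    end;
  do 4 rewrite ?(count_cat, count_rev) /=;
  repeat match goal with
    | |- context [nat_of_bool ?b] => generalize (nat_of_bool b)
    | |- context [@count ?T ?b ?A] => generalize (@count T b A)
    end;
  clear; intros; lia.

Ltac size_lia :=
  do 4 rewrite ?size_cat /=;
  repeat match goal with
    | |- context [@size ?T ?s] => generalize (@size T s)
    end;
  clear; intros; lia.

(** * Spanning paths of regions and their gluing *)

Section SpanningPaths.
Variables (T : eqType) (e : rel T).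
Hypothesis e_sym : symmetric e.

(** The list [D] matters only up to permutation. The path is simple as soon as [D] is
    duplicate-free, so gluing needs no disjointness conditions. *)
Definition hpath (x y : T) (D : seq T) : Prop :=
  exists p, [/\ path e x p, last x p = y & perm_eq (x :: p) D].

Lemma hpath_perm x y D D' : perm_eq D D' -> hpath x y D -> hpath x y D'.
Proof. by move=> DD' [p [? ? pD]]; exists p; split=> //; apply: perm_trans DD'. Qed.

Lemma hpath1 x : hpath x x [:: x].
Proof. by exists [::]. Qed.

Lemma hpath_cat x y z w A B :
  hpath x y A -> e y z -> hpath z w B -> hpath x w (A ++ B).
Proof.
move=> [p [xp lp pA]] yz [q [zq lq qB]]; exists (p ++ z :: q); split.
- by rewrite cat_path xp lp /= yz.
- by rewrite last_cat.
by rewrite -cat_cons perm_cat.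
Qed.

Lemma hpath_sym x y D : hpath x y D -> hpath y x D.
Proof.
case=> p [xp <- pD]; exists (rev (belast x p)); split.
- by rewrite rev_path -(eq_path (e := e)) // => u v; rewrite e_sym.
- by case: p {xp pD} => //= u p; rewrite rev_cons last_rcons.
- by rewrite -rev_rcons -lastI perm_rev.
Qed.

Lemma hpath_seg x p : path e x p -> hpath x (last x p) (x :: p).
Proof. by exists p. Qed.

Lemma hpath_cons x y z A : e x y -> hpath y z A -> hpath x z (x :: A).
Proof. by move=> xy; apply: hpath_cat (hpath1 x) xy. Qed.

Lemma hpath_rcons x y z A : hpath x y A -> e y z -> hpath x z (z :: A).
Proof.
by move=> xy yz; apply: hpath_perm (hpath_cat xy yz (hpath1 z)); perm_count.
Qed.

Lemma hpath_mem x y D : hpath x y D -> x \in D.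
Proof. by case=> p [_ _ pD]; rewrite -(perm_mem pD) mem_head. Qed.

(* Spanning pair of disjoint paths, from [a] to [b] and from [c] to [t]. *)
Definition hpair D a b c t : Prop :=
  exists A B, [/\ hpath a b A, hpath c t B & perm_eq (A ++ B) D].

Lemma hpairC D a b c t : hpair D a b c t -> hpair D b a c t.
Proof. by case=> A [B [/hpath_sym hA hB pD]]; exists A, B. Qed.

(* [D] has spanning paths between any two of its terminals [x1], [x2], [x3], and
   attaching a further vertex both to a terminal and to some other vertex of [D]
   preserves this. *)
Record good (D : seq T) (x1 x2 x3 : T) : Prop := Good {
  good_uniq : uniq [:: x1; x2; x3];
  good_sub : {subset [:: x1; x2; x3] <= D};
  good12 : hpath x1 x2 D;
  good13 : hpath x1 x3 D;
  good23 : hpath x2 x3 D;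
  good1 : hpair D x2 x3 x1 x1;
  good2 : hpair D x1 x3 x2 x2;
  good3 : hpair D x1 x2 x3 x3;
  good_inner : forall t, t \in D -> t \notin [:: x1; x2; x3] ->
    [/\ hpair D x2 x3 x1 t \/ hpair D x1 x3 x2 t,
        hpair D x2 x3 x1 t \/ hpair D x1 x2 x3 t &
        hpair D x1 x3 x2 t \/ hpair D x1 x2 x3 t] }.

Lemma good_swap12 D x1 x2 x3 : good D x1 x2 x3 -> good D x2 x1 x3.
Proof.
case=> u s h12 h13 h23 k1 k2 k3 ki; split=> //.
- by move: u; rewrite /= !inE !negb_or eq_sym; case/and3P=> /andP[-> ->] ->.
- by move=> t; rewrite !inE orbCA => ?; apply: s; rewrite !inE.
- exact: hpath_sym.
- exact: hpairC.
move=> t tD tn; have tn' : t \notin [:: x1; x2; x3] by move: tn; rewrite !inE orbCA.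
have [a b c] := ki t tD tn'; have := @hpairC D x1 x2 x3 t; split; tauto.
Qed.

Lemma good_swap23 D x1 x2 x3 : good D x1 x2 x3 -> good D x1 x3 x2.
Proof.
case=> u s h12 h13 h23 k1 k2 k3 ki; split=> //.
- by move: u; rewrite /= !inE !negb_or [x2 == x3]eq_sym;
    case/and3P=> /andP[-> ->] ->.
- by move=> t; rewrite !inE [(t == x3) || _]orbC => ?; apply: s; rewrite !inE.
- exact: hpath_sym.
- exact: hpairC.
move=> t tD tn; have tn' : t \notin [:: x1; x2; x3].
  by move: tn; rewrite !inE [(t == x3) || _]orbC.
have [a b c] := ki t tD tn'; have := @hpairC D x2 x3 x1 t; split; tauto.
Qed.

(** At an inner vertex at most one of the three pairings fails. *)
Lemma good_pair12 D x1 x2 x3 t : good D x1 x2 x3 -> t \in D -> t != x3 ->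
  hpair D x2 x3 x1 t \/ hpair D x1 x3 x2 t.
Proof.
case=> _ _ _ _ _ k1 k2 _ ki tD t3.
have [->|t1] := eqVneq t x1; first by left.
have [->|t2] := eqVneq t x2; first by right.
by case: (ki t tD) => //; rewrite !inE !negb_or t1 t2 t3.
Qed.

Lemma good_triangle x1 x2 x3 : uniq [:: x1; x2; x3] ->
  e x1 x2 -> e x1 x3 -> e x2 x3 -> good [:: x1; x2; x3] x1 x2 x3.
Proof.
have h2 x y : e x y -> hpath x y [:: x; y] by move=> xy; apply: hpath_cons (hpath1 y).
have p2 D a b c : e a b -> perm_eq [:: a; b; c] D -> hpair D a b c c.
  by move=> ab pD; exists [:: a; b], [:: c]; split; [exact: h2|exact: hpath1|].
move=> u e12 e13 e23; have [e21 e31 e32] : [/\ e x2 x1, e x3 x1 & e x3 x2].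
  by rewrite !(e_sym _ x1) (e_sym x3).
split=> //.
- by apply: (@hpath_perm _ _ [:: x1; x3; x2]);
    [perm_count|apply: hpath_cons e13 (h2 _ _ e32)].
- by apply: hpath_cons e12 (h2 _ _ e23).
- by apply: (@hpath_perm _ _ [:: x2; x1; x3]);
    [perm_count|apply: hpath_cons e21 (h2 _ _ e13)].
- by apply: p2 => //; perm_count.
- by apply: p2 => //; perm_count.
- exact: p2.
- by move=> t ->.
Qed.

(** The pairing at [s] has a path from one of [x1], [x2] to [x3] and a path from the other to [s];
    inserting [p] between [x3] and [s] connects [x1] with [x2]. Paths ending in [x3] are prolonged
    to [p]. *)
Lemma good_extend D x1 x2 x3 p s : good D x1 x2 x3 -> p \notin D ->
  e x3 p -> s \in D -> s != x3 -> e p s -> good (p :: D) x1 x2 p.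
Proof.
move=> g pD e3 sD s3 ps; have [u sub h12 h13 h23 k1 k2 k3 ki] := g.
have ne x : x \in [:: x1; x2; x3] -> x != p.
  by move=> /sub; apply: contraTneq => ->.
have sp : e s p by rewrite e_sym.
have e3' : e p x3 by rewrite e_sym.
(* [p] lies between [x3] and [s]. *)
have thr a b : hpair D a x3 b s -> hpath a b (p :: D).
  case=> A [B [hA hB pAB]].
  apply: (@hpath_perm _ _ (A ++ p :: B)); first by perm_count.
  by apply: hpath_cat hA e3 _; apply: hpath_cons ps (hpath_sym hB).
have ext1 a b t : hpair D a x3 b t -> hpair (p :: D) a p b t.
  case=> A [B [hA hB pAB]]; exists (p :: A), B; split=> //.
    exact: hpath_rcons hA e3.
  by perm_count.
have ext3 a b t : hpair D a b x3 t -> hpair (p :: D) a b p t.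
  case=> A [B [hA hB pAB]]; exists A, (p :: B); split=> //.
    exact: hpath_cons e3' hB.
  by perm_count.
split=> //.
- by move: u; rewrite /= !inE !negb_or !ne ?inE ?eqxx ?orbT // !andbT => /andP[/andP[]].
- move=> t; rewrite !inE orbA => /orP[t12|->//]; rewrite sub ?orbT // !inE.
  by case/orP: t12 => ->; rewrite ?orbT.
- by case: (good_pair12 g sD s3) => [/thr/hpath_sym|/thr].
- exact: hpath_rcons h13 e3.
- exact: hpath_rcons h23 e3.
- exact: ext1.
- exact: ext1.
- by exists D, [:: p]; split; [exact: h12|exact: hpath1|perm_count].
move=> t; rewrite !inE => /predU1P[->|tD]; first by rewrite eqxx !orbT.
rewrite !negb_or => /and3P[t1 t2 tp].
(* The old terminal [x3] is now an inner vertex: in the pairing at [s], the path to [s] is prolonged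
   to [p] and the other path ends in [x3]. *)
have [->|t3] := eqVneq t x3.
  have K3 : hpair (p :: D) x1 x2 p x3 by apply: ext3.
  suff : hpair (p :: D) x2 p x1 x3 \/ hpair (p :: D) x1 p x2 x3 by split; tauto.
  have [] := good_pair12 g sD s3.
    case=> A [B [hA hB pAB]]; right; exists (p :: B), A; split=> //.
      exact: hpath_rcons hB sp.
    by perm_count.
  case=> A [B [hA hB pAB]]; left; exists (p :: B), A; split=> //.
    exact: hpath_rcons hB sp.
  by perm_count.
have [|a b c] := ki t tD; first by rewrite !inE !negb_or t1 t2 t3.
have := ext1 x2 x1 t; have := ext1 x1 x2 t; have := ext3 x1 x2 t.
by split; tauto.
Qed.

(** Paths ending in [x2] or [x3] are prolonged to [p] or [q]; a path from [x1] to [p] reaches it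
    through [x3] and [q], and symmetrically for [q]. *)
Lemma good_extend2 D x1 x2 x3 p q : good D x1 x2 x3 ->
  p != q -> p \notin D -> q \notin D -> e x2 p -> e x3 q -> e p q ->
  good (p :: q :: D) x1 p q.
Proof.
move=> [u sub h12 h13 h23 k1 k2 k3 ki] npq pD qD e2 e3 pq.
have [e2' e3' qp] : [/\ e p x2, e q x3 & e q p] by rewrite !(e_sym p) !(e_sym q).
have nep x : x \in [:: x1; x2; x3] -> x != p.
  by move=> /sub; apply: contraTneq => ->.
have neq x : x \in [:: x1; x2; x3] -> x != q.
  by move=> /sub; apply: contraTneq => ->.
have ext1 t : hpair D x2 x3 x1 t -> hpair (p :: q :: D) p q x1 t.
  case=> A [B [hA hB pAB]]; exists (p :: q :: A), B; split=> //.
    by apply: hpath_cons e2' (hpath_rcons hA e3).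
  by perm_count.
have ext2 t : hpair D x1 x3 x2 t -> hpair (p :: q :: D) x1 q p t.
  case=> A [B [hA hB pAB]]; exists (q :: A), (p :: B); split=> //.
  - exact: hpath_rcons hA e3.
  - exact: hpath_cons e2' hB.
  - by perm_count.
have ext3 t : hpair D x1 x2 x3 t -> hpair (p :: q :: D) x1 p q t.
  case=> A [B [hA hB pAB]]; exists (p :: A), (q :: B); split=> //.
  - exact: hpath_rcons hA e2.
  - exact: hpath_cons e3' hB.
  - by perm_count.
have hp : hpath x1 p (p :: q :: D).
  exact: hpath_rcons (hpath_rcons h13 e3) qp.
have hq : hpath x1 q (p :: q :: D).
  apply: (@hpath_perm _ _ (q :: p :: D)); first by perm_count.
  exact: hpath_rcons (hpath_rcons h12 e2) pq.
(* The pair [p], [q] alone is one of the paths, which leaves all of [D] for a path from [x1] to a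
   former terminal. *)
have top t : hpath x1 t D -> hpair (p :: q :: D) p q x1 t.
  by move=> ht; exists [:: p; q], D; split=> //; apply: hpath_cons pq (hpath1 _).
split=> //.
- by rewrite /= !inE !negb_or npq nep ?neq ?inE ?eqxx.
- move=> t; rewrite !inE => /or3P[] /eqP->; rewrite ?eqxx ?orbT //.
  by rewrite sub ?inE ?eqxx ?orbT.
- exact: hpath_cons e2' (hpath_rcons h23 e3).
- exact: ext1.
- by exists (q :: D), [:: p]; split; [exact: (hpath_rcons h13 e3)|exact: hpath1|perm_count].
- exists (p :: D), [:: q]; split; [exact: (hpath_rcons h12 e2)|exact: hpath1|perm_count].
move=> t; rewrite !inE !negb_or => /or3P[/eqP->|/eqP->|tD].
- by rewrite eqxx andbF.
- by rewrite eqxx !andbF.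
case/and3P=> t1 tp tq.
have [t2|t2] := eqVneq t x2.
  have := top t; have := ext2 t; rewrite t2; split; tauto.
have [t3|t3] := eqVneq t x3.
  have := top t; have := ext3 t; rewrite t3; split; tauto.
have [|a b c] := ki t tD; first by rewrite !inE !negb_or t1 t2 t3.
have := ext1 t; have := ext2 t; have := ext3 t; split; tauto.
Qed.

Definition link (x : T) (Q : seq T) (y p r : T) : Prop :=
  [/\ e x p, hpath p r Q & e r y].

Lemma link_sym x Q y p r : link x Q y p r -> link y Q x r p.
Proof. by case=> xp pr ry; split; [rewrite e_sym|exact: hpath_sym|rewrite e_sym]. Qed.

Lemma path_link x Q y : path e x (rcons Q y) -> Q != [::] ->
  link x Q y (head x Q) (last x Q).
Proof.
by case: Q => //= p Q /andP[xp]; rewrite rcons_path => /andP[pq qy] _; split=> //; exact: hpath_seg.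
Qed.

Lemma hpath_link A Q B a x y p r b :
  hpath a x A -> link x Q y p r -> hpath y b B -> hpath a b (A ++ Q ++ B).
Proof.
move=> aA [xp pr ry] bB; apply: hpath_cat aA xp _; exact: hpath_cat pr ry bB.
Qed.

Section Gluing.
Variables (Du Dv Q1 Q2 Q3 : seq T).
Variables (x1 x2 x3 y1 y2 y3 p1 p2 p3 r1 r2 r3 : T).
Hypotheses (L1 : link x1 Q1 y1 p1 r1) (L2 : link x2 Q2 y2 p2 r2)
  (L3 : link x3 Q3 y3 p3 r3).

(** A zigzag: [s] to [x1], along [Q1], through [Dv] to [y3], back along [Q3], through [Du] to [x2],
    along [Q2], and on to [t]. *)
Lemma glue_cross s t : hpair Du x2 x3 x1 s -> hpair Dv y1 y3 y2 t ->
  hpath s t (Du ++ Dv ++ Q1 ++ Q2 ++ Q3).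
Proof.
case=> A [B [hA /hpath_sym hB pA]] [A' [B' [hA' hB' pA']]].
have h1 := hpath_link hB L1 hA'.
have h2 := hpath_link h1 (link_sym L3) (hpath_sym hA).
have h3 := hpath_link h2 L2 hB'.
by apply: hpath_perm h3; perm_count.
Qed.

Lemma glue_end s : hpair Du x1 x2 x3 s -> hpath y1 y3 Dv ->
  hpath s r2 (Du ++ Dv ++ Q1 ++ Q2 ++ Q3).
Proof.
case=> A [B [hA /hpath_sym hB pA]] /hpath_sym hD.
have h1 := hpath_link hB L3 hD.
have h2 := hpath_link h1 (link_sym L1) hA.
have [xp pr _] := L2.
by apply: hpath_perm (hpath_cat h2 xp pr); perm_count.
Qed.

Lemma glue_ends : hpath x2 x3 Du -> hpath y1 y3 Dv ->
  hpath p1 r2 (Du ++ Dv ++ Q1 ++ Q2 ++ Q3).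
Proof.
move=> /hpath_sym hu hv.
have [_ pr ry] := L1; have [xp2 pr2 _] := L2.
have h1 := hpath_cat pr ry hv.
have h2 := hpath_link h1 (link_sym L3) hu.
by apply: hpath_perm (hpath_cat h2 xp2 pr2); perm_count.
Qed.

(** Here [Q1] stays outside, and [A] will be [Du] enlarged by vertices off the cycle. *)
Lemma glue_two a A : hpath a x3 A -> hpath y2 y3 Dv ->
  hpath a p2 (A ++ Dv ++ Q2 ++ Q3).
Proof.
move=> hA /hpath_sym hv.
have [_ _ ry] := L2; have [_ /hpath_sym rp _] := L2.
have h1 := hpath_link hA L3 hv.
have yr : e y2 r2 by rewrite e_sym.
by apply: hpath_perm (hpath_cat h1 yr rp); perm_count.
Qed.

End Gluing.

Lemma good_pairs D x1 x2 x3 t : good D x1 x2 x3 -> t \in D ->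
  [\/ t = x1 /\ hpair D x2 x3 x1 t, t = x2 /\ hpair D x1 x3 x2 t,
      t = x3 /\ hpair D x1 x2 x3 t |
      [/\ hpair D x2 x3 x1 t \/ hpair D x1 x3 x2 t,
        hpair D x2 x3 x1 t \/ hpair D x1 x2 x3 t &
        hpair D x1 x3 x2 t \/ hpair D x1 x2 x3 t]].
Proof.
case=> _ _ _ _ _ k1 k2 k3 ki tD.
have [->|t1] := eqVneq t x1; first by constructor 1.
have [->|t2] := eqVneq t x2; first by constructor 2.
have [->|t3] := eqVneq t x3; first by constructor 3.
by constructor 4; apply: ki; rewrite // !inE !negb_or t1 t2.
Qed.

(** A zigzag exists whenever the pairings at [s] and at [t] have different indices. A terminal has
    the pairing of its own index and an inner vertex has at least two, so only terminals of equal
    index escape. *)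
Lemma crossing Du Dv Q1 Q2 Q3 x1 x2 x3 y1 y2 y3 p1 p2 p3 r1 r2 r3 s t :
  good Du x1 x2 x3 -> good Dv y1 y2 y3 ->
  link x1 Q1 y1 p1 r1 -> link x2 Q2 y2 p2 r2 -> link x3 Q3 y3 p3 r3 ->
  s \in Du -> t \in Dv ->
  [\/ s = x1 /\ t = y1, s = x2 /\ t = y2 | s = x3 /\ t = y3] \/
  hpath s t (Du ++ Dv ++ Q1 ++ Q2 ++ Q3).
Proof.
move=> gu gv L1 L2 L3 sD tD.
set H := hpath s t _.
have c12 : hpair Du x2 x3 x1 s -> hpair Dv y1 y3 y2 t -> H.
  by move=> hu hv; exact: (glue_cross L1 L2 L3 hu hv).
have c13 : hpair Du x2 x3 x1 s -> hpair Dv y1 y2 y3 t -> H.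
  move=> /hpairC hu hv; apply: hpath_perm (glue_cross L1 L3 L2 hu hv).
  by perm_count.
have c21 : hpair Du x1 x3 x2 s -> hpair Dv y2 y3 y1 t -> H.
  move=> hu hv; apply: hpath_perm (glue_cross L2 L1 L3 hu hv).
  by perm_count.
have c23 : hpair Du x1 x3 x2 s -> hpair Dv y1 y2 y3 t -> H.
  move=> /hpairC hu /hpairC hv; apply: hpath_perm (glue_cross L2 L3 L1 hu hv).
  by perm_count.
have c31 : hpair Du x1 x2 x3 s -> hpair Dv y2 y3 y1 t -> H.
  move=> hu /hpairC hv; apply: hpath_perm (glue_cross L3 L1 L2 hu hv).
  by perm_count.
have c32 : hpair Du x1 x2 x3 s -> hpair Dv y1 y3 y2 t -> H.
  move=> /hpairC hu /hpairC hv; apply: hpath_perm (glue_cross L3 L2 L1 hu hv).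
  by perm_count.
have := good_pairs gu sD; have := good_pairs gv tD.
set K1 := hpair Dv y2 y3 y1 t in c21 c31 *; set K2 := hpair Dv y1 y3 y2 t in c12 c32 *.
set K3 := hpair Dv y1 y2 y3 t in c13 c23 *.
set J1 := hpair Du x2 x3 x1 s in c12 c13 *; set J2 := hpair Du x1 x3 x2 s in c21 c23 *.
set J3 := hpair Du x1 x2 x3 s in c31 c32 *.
case=> [[Et k]|[Et k]|[Et k]|[a b c]]; case=> [[Es j]|[Es j]|[Es j]|[a' b' c']];
  first [by left; constructor 1|by left; constructor 2|by left; constructor 3|right; tauto].
Qed.
Lemma good_end Du Dv Q1 Q2 Q3 x1 x2 x3 y1 y2 y3 p1 p2 p3 r1 r2 r3 s :
  good Du x1 x2 x3 -> good Dv y1 y2 y3 ->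
  link x1 Q1 y1 p1 r1 -> link x2 Q2 y2 p2 r2 -> link x3 Q3 y3 p3 r3 ->
  s \in Du -> s != x2 -> hpath s r2 (Du ++ Dv ++ Q1 ++ Q2 ++ Q3).
Proof.
move=> gu gv L1 L2 L3 sD s2.
case: (good_pair12 (good_swap23 gu) sD s2) => h.
  have h2 := glue_end L3 L2 L1 h (hpath_sym (good13 gv)).
  apply: hpath_perm h2.
  by perm_count.
have h2 := glue_end L1 L2 L3 h (good13 gv).
exact: h2.
Qed.
End SpanningPaths.

(** * Cycles of o-adjacent vertices and the circumference *)

Section OCycles.
Variable G : sgraph.
Implicit Types (x y z : G) (p q c : seq G).

(* o-adjacency: the pairs which the Bondy-Chvatal closure joins in one step. *)
Definition oadj : rel G := fun x y => adj x y || (#|G| <= deg x + deg y).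

Lemma oadj_sym : symmetric oadj.
Proof. by move=> x y; rewrite /oadj adj_sym addnC. Qed.

Lemma adj_oadj x y : adj x y -> oadj x y.
Proof. by rewrite /oadj => ->. Qed.

Fixpoint nonedges x p :=
  if p is y :: p' then ~~ adj x y + nonedges y p' else 0.

Lemma nonedges_cat x p q :
  nonedges x (p ++ q) = nonedges x p + nonedges (last x p) q.
Proof. by elim: p x => //= y p IH x; rewrite IH addnA. Qed.

Lemma nonedges_rev x p : nonedges (last x p) (rev (belast x p)) = nonedges x p.
Proof.
elim: p x => //= y p IH x; rewrite rev_cons -cats1 nonedges_cat IH addnC /= addn0.
by congr (_ + _); case: p {IH} => [|z p] /=; rewrite ?rev_cons ?last_rcons adj_sym.
Qed.

Lemma nonedges_eq0 x p : (nonedges x p == 0) = path (@adj G) x p.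
Proof. by elim: p x => //= y p IH x; rewrite addn_eq0 IH; case: (adj x y). Qed.

Lemma nonedges_split x p : 0 < nonedges x p ->
  exists q y r, p = q ++ y :: r /\ ~~ adj (last x q) y.
Proof.
elim: p x => //= y p IH x; case: (boolP (adj x y)) => [_ /IH|xy _].
  by case=> q [z [r [-> zr]]]; exists (y :: q), z, r.
by exists [::], y, p.
Qed.

(** Ore's count: the predecessor of a neighbour of [x] on the list is no neighbour of [y], and
    outside the list the two neighbourhoods are disjoint. *)
Lemma sum_degrees_path x y p (L := x :: p) : last x p = y -> uniq L ->
  (forall q z r, p = q ++ z :: r -> ~~ (adj y (last x q) && adj x z)) ->
  (forall z, z \notin L -> ~~ (adj x z && adj y z)) ->
  deg x + deg y < #|G|.
Proof.
move=> lp uL noflip nocommon.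
have cnt z : #|[set u | adj z u] :&: [set u in L]| = count (adj z) L.
  rewrite -size_filter -(card_uniqP (filter_uniq (adj z) uL)).
  by apply: eq_card => u; rewrite !inE mem_filter.
have inside : count (adj x) L + count (adj y) L <= size p.
  have -> : count (adj x) L = count (adj x) p by rewrite /L /= adj_irrefl.
  have -> : count (adj y) L = count (adj y) (belast x p).
    by rewrite /L lastI lp -cats1 count_cat /= adj_irrefl addn0 addn0.
  have gen w q : (forall a z b, q = a ++ z :: b -> ~~ (adj y (last w a) && adj x z)) ->
      count (adj x) q + count (adj y) (belast w q) <= size q.
    elim: q w => //= z q IH w nf; have := nf [::] z q erefl.
    have := IH z (fun a u b E => nf (z :: a) u b (congr1 _ E)).
    by rewrite /=; case: (adj y w); case: (adj x z) => //=; lia.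
  exact: gen.
have outside : #|[set u | adj x u] :\: [set u in L]| +
               #|[set u | adj y u] :\: [set u in L]| <= #|~: [set u in L]|.
  rewrite -cardsUI; set I := _ :&: _; have -> : I = set0.
    apply/setP=> u; rewrite !inE; apply/negP=> /andP[/andP[uL' xu] /andP[_ yu]].
    by have := nocommon u; rewrite inE xu yu => /(_ uL').
  by rewrite cards0 addn0 subset_leq_card //; apply/subsetP=> u; rewrite !inE => /orP[]/andP[].
have cardL : #|[set u in L]| = (size p).+1 by rewrite cardsE (card_uniqP uL).
have := cardsC [set u in L]; rewrite cardL.
rewrite /deg -(cardsID [set u in L] [set u | adj x u]).
rewrite -(cardsID [set u in L] [set u | adj y u]) !cnt.
move: inside outside; lia.
Qed.

(** Induction on the number of nonedges. The ends of a nonedge have degree sum at least n, so by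
    Ore's count they have a common neighbour off the cycle, which is inserted, or a crossing pair of
    chords, along which the cycle is rerouted; either way a nonedge disappears and no vertex is
    lost. *)
Lemma cycle_of_ocycle c : uniq c -> cycle oadj c -> 2 < size c ->
  exists c', [/\ uniq c', cycle (@adj G) c' & size c <= size c'].
Proof.
case: c => // x p; have [k] := ubnP (nonedges x (rcons p x)).
elim: k x p => // k IH x p le u cyc sz.
have [/eqP|] := posnP (nonedges x (rcons p x)).
  by rewrite nonedges_eq0 => cyc'; exists (x :: p).
case/nonedges_split => q [y [r [E nadj]]].
(* Rotating the cycle makes the chosen nonedge its closing pair. *)
wlog rnil : x p q y r le u cyc sz E nadj / r = [::].
  move=> wl; case/lastP: r E => [|r z] E; first exact: (wl x p q y [::]).
  move: E; rewrite -rcons_cons -rcons_cat => /rcons_inj[Ep Ez]; subst z p.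
  have [] := wl y (r ++ x :: q) (r ++ x :: q) y [::].
  - move: le; rewrite -!cats1 -!catA /= !nonedges_cat /= !nonedges_cat /=.
    by lia.
  - by rewrite -(cat_cons y r) uniq_catC.
  - by rewrite -(cat_cons y r) -rot_size_cat rot_cycle.
  - by move: sz; rewrite /= !size_cat /=; lia.
  - by rewrite cats1.
  - by rewrite last_cat.
  - by [].
  move=> c' [uc' cc' lec']; exists c'; split=> //.
  by move: lec'; rewrite /= !size_cat /=; lia.
move: E; rewrite rnil cats1 => /rcons_inj[Eq Ey]; subst q y; clear r rnil.
have : oadj (last x p) x by move: cyc; rewrite /= rcons_path => /andP[].
rewrite /oadj (negPf nadj) /= addnC => heavy.
set y := last x p in nadj heavy.
have pathp : path oadj x p by move: cyc; rewrite /= rcons_path => /andP[].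
have nb : nonedges x (rcons p x) = (nonedges x p).+1.
  by rewrite -cats1 nonedges_cat /= nadj addn0 addn1.
rewrite nb ltnS in le.
pose common z := [&& z \notin x :: p, adj x z & adj y z].
have [z /and3P[zp xz yz]|nocommon] := pickP common.
  have [] := IH x (rcons p z).
  - by rewrite -!cats1 -catA nonedges_cat /= yz adj_sym xz !addn0.
  - move: zp u; rewrite /= !inE mem_rcons rcons_uniq inE !negb_or eq_sym.
    by move=> /andP[-> ->] /andP[-> ->].
  - rewrite /= -!cats1 -catA cat_path pathp /= -/y.
    by rewrite !adj_oadj // adj_sym.
  - by rewrite /= size_rcons; move: sz => /=; lia.
  move=> c' [uc' cc' lec']; exists c'; split=> //.
  by move: lec'; rewrite /= size_rcons; lia.
have [[q [z [r [Ep /andP[ya xz]]]]]|noflip] : decidable (exists q z r,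
    p = q ++ z :: r /\ adj y (last x q) && adj x z).
- apply: (@decP _ [exists i : 'I_(size p), adj y (last x (take i p)) && adj x (nth x p i)]).
  apply: (iffP existsP) => [[i Hi]|[q [z [r [Ep Hz]]]]].
    exists (take i p), (nth x p i), (drop i.+1 p); split=> //.
    by rewrite -drop_nth ?cat_take_drop.
  have lt : size q < size p by rewrite Ep size_cat /=; lia.
  by exists (Ordinal lt); rewrite /= Ep take_size_cat // nth_cat ltnn subnn.
- have lz : last z r = y by rewrite /y Ep last_cat.
  have Er : rev (z :: r) = y :: rev (belast z r) by rewrite lastI rev_rcons lz.
  have lr : last y (rev (belast z r)) = z.
    by rewrite -lz; case: (r) => //= w r'; rewrite rev_cons last_rcons.
  have pq : perm_eq (x :: q ++ rev (z :: r)) (x :: p).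
    by rewrite Ep perm_cons perm_cat2l perm_rev.
  have [] := IH x (q ++ rev (z :: r)).
  + rewrite rcons_cat nonedges_cat Er -cats1 /= nonedges_cat /= -lz nonedges_rev.
    rewrite lz lr [adj _ y]adj_sym ya [adj z x]adj_sym xz.
    by move: le; rewrite Ep nonedges_cat /=; lia.
  + by rewrite (perm_uniq pq).
  + rewrite /= rcons_cat cat_path Er rcons_cons /= rcons_path lr.
    rewrite [oadj (last x q) y]oadj_sym !adj_oadj // 1?adj_sym // andbT.
    move: pathp; rewrite Ep cat_path /= => /and3P[-> _ pr] /=.
    rewrite -lz rev_path -(eq_path (e := oadj)) // => u1 u2.
    exact: oadj_sym.
  + by move: (perm_size pq) => /= ->.
  move=> c' [uc' cc' lec']; exists c'; split=> //.
  by move: (perm_size pq) lec' => /= ->.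
have := @sum_degrees_path x y p erefl u.
rewrite ltnNge heavy => H; suff : false by []; apply: H => [q z r Ep|z zp].
  by apply/negP=> H; apply: noflip; exists q, z, r.
by have := nocommon z; rewrite /common zp /= => ->.
Qed.

Definition circumference m : Prop :=
  (exists c, [/\ uniq c, cycle (@adj G) c & size c = m]) /\ 2 < m /\
  forall c, 2 < size c -> uniq c -> cycle (@adj G) c -> size c <= m.

(** Maximality of the cycle is used in this form throughout. Lists of at most two vertices, which
    close up to no cycle, are covered by [2 < m]. *)
Lemma no_longer_ocycle m x y D : circumference m -> uniq D ->
  hpath oadj x y D -> oadj y x -> size D <= m.
Proof.
case=> _ [m2 maxm] uD [p [xp lp pD]] yx.
rewrite -(perm_size pD); case: (leqP (size (x :: p)) 2) => [le|sz].
  exact: leq_trans le (ltnW m2).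
have [||c [uc cc le]] := cycle_of_ocycle (c := x :: p) _ _ sz.
- by rewrite (perm_uniq pD).
- by rewrite /= rcons_path xp lp.
- by rewrite (leq_trans le) // maxm // (leq_trans sz).
Qed.

Lemma avoiding_path v a b : two_connected G -> a != v -> b != v ->
  exists p, [/\ path (@adj G) a p, last a p = b, v \notin a :: p & uniq (a :: p)].
Proof.
case=> _ _ /(_ v) [_ con] av bv.
have avT : a \in [set~ v] by rewrite !inE.
have bvT : b \in [set~ v] by rewrite !inE.
pose a' : induced [set~ v] := exist _ a avT; pose b' : induced [set~ v] := exist _ b bvT.
have /connectP[p0 p0P lp0] := con a' b'.
case/shortenP: p0P lp0 => p pP up _ lp.
exists (map val p); split.
- by rewrite -[a]/(val a') path_map.
- by rewrite -[a]/(val a') last_map -lp.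
- rewrite -[a]/(val a') -map_cons; apply/mapP=> -[w _ vw].
  by have := valP w; rewrite -vw !inE eqxx.
- by rewrite -[a]/(val a') -map_cons map_inj_uniq //; exact: val_inj.
Qed.

Lemma exists_circumference : two_connected G -> exists m, circumference m.
Proof.
move=> G2; have [n3 [_ con] _] := G2.
have exP : exists m, [exists c : m.-tuple G, (2 < m) && uniq c && cycle (@adj G) c].
  have /card_gt0P[x _] : 0 < #|G| by apply: leq_ltn_trans n3.
  (* Deleting [v] leaves [x] connected to the rest, hence with a neighbour other than [v]. Two
     neighbours of [x] found in this way and a path between them avoiding [x] form a cycle. *)
  have nbr v : exists y, (y != v) && adj x y || (x == v).
    have [->|xv] := eqVneq x v; first by exists v; rewrite orbT.
    have /card_gt0P[w] : 0 < #|~: [set x; v]|.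
      by have := n3; rewrite -(cardsC [set x; v]) cards2 xv; lia.
    rewrite !inE negb_or => /andP[wx wv].
    have [p [pP lp vp _]] := avoiding_path G2 xv wv.
    case: p pP lp vp => [|y p] /=; first by move=> _ E; rewrite E eqxx in wx.
    case/andP=> xy _ _; rewrite !inE !negb_or => /and3P[_ vy _].
    by exists y; rewrite eq_sym vy xy.
  have /card_gt0P[u] : 0 < #|~: [set x]|.
    by have := n3; rewrite -(cardsC [set x]) cards1; lia.
  rewrite !inE => ux; have [y] := nbr u; rewrite [x == u]eq_sym (negPf ux) orbF => /andP[yu xy].
  have yx : y != x by apply: contraTneq xy => ->; rewrite adj_irrefl.
  have [z] := nbr y; rewrite [x == y]eq_sym (negPf yx) orbF => /andP[zy xz].
  have zx : z != x by apply: contraTneq xz => ->; rewrite adj_irrefl.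
  have [p [pP lp xp up]] := avoiding_path G2 yx zx.
  exists (size (x :: y :: p)); apply/existsP; exists (in_tuple (x :: y :: p)).
  case: p pP lp xp up => [_ E|w p]; first by rewrite /= in E; rewrite E eqxx in zy.
  move=> pP lp xp up.
  have -> : cycle (@adj G) [:: x, y, w & p] =
    adj x y && (path (@adj G) y (w :: p) && adj (last y (w :: p)) x).
    by rewrite -rcons_path.
  by rewrite xy pP lp [adj z x]adj_sym xz [uniq _]/= -/(uniq (y :: w :: p)) xp up.
have bound m : [exists c : m.-tuple G, (2 < m) && uniq c && cycle (@adj G) c] -> m <= #|G|.
  case/existsP=> c /andP[/andP[_ uc] _]; rewrite -(size_tuple c) -(card_uniqP uc).
  exact: max_card.
case: (ex_maxnP exP bound) => m /existsP[c /andP[/andP[m2 uc] cc]] maxm.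
exists m; split; first by exists c; rewrite size_tuple.
split=> // c' c2 uc' cc'; apply: maxm; apply/existsP; exists (in_tuple c').
by rewrite c2 uc' cc'.
Qed.

End OCycles.

(** * Degree counting along a path *)

Section Counting.
Variable G : sgraph.

(** The successor map injects the positions satisfying both predicates into those satisfying
    neither. *)
Lemma count_doubles (f g : pred G) s :
  (forall X a c Y, s = X ++ a :: c :: Y -> f a -> g a -> ~~ f c && ~~ g c) ->
  (forall X a, s = rcons X a -> ~~ (f a && g a)) ->
  count (predI f g) s <= count (predI (predC f) (predC g)) s.
Proof.
have [n] := ubnP (size s); elim: n s => // n IH [|a [|c s]] //= le dz lastN.
  by have := lastN [::] a erefl; case: (f a); case: (g a).
have dz' X a' c' Y : c :: s = X ++ a' :: c' :: Y -> f a' -> g a' -> ~~ f c' && ~~ g c'.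
  by move=> E; apply: (dz (a :: X) a' c' Y); rewrite E.
have last' X a' : c :: s = rcons X a' -> ~~ (f a' && g a').
  by move=> E; apply: (lastN (a :: X)); rewrite E.
have := IH (c :: s) le dz' last'; rewrite /=.
have := dz [::] a c s erefl.
have := IH s (ltnW le); move=> IHs.
case fa: (f a); case ga: (g a) => //=; try lia.
move/(_ isT isT)/andP=> [/negPf fc /negPf gc] _; rewrite fc gc /=.
suff : count (predI f g) s <= count (predI (predC f) (predC g)) s by rewrite /=; lia.
apply: IHs => [X a' c' Y E|X a' E]; first by apply: (dz' (c :: X)); rewrite E.
by apply: (last' (c :: X)); rewrite E.
Qed.

(** The excess of [deg u + deg t] over the order is the number of common neighbours minus the number
    of common non-neighbours. On [b :: Z] a common neighbour is followed by a common non-neighbour.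
    [X0] has no common neighbour, and behind its last neighbour of [u] enough common non-neighbours
    to pay for [R]. The vertices [u] and [t] themselves make the inequality strict. *)
Lemma sum_degrees_lt (u t : G) X0 b Z (s := X0 ++ b :: Z)
    (R := [seq c <- enum G | (c \notin s) && (adj u c && adj t c)]) :
  uniq s -> u \notin s -> t \notin s -> u != t -> ~~ adj u t ->
  has (adj u) X0 -> ~~ has (adj t) X0 -> ~~ adj t (last b Z) ->
  (forall X a Y, X0 = X ++ a :: Y -> adj u a -> size R <= size Y) ->
  (forall X a c Y, s = X ++ a :: c :: Y -> adj u a -> adj t a ->
     ~~ adj u c && ~~ adj t c) ->
  deg u + deg t < #|G|.
Proof.
move=> us us' ts ut nut hasu not lastt gap dz.
set f := adj u; set g := adj t.
pose dbl := predI f g; pose zero := predI (predC f) (predC g).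
have zeroX0 : size R <= count zero X0.
  have [a [X [Y [EX fa nY]]]] : exists a X Y,
      [/\ X0 = X ++ a :: Y, f a & ~~ has f Y].
    move: hasu; rewrite -has_rev; move E: (rev X0) => s' h.
    case: (split_find h) E => a X Y fa nX E.
    exists a, (rev Y), (rev X); split=> //; last by rewrite has_rev.
    by rewrite -[X0]revK E rev_cat rev_rcons.
  rewrite EX count_cat /=; apply: leq_trans (gap _ _ _ EX fa) _.
  suff /eqP <- : count zero Y == size Y by lia.
  rewrite -all_count; apply/allP=> c cY; rewrite /= (hasPn nY) //=.
  by apply: (hasPn not); rewrite EX mem_cat inE cY !orbT.
have dblX0 : count dbl X0 = 0.
  apply/eqP; rewrite -leqn0 leqNgt -has_count; apply/hasPn => c cX.
  by rewrite /= negb_and (hasPn not) ?orbT.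
have dblZ : count dbl (b :: Z) <= count zero (b :: Z).
  apply: count_doubles => [X a c Y E|X a E].
    by apply: (dz (X0 ++ X)); rewrite /s E -catA.
  suff -> : a = last b Z by rewrite negb_and lastt orbT.
  by rewrite -[last b Z]/(last a (b :: Z)) E last_rcons.
have cntE (h : pred G) : #|[set x | h x] :&: [set x in s]| = count h s.
  rewrite -size_filter -(card_uniqP (filter_uniq h us)).
  by apply: eq_card => x; rewrite !inE mem_filter.
have dblE : #|[set x | dbl x]| = count dbl s + size R.
  rewrite -(cardsID [set x in s]) cntE; congr (_ + _).
  have uR : uniq R by apply/filter_uniq/enum_uniq.
  rewrite -(card_uniqP uR).
  by apply: eq_card => x; rewrite !inE mem_filter mem_enum andbT.
have zeroE : count zero s + 2 <= #|[set x | zero x]|.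
  rewrite -(cardsID [set x in s]) cntE leq_add2l.
  have <- : #|[set u; t]| = 2 by rewrite cards2 ut.
  apply/subset_leq_card/subsetP => x; rewrite !inE => /orP[] /eqP->.
    by rewrite us' /f /g adj_irrefl adj_sym (negPf nut).
  by rewrite ts /f /g adj_irrefl (negPf nut).
have cardE : #|G| = #|[set x | f x] :|: [set x | g x]| + #|[set x | zero x]|.
  rewrite -(cardsC ([set x | f x] :|: [set x | g x])); congr (_ + _).
  by apply: eq_card => x; rewrite !inE negb_or.
have UI := cardsUI [set x | f x] [set x | g x].
have IE : #|[set x | f x] :&: [set x | g x]| = #|[set x | dbl x]|.
  by apply: eq_card => x; rewrite !inE.
rewrite /deg -/f -/g; move: zeroE dblE; rewrite /s !count_cat dblX0.
by clear -UI IE cardE zeroX0 dblZ; lia.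
Qed.
End Counting.

(** * A longest cycle with a path outside it *)

Section Theta.
Variables (G : sgraph) (m : nat).
Notation e := (@oadj G).
Notation hp := (hpath (@oadj G)).
Hypothesis m_gt2 : 2 < m.
Hypothesis nolong : forall x y D, uniq D -> hp x y D -> e y x -> size D <= m.
Hypothesis claw_heavy : forall c x y z : G, uniq [:: x; y; z] ->
  adj c x -> adj c y -> adj c z -> [|| e x y, e x z | e y z].

Let e_sym := @oadj_sym G.

Definition tie (x : G) (Q : seq G) (y p r : G) : Prop :=
  [/\ Q != [::], path (@adj G) x (rcons Q y), head x Q = p & last x Q = r].

Lemma tie_link x Q y p r : tie x Q y p r -> link e x Q y p r.
Proof.
case=> Qn pQ <- <-; apply: path_link => //.
by apply: sub_path pQ => u v; exact: adj_oadj.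
Qed.

Lemma tie_adj x Q y p r : tie x Q y p r -> adj x p /\ adj r y.
Proof.
by case: Q => [[]//|q Q] [_ /= /andP[xq] + <- <-]; rewrite rcons_path => /andP[].
Qed.

Lemma tie_mem x Q y p r : tie x Q y p r -> (p \in Q) * (r \in Q).
Proof.
by case: Q => [[]//|q Q] [_ _ <- <-]; rewrite /= mem_head mem_last.
Qed.

Lemma rev_tie_path (x : G) Q y :
  path (@adj G) x (rcons Q y) -> path (@adj G) y (rcons (rev Q) x).
Proof.
move=> pQ; have := rev_path (@adj G) x (rcons Q y).
rewrite last_rcons belast_rcons rev_cons => E; rewrite E.
by rewrite -(@eq_path _ (@adj G)) // => z t; exact: adj_sym.
Qed.

Lemma tie_sym x Q y p r : tie x Q y p r -> tie y (rev Q) x r p.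
Proof.
case=> Qn pQ <- <-; split; last 2 first.
- by case: Q Qn {pQ} => //= q Q _; rewrite lastI rev_rcons.
- by case: Q Qn {pQ} => //= q Q _; rewrite rev_cons last_rcons.
- by rewrite -size_eq0 size_rev size_eq0.
exact: rev_tie_path.
Qed.

(* A cycle of length [m] through [u] and [v] with arcs [A] and [B], and a path
   [w] joining [u] to [v] outside the cycle. *)
Record theta u A a a' v B b b' w p r : Prop := Theta {
  th_uniq : uniq (u :: v :: A ++ B ++ w);
  th_A : tie u A v a a';
  th_B : tie v B u b b';
  th_w : tie u w v p r;
  th_size : (size A + size B).+2 = m }.

Lemma theta_rev u A a a' v B b b' w p r : theta u A a a' v B b b' w p r ->
  theta u (rev B) b' b v (rev A) a' a w p r.
Proof.
case=> un tA tB tw sz; split; rewrite ?size_rev 1?addnC //; try exact: tie_sym.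
have pD : perm_eq (u :: v :: rev B ++ rev A ++ w) (u :: v :: A ++ B ++ w).
  by perm_count.
by rewrite (perm_uniq pD).
Qed.

Lemma theta_swap u A a a' v B b b' w p r : theta u A a a' v B b b' w p r ->
  theta v B b b' u A a a' (rev w) r p.
Proof.
case=> un tA tB tw sz; split; rewrite 1?addnC //; try exact: tie_sym.
have pD : perm_eq (v :: u :: B ++ A ++ rev w) (u :: v :: A ++ B ++ w).
  by perm_count.
by rewrite (perm_uniq pD).
Qed.

Section Facts.
Variables (u v a a' b b' p r : G) (A B w : seq G).
Hypothesis th : theta u A a a' v B b b' w p r.

Let C := u :: v :: A ++ B.

Lemma th_uniqC : uniq C.
Proof. by have := th_uniq th; rewrite -2!cat_cons catA cat_uniq => /and3P[]. Qed.

Lemma th_off z : z \in w -> z \notin C.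
Proof.
move=> zw; have := th_uniq th.
rewrite -2!cat_cons catA cat_uniq => /and3P[_ /hasPn + _]; exact.
Qed.

Lemma th_sizeC : size C = m.
Proof. by rewrite /= size_cat (th_size th). Qed.

(** Otherwise [W] could be inserted into the cycle between [u] and its neighbour [a]. *)
Lemma th_insert_path c d W : uniq W -> {in W, forall z, z \notin C} ->
  hp c d W -> e u c -> ~~ e d a.
Proof.
move=> uW WC hW uc; apply/negP => da.
have hA := tie_link (th_A th).
have hB := tie_link (th_B th).
have [_ h1 e1] := hA; have [e2 h2 e3] := hB.
have h := hpath_cat (hpath_rcons (hpath_cat h1 e1 (hpath_cons e2 h2)) e3) uc hW.
have pD : perm_eq ((u :: A ++ v :: B) ++ W) (C ++ W) by rewrite /C; perm_count.
have uCW : uniq (C ++ W).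
  by rewrite cat_uniq th_uniqC uW andbT; apply/hasPn => z /WC.
have := nolong _ h da; rewrite (perm_uniq pD) (perm_size pD) => /(_ uCW).
rewrite size_cat th_sizeC -[X in _ <= X]addn0 leq_add2l leqn0 size_eq0 => /eqP W0.
by have := hpath_mem hW; rewrite W0.
Qed.

Lemma th_insert z : z \notin C -> e u z -> ~~ e z a.
Proof.
move=> zC; apply: (@th_insert_path z z [:: z]) => //; last exact: hpath1.
by move=> x; rewrite inE => /eqP->.
Qed.

End Facts.

Section Chords.
Variables (u v a a' b b' p r : G) (A B w : seq G).
Hypothesis th : theta u A a a' v B b b' w p r.
Let C := u :: v :: A ++ B.

Lemma th_insert' z : z \notin C -> e u z -> ~~ e z b'.
Proof.
move=> zC; apply: (th_insert (theta_rev th)).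
by move: zC; rewrite !inE !mem_cat !mem_rev [(z \in B) || _]orbC.
Qed.

Lemma th_ab : a != b'.
Proof.
have [aA _] := tie_mem (th_A th).
have [_ bB] := tie_mem (th_B th).
have := th_uniqC th; rewrite -cat1s -(cat1s v) !cat_uniq.
move=> /and5P[_ _ _ _ /and3P[_ /hasPn H _]].
by apply: contraNneq (H _ bB) => <-.
Qed.

(** Among the neighbours [p], [a], [b'] of [u], an o-edge at [p] would allow inserting [p] into the
    cycle, so the o-pair is the remaining one. *)
Lemma th_chord : e a b'.
Proof.
have [ua _] := tie_adj (th_A th).
have [_ bu] := tie_adj (th_B th).
have [up _] := tie_adj (th_w th).
have [pw _] := tie_mem (th_w th).
have pC := th_off th pw.
have [aA _] := tie_mem (th_A th).
have [_ bB] := tie_mem (th_B th).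
have un : uniq [:: p; a; b'].
  have ne z : z \in u :: v :: A ++ B -> p != z by apply: contraTneq => <-.
  by rewrite /= !inE th_ab negb_or !ne // !inE mem_cat ?aA ?bB !orbT.
have := claw_heavy un up ua; rewrite adj_sym => /(_ bu).
have ne1 := th_insert th pC (adj_oadj up).
have ne2 := th_insert' pC (adj_oadj up).
by rewrite (negPf ne1) (negPf ne2).
Qed.

End Chords.

Section Ends.
Variables (u v a a' b b' p r : G) (A B w : seq G).
Hypothesis th : theta u A a a' v B b b' w p r.
Let C := u :: v :: A ++ B.
Let chord := th_chord th.
Let chord' := th_chord (theta_swap th).
Let lA := tie_link (th_A th).
Let lB := tie_link (th_B th).
Let lw := tie_link (th_w th).

Let too_long x y D : hp x y D -> e y x -> perm_eq D (u :: v :: A ++ B ++ w) -> False.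
Proof.
move=> h yx pD; have := nolong _ h yx.
rewrite (perm_uniq pD) (perm_size pD) (th_uniq th) => /(_ isT).
rewrite /= !size_cat; have := th_size th.
have [] := th_w th; case: (w) => //= *; lia.
Qed.

(* [u w v B] followed by [A] backwards through the chord [b' a]. *)
Lemma th_far_end : ~~ e u a'.
Proof.
apply/negP=> ua; have [uA hA _] := lA; have [vB hB Bu] := lB.
have h1 := hpath_link (hpath1 _ u) lw (hpath_cons vB hB).
have h2 := hpath_cat h1 _ hA.
apply: (too_long (h2 _)); rewrite 1?e_sym //; by perm_count.
Qed.

(** If [A] were a single vertex, the chord at [v] would join it to [b], and [u w v a B] would be a
    longer cycle. This later keeps the initial regions disjoint. *)
Lemma th_arc_gt1 : a != a'.
Proof.
apply/eqP=> E; have [Qn pQ hQ lQ] := th_A th.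
have [_ _ va] := lA; have [_ hB Bu] := lB.
have EA : perm_eq A [:: a].
  have uA : uniq A.
    by have := th_uniq th; rewrite /= cat_uniq; case/and3P=> _ _ /andP[].
  move: Qn hQ lQ uA; case: (A) => //= x [|y q] _ -> //=; rewrite -E => ly.
  by rewrite -{1}ly mem_last.
have e1 : e v a by rewrite e_sym E.
have e2 : e a b by rewrite E e_sym.
have h1 := hpath_link (hpath1 _ u) lw (hpath1 _ v).
have h2 := hpath_cat h1 e1 (hpath_cons e2 hB).
by apply: (too_long h2 Bu); perm_count.
Qed.

End Ends.

(** An edge [u v] of the cycle could be replaced by [w]. *)
Lemma theta_arc_neq0 u A v B w :
  uniq (u :: v :: A ++ B ++ w) -> path (@adj G) u (rcons A v) ->
  path (@adj G) v (rcons B u) -> path (@adj G) u (rcons w v) -> w != [::] ->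
  (size A + size B).+2 = m -> A != [::].
Proof.
move=> un pA pB pw wn sz; apply/eqP=> A0; move: un sz; rewrite A0 cat0s add0n => un sz.
have oe : subrel (@adj G) e by move=> ? ?; exact: adj_oadj.
have hw := path_link (sub_path oe pw) wn.
have h1 := hpath_link (hpath1 _ u) hw (hpath1 _ v).
have B0 : B != [::] by move: sz m_gt2; case: (B) => //=; lia.
have [vB hB Bu] := path_link (sub_path oe pB) B0.
have h2 := hpath_cat h1 vB hB.
have pD : perm_eq (([:: u] ++ w ++ [:: v]) ++ B) (u :: v :: B ++ w) by perm_count.
have := nolong _ h2 Bu.
rewrite (perm_uniq pD) (perm_size pD) => /(_ un); rewrite /= size_cat.
by move: wn sz; case: (w) => //= *; lia.
Qed.

End Theta.

(** * Excluding o-adjacency by a degree count *)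

Section Chord.
Variables (G : sgraph) (m : nat).
Notation e := (@oadj G).
Notation hp := (hpath (@oadj G)).
Hypothesis nolong : forall x y D, uniq D -> hp x y D -> e y x -> size D <= m.

Let e_sym := @oadj_sym G.

Lemma sorted_hpath_prefix (X : seq G) a Z :
  sorted e (X ++ a :: Z) -> hp (head a X) a (rcons X a).
Proof.
case: X => [|x X] /=; first by move=> _; exact: hpath1.
rewrite cat_path /= => /and3P[xX Xa _].
by exists (rcons X a); rewrite rcons_path xX Xa last_rcons.
Qed.

Lemma sorted_hpath_suffix (X : seq G) b Z :
  sorted e (X ++ b :: Z) -> hp b (last b Z) (b :: Z).
Proof.
case: X => [|x X] /=; first exact: hpath_seg.
by rewrite cat_path /= => /and3P[_ _ bZ]; exact: hpath_seg.
Qed.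

(** Closed by its end pair, [s] is a cycle without [u]. The cycle [u], [W], [b], [Z], [X], [a]
    reinserts [u] together with [W] and misses only [Y]. *)
Lemma detour u s X a Y b Z c d W : s = X ++ a :: Y ++ b :: Z ->
  sorted e s -> e (head u s) (last u s) -> e u a -> e u c -> hp c d W -> e d b ->
  uniq (u :: s ++ W) -> (size s).+1 + size W <= m + size Y.
Proof.
move=> Es so ht ua uc hW db un.
have hX : hp (head a X) a (rcons X a).
  by apply: (sorted_hpath_prefix (Z := Y ++ b :: Z)); rewrite -Es.
have hZ : hp b (last b Z) (b :: Z).
  by apply: (sorted_hpath_suffix (X := X ++ a :: Y)); rewrite -catA -Es.
have hd : head u s = head a X by rewrite Es; case: (X).
have tl : last u s = last b Z by rewrite Es !last_cat /= last_cat.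
rewrite hd tl in ht.
have lt : e (last b Z) (head a X) by rewrite e_sym.
have h1 := hpath_cons uc (hpath_cat (hpath_cat hW db hZ) lt hX).
have au : e a u by rewrite e_sym.
have uD : uniq (u :: (W ++ b :: Z) ++ rcons X a).
  have pD : perm_eq ((u :: (W ++ b :: Z) ++ rcons X a) ++ Y) (u :: s ++ W).
    by rewrite Es -cats1; perm_count.
  by have := perm_uniq pD; rewrite un cat_uniq => /andP[].
have := nolong uD h1 au; rewrite Es /= !size_cat size_rcons /=.
by rewrite /= size_cat /=; move: (size X) (size Y) (size Z) (size W); clear; lia.
Qed.

Lemma detour_rev u s X a Y b Z c d W : s = X ++ b :: Y ++ a :: Z ->
  sorted e s -> e (head u s) (last u s) -> e u a -> e u c -> hp c d W -> e d b ->
  uniq (u :: s ++ W) -> (size s).+1 + size W <= m + size Y.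
Proof.
move=> Es so ht ua uc hW db un.
have Er : rev s = rev Z ++ a :: rev Y ++ b :: rev X.
  by rewrite Es rev_cat rev_cons rev_cat rev_cons -!cats1 -!catA.
have := @detour u (rev s) _ _ _ _ _ c d W Er; rewrite !size_rev; apply=> //.
- by rewrite rev_sorted (@eq_sorted _ _ e) // => ? ?; rewrite e_sym.
- have -> : head u (rev s) = last u s by case: (lastP s) => // ? ?; rewrite rev_rcons last_rcons.
  have -> : last u (rev s) = head u s by case: (s) => // ? ?; rewrite rev_cons last_rcons.
  by rewrite e_sym.
have pD : perm_eq (u :: rev s ++ W) (u :: s ++ W) by perm_count.
by rewrite (perm_uniq pD).
Qed.

Lemma clique_hpath x (R : seq G) : uniq (x :: R) ->
  {in x :: R &, forall c d, c != d -> e c d} -> hp x (last x R) (x :: R).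
Proof.
move=> uR cR; apply: hpath_seg; elim: R x uR cR => //= y R IH x /andP[nx uR] cR.
rewrite cR ?inE ?eqxx ?orbT //=; last first.
  by apply: contraNneq nx => ->; rewrite inE eqxx.
by apply: IH => // c d cR' dR'; apply: cR; rewrite inE ?cR' ?dR' orbT.
Qed.

(** The common neighbours of [u] and [t] off [s] form an o-clique, hence a single path that a detour
    can take on its way to [t]. Maximality of [m] then supplies the two hypotheses of
    [sum_degrees_lt]: a gap in front of [b], and no neighbour right after a common neighbour. *)
Lemma no_ochord u t X0 b Z z tau (s := X0 ++ b :: Z) :
  uniq (u :: t :: s) -> sorted e s -> e (head u s) (last u s) ->
  m <= (size s).+2 -> ~~ adj u t ->
  has (adj u) X0 -> ~~ has (adj t) X0 -> ~~ adj t (last b Z) ->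
  (exists c, [/\ c \notin s, adj u c & adj t c]) ->
  (forall c d, c \notin s -> d \notin s -> c != d -> adj u c -> adj t c ->
     adj u d -> adj t d -> e c d) ->
  hp t z (t :: tau) -> e z b -> uniq (t :: tau) ->
  {in tau, forall c, (c \notin u :: s) && ~~ adj u c} -> ~~ e u t.
Proof.
move=> un so ht sz nut hasu not lastt [c0 [c0s uc0 tc0]] cliq htau zb utau off.
have [unu unt us] : [/\ u \notin s, t \notin s & uniq s].
  by move: un; rewrite /= inE negb_or => /and3P[/andP[_ ->] -> ->].
have ut : u != t by apply: contraTneq un => ->; rewrite /= mem_head.
rewrite /oadj (negPf nut) /= -ltnNge.
pose R := [seq c <- enum G | (c \notin s) && (adj u c && adj t c)].
have RP c : (c \in R) = [&& c \notin s, adj u c & adj t c].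
  by rewrite mem_filter mem_enum andbT.
have uR : uniq R by apply/filter_uniq/enum_uniq.
have c0R : c0 \in R by rewrite RP c0s uc0 tc0.
have [c [d [hR cR dR]]] : exists c d, [/\ hp c d R, c \in R & d \in R].
  have cl : {in R &, forall c d, c != d -> e c d}.
    move=> c d; rewrite !RP => /and3P[cs uc tc] /and3P[ds ud td] ne.
    exact: cliq.
  case: (R) uR c0R cl => // c R' uR' _ cl.
  by exists c, (last c R'); split; [exact: clique_hpath|exact: mem_head|exact: mem_last].
have uc : e u c by move: cR; rewrite RP => /and3P[_ /adj_oadj].
have dt : e d t by move: dR; rewrite RP => /and3P[_ _]; rewrite adj_sym => /adj_oadj.
have offR (D : seq G) : uniq (t :: D) ->
    {in D, forall c, (c \notin u :: s) && ~~ adj u c} -> uniq (u :: s ++ R ++ t :: D).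
  move=> uD offD; have tDR x : x \in t :: D -> x \notin R.
    rewrite inE RP => /predU1P[->|/offD/andP[_ /negPf->]]; last by rewrite andbF.
    by rewrite (negPf nut) andbF.
  have tDs x : x \in t :: D -> x \notin u :: s.
    rewrite [x \in t :: D]inE => /predU1P[->|/offD/andP[] //].
    by rewrite inE negb_or eq_sym ut.
  have Rs x : x \in R -> x \notin u :: s.
    rewrite RP inE negb_or => /and3P[-> ux _]; rewrite andbT.
    by apply: contraTneq ux => ->; rewrite adj_irrefl.
  have us' : uniq (u :: s) by rewrite cons_uniq unu us.
  rewrite -cat_cons cat_uniq us'; apply/and3P; split=> //.
    by apply/hasPn => x; rewrite mem_cat => /orP[/Rs|/tDs].
  by rewrite cat_uniq uR uD andbT; apply/hasPn => x /tDR.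
have R1 : 0 < size R by case: (R) c0R.
have t1 : uniq [:: t] by [].
have off1 : {in [::], forall c, (c \notin u :: s) && ~~ adj u c} by [].
have hR1 := hpath_cat hR dt (hpath1 e t).
have hR2 := hpath_cat hR dt htau.
apply: (@sum_degrees_lt G u t X0 b Z) => //.
(* The detour through [R], [t] and [tau] into [b] skips only [Y], and [m <= (size s).+2]; hence [Y]
   is at least as long as [R]. *)
- move=> X a Y EX ua.
  have Es : s = X ++ a :: Y ++ b :: Z by rewrite /s EX -catA.
  have := detour Es so ht (adj_oadj ua) uc hR2 zb (offR _ utau off).
  rewrite size_cat /= => kY; suff : size R <= size Y by [].
  by move: kY sz; move: (size R) (size s) (size tau) (size Y); clear; lia.
(* Now the detour through [R] and [t] skips nothing and, as [R] is nonempty, exceeds [m]. *)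
move=> X a x Y Es ua ta; apply/andP; split; apply/negP.
  move=> ux; have := detour_rev (Y := [::]) Es so ht (adj_oadj ux) uc hR1 (adj_oadj ta).
  rewrite offR // size_cat /= => /(_ isT).
  by move: sz R1; move: (size R) (size s); clear; lia.
move=> tx; have := detour (Y := [::]) Es so ht (adj_oadj ua) uc hR1 (adj_oadj tx).
rewrite offR // size_cat /= => /(_ isT).
by move: sz R1; move: (size R) (size s); clear; lia.
Qed.
End Chord.

(** * O-pairs at the end of a shortest outside path *)

Section Second.
Variables (G : sgraph) (m : nat).
Notation e := (@oadj G).
Notation hp := (hpath (@oadj G)).
Hypothesis m_gt2 : 2 < m.
Hypothesis nolong : forall x y D, uniq D -> hp x y D -> e y x -> size D <= m.
Hypothesis claw_heavy : forall c x y z : G, uniq [:: x; y; z] ->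
  adj c x -> adj c y -> adj c z -> [|| e x y, e x z | e y z].

Let e_sym := @oadj_sym G.

Definition shortest_ear (C w : seq G) : Prop :=
  forall a b z, a \in C -> b \in C -> a != b -> z != [::] -> uniq z ->
    {in z, forall x, x \notin C} -> path (@adj G) a (rcons z b) -> size w <= size z.

Variables (u v a a' b b' p r : G) (A B w : seq G).
Hypothesis th : theta m u A a a' v B b b' w p r.

Let C := u :: v :: A ++ B.
Let chord := th_chord nolong claw_heavy th.
Let chord' := th_chord nolong claw_heavy (theta_swap th).

(** Neither vertex is o-adjacent to [a], by insertion, so in the triple [c], [d], [a] at [u] the
    o-pair is [c], [d]. *)
Lemma th_clique c d : c \notin C -> d \notin C -> c != d ->
  adj u c -> adj u d -> e c d.
Proof.
move=> cC dC cd uc ud; have [ua _] := tie_adj (th_A th).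
have aC : a \in C by rewrite !inE mem_cat (tie_mem (th_A th)) !orbT.
have un : uniq [:: c; d; a].
  rewrite /= !inE negb_or cd /= andbT; apply/andP; split.
    by apply: contraNneq cC => ->.
  by apply: contraNneq dC => ->.
have := claw_heavy un uc ud ua.
rewrite (negPf (th_insert nolong th cC (adj_oadj uc))).
by rewrite (negPf (th_insert nolong th dC (adj_oadj ud))) !orbF.
Qed.

Lemma sorted_tie x Q y q q' : tie x Q y q q' ->
  exists s, [/\ Q = q :: s, path (@adj G) q s & last q s = q'].
Proof.
case: Q => [[]//|q0 s] [_ pQ <- <-]; exists s; split=> //.
by move: pQ; rewrite /= rcons_path => /and3P[].
Qed.

Lemma th_off_uniq : uniq w.
Proof.
by have := th_uniq th; rewrite -2!cat_cons !catA cat_uniq => /and3P[].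
Qed.

Lemma far_swapped : ~~ e v a /\ ~~ e v b'.
Proof.
split; last exact: (th_far_end m_gt2 nolong claw_heavy (theta_swap th)).
exact: (th_far_end m_gt2 nolong claw_heavy (theta_rev (theta_swap th))).
Qed.

(** Apply [no_ochord] with [t = v]. Both ends are removed from the cycle, and the chords at [u] and
    [v] close [A ++ B]; [X0] is the part of [A] before the first neighbour of [v], and [p] is a
    common neighbour. *)
Lemma second_one : w = [:: p] -> e u v -> adj u v.
Proof.
move=> Ew uv; apply: contraTT uv => nuv.
have [As [EA pA lA]] := sorted_tie (th_A th).
have [Bs [EB pB lB]] := sorted_tie (th_B th).
have [ua a'v] := tie_adj (th_A th); have [vb bu] := tie_adj (th_B th).
have [up pv] := tie_adj (th_w th).
have pr : p = r by case: (th_w th) => _ _ _; rewrite Ew.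
have pC : p \notin C by apply: (th_off th); rewrite Ew mem_head.
have [/negP va vb'] := far_swapped.
have nva : ~~ adj v a by apply/negP=> /adj_oadj.
have hasA : has (adj v) A.
  by apply/hasP; exists a'; rewrite ?(tie_mem (th_A th)) // adj_sym.
have uC := th_uniqC th.
move EA' : A hasA => A0 hasA.
case: (split_find hasA) EA' => b0 X0 Z0 vb0 nX0; rewrite cat_rcons => EA'.
have X0n : X0 != [::].
  apply/eqP=> X00; move: EA'; rewrite X00 EA => -[Ea _].
  by rewrite Ea vb0 in nva.
have hasX0 : has (adj u) X0.
  case: (X0) X0n EA' => // x X _; rewrite EA => -[<- _]; by rewrite /= ua.
have Es : A ++ B = X0 ++ b0 :: (Z0 ++ B) by rewrite EA' -catA.
have lastE : last b0 (Z0 ++ B) = b'.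
  by rewrite last_cat EB /= lB.
apply: (@no_ochord G m nolong u v X0 b0 (Z0 ++ B) v [::]); rewrite -?Es //.
- rewrite EA EB /= cat_path /=.
  have oe : subrel (@adj G) e by move=> ? ?; exact: adj_oadj.
  by rewrite !(sub_path oe) // lA andbT e_sym.
- by rewrite EA EB /= last_cat /= lB.
- by rewrite size_cat (th_size th).
- by rewrite lastE; apply/negP=> /adj_oadj; exact/negP.
- exists p; rewrite up adj_sym pr pv -pr; split=> //.
  by move: pC; rewrite !inE !negb_or => /and3P[].
- move=> c d cs ds cd uc vc ud vd; apply: th_clique => //.
    rewrite !inE !negb_or cs andbT; apply/andP; split.
      by apply: contraTneq uc => ->; rewrite adj_irrefl.
    by apply: contraTneq vc => ->; rewrite adj_irrefl.
  rewrite !inE !negb_or ds andbT; apply/andP; split.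
    by apply: contraTneq ud => ->; rewrite adj_irrefl.
  by apply: contraTneq vd => ->; rewrite adj_irrefl.
- exact: hpath1.
- exact: adj_oadj.
Qed.

Section Long.
Variables (t : G) (w1 : seq G).
Hypothesis Ew : w = p :: t :: w1.
Hypothesis short : shortest_ear C w.

Lemma short_head z : z \in t :: w1 -> ~~ adj u z.
Proof.
move=> zw; apply/negP=> uz; case/splitPr: zw Ew => w2 w3 E.
have [wn pw _ _] := th_w th.
suff : size w <= size (z :: w3) by rewrite E /= size_cat /=; lia.
apply: (short (a := u) (b := v)) => //; rewrite ?inE ?eqxx ?orbT //.
- by apply: contraTneq (th_uniqC th) => ->; rewrite /= inE eqxx.
- by have := th_off_uniq; rewrite E /= cat_uniq; case/and3P=> _ _ /andP[].
- by move=> x xz; apply: (th_off th); rewrite E inE mem_cat xz !orbT.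
move: pw; rewrite E rcons_cons rcons_cat /= cat_path /=.
by rewrite uz; case/and4P.
Qed.

Lemma short_second x : w1 != [::] -> x \in C -> ~~ adj t x.
Proof.
move=> w1n xC; apply/negP=> tx.
have [xu|xu] := eqVneq x u.
  by have := short_head (mem_head t w1); rewrite adj_sym -xu tx.
have [up _] := tie_adj (th_w th).
suff : size w <= size [:: p; t] by rewrite Ew; case: (w1) w1n.
apply: (short (a := u) (b := x)) => //; rewrite ?inE ?eqxx // 1?eq_sym //.
- by have := th_off_uniq; rewrite Ew /= !inE negb_or; case/and3P=> /andP[->].
- by move=> y; rewrite !inE => yp; apply: (th_off th); rewrite Ew !inE orbA yp.
have [_ pw _ _] := th_w th; move: pw; rewrite Ew /= => /and3P[-> -> _].
by rewrite tx.
Qed.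

(** Here only [u] is removed from the cycle. If [t] is the last vertex of [w], the list is split at
    the first neighbour of [t]. Otherwise [t] has no neighbour on the cycle; the split is at [v],
    which the rest [w1] of the outside path reaches. *)
Lemma second_two : ~~ e u t.
Proof.
have nut := short_head (mem_head t w1).
have [As [EA pA lA]] := sorted_tie (th_A th).
have [Bs [EB pB lB]] := sorted_tie (th_B th).
have [ua a'v] := tie_adj (th_A th); have [vb bu] := tie_adj (th_B th).
have [up rv] := tie_adj (th_w th).
have tw : t \in w by rewrite Ew !inE eqxx orbT.
have pw : p \in w by rewrite Ew mem_head.
have tC := th_off th tw; have pC := th_off th pw.
have upt : adj p t by have [_ + _ _] := th_w th; rewrite Ew /= => /and3P[].
have hpt : hp p t [:: p; t] by apply: hpath_cons (hpath1 _ _); exact: adj_oadj.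
have upt' : uniq [:: p; t].
  by have := th_off_uniq; rewrite Ew /= !inE negb_or; case/and3P=> /andP[->].
have offpt : {in [:: p; t], forall z, z \notin C}.
  by move=> z; rewrite !inE => /orP[]/eqP->.
have nta : ~~ adj t a.
  by apply/negP=> /adj_oadj; apply/negP; apply: (th_insert_path nolong th upt' offpt hpt (adj_oadj up)).
have ntb' : ~~ adj t b'.
  apply/negP=> /adj_oadj; apply/negP.
  apply: (th_insert_path nolong (theta_rev th) upt' _ hpt (adj_oadj up)) => z /offpt.
  by rewrite !inE !mem_cat !mem_rev [(z \in B) || _]orbC.
pose s := A ++ v :: B.
have usC : perm_eq (u :: s) C by rewrite /s /C; perm_count.
have sC x : (x \notin u :: s) = (x \notin C) by rewrite (perm_mem usC).
have main X0 b0 Z0 tau z : s = X0 ++ b0 :: Z0 -> has (adj u) X0 ->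
    ~~ has (adj t) X0 -> hp t z (t :: tau) -> e z b0 -> uniq (t :: tau) ->
    {in tau, forall c, (c \notin u :: s) && ~~ adj u c} -> ~~ e u t.
  move=> Es hX nX htau zb utau off.
  have oe : subrel (@adj G) e by move=> ? ?; exact: adj_oadj.
  have lE : last b0 Z0 = b'.
    have <- : last b' s = b' by rewrite /s EB last_cat /= lB.
    by rewrite Es last_cat.
  apply: (@no_ochord G m nolong u t X0 b0 Z0 z tau); rewrite -?Es //.
  - rewrite /= inE negb_or; move: (tC); rewrite -sC inE negb_or => /andP[tu ->].
    rewrite eq_sym tu /=; have := th_uniqC th.
    by rewrite -(perm_uniq usC).
  - rewrite /s EA EB /= cat_path /= (sub_path oe) //= (sub_path oe) // lA.
    by rewrite !adj_oadj.
  - by rewrite /s EA EB /= last_cat /= lB.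
  - by rewrite /s size_cat /= addnS -(th_size th).
  - by rewrite lE.
  - exists p; rewrite up adj_sym upt; split=> //.
    by move: pC; rewrite -sC inE negb_or => /andP[].
  move=> c d cs ds cd uc _ ud _; apply: th_clique => //; rewrite -sC inE negb_or.
    by rewrite cs andbT; apply: contraTneq uc => ->; rewrite adj_irrefl.
  by rewrite ds andbT; apply: contraTneq ud => ->; rewrite adj_irrefl.
have [w10|w1n] := eqVneq w1 [::].
  have tr : t = r by have [_ _ _] := th_w th; rewrite Ew w10.
  have hs : has (adj t) s.
    by apply/hasP; exists v; rewrite ?mem_cat ?inE ?eqxx ?orbT // tr.
  move Es : s hs => s0 hs.
  case: (split_find hs) Es => b0 X0 Z0 tb0 nX0; rewrite cat_rcons => Es.
  apply: (main X0 b0 Z0 [::] t) => //; last 2 first.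
  - exact: hpath1.
  - exact: adj_oadj.
  have X0n : X0 != [::].
    apply/eqP=> X00; move: Es; rewrite X00 /s EA => -[Ea _].
    by rewrite Ea tb0 in nta.
  by case: (X0) X0n Es => // x X _; rewrite /s EA => -[<- _]; rewrite /= ua.
apply: (main A v B w1 (last t w1)) => //.
- by apply/hasP; exists a; rewrite ?(tie_mem (th_A th)).
- apply/hasPn=> x xA; apply: short_second => //.
  by rewrite !inE mem_cat xA !orbT.
- apply: hpath_seg; have [_ pw' _ _] := th_w th; move: pw'.
  rewrite Ew /= rcons_path => /and4P[_ _ + _].
  by apply: sub_path => ? ?; exact: adj_oadj.
- have [_ _ _] := th_w th; rewrite Ew /= => ->; exact: adj_oadj.
- by have := th_off_uniq; rewrite Ew /= => /andP[].
move=> c cw; rewrite sC (th_off th) ?Ew ?inE ?cw ?orbT //=.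
by apply: short_head; rewrite inE cw orbT.
Qed.
End Long.
End Second.

(** * Two regions joined by three paths *)

Section Configurations.
Variables (G : sgraph) (m : nat).
Notation e := (@oadj G).
Notation hp := (hpath (@oadj G)).
Hypothesis m_gt2 : 2 < m.
Hypothesis nolong : forall x y D, uniq D -> hp x y D -> e y x -> size D <= m.

Let e_sym := @oadj_sym G.
Let adj_e : subrel (@adj G) e.
Proof. by move=> x y; exact: adj_oadj. Qed.

Definition adj_in (D : seq G) : rel G :=
  fun x y => [&& adj x y, x \in D & y \in D].

Definition connected_in (D : seq G) : Prop :=
  {in D &, forall x y, connect (adj_in D) x y}.

Lemma adj_in_sym D : symmetric (adj_in D).
Proof. by move=> x y; rewrite /adj_in adj_sym [(x \in D) && _]andbC. Qed.

Lemma adj_in_sub (D D' : seq G) :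
  {subset D <= D'} -> subrel (connect (adj_in D)) (connect (adj_in D')).
Proof.
move=> DD'; apply: connect_sub => x y /and3P[xy /DD' xD /DD' yD].
by apply: connect1; rewrite /adj_in xy xD.
Qed.

Lemma connected_in_cons D x p :
  connected_in D -> x \in D -> adj x p -> connected_in (p :: D).
Proof.
move=> cD xD xp.
have sub : {subset D <= p :: D} by move=> z zD; rewrite inE zD orbT.
have px : connect (adj_in (p :: D)) p x.
  by apply: connect1; rewrite /adj_in adj_sym xp mem_head inE xD orbT.
have sym := sym_connect_sym (@adj_in_sym (p :: D)).
have toX z : z \in p :: D -> connect (adj_in (p :: D)) z x.
  by rewrite inE => /predU1P[->//|zD]; apply: (adj_in_sub sub); apply: cD.
move=> y z yD zD; apply: connect_trans (toX _ yD) _.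
by rewrite sym; exact: toX.
Qed.

(** [Du], [Dv], [Q2], [Q3] partition the vertices of the longest cycle, and [Q1] is the path outside
    it. Spanning paths may use o-edges, but connectedness is in the graph itself, where the induced
    subgraphs are sought. *)
Record config Du x1 x2 x3 Dv y1 y2 y3 Q1 Q2 Q3 : Prop := Config {
  cf_uniq : uniq (Du ++ Dv ++ Q1 ++ Q2 ++ Q3);
  cf_u : good e Du x1 x2 x3;
  cf_v : good e Dv y1 y2 y3;
  cf_cu : connected_in Du;
  cf_cv : connected_in Dv;
  cf_1n : Q1 != [::];
  cf_1 : path (@adj G) x1 (rcons Q1 y1);
  cf_2 : path (@adj G) x2 (rcons Q2 y2);
  cf_3 : path (@adj G) x3 (rcons Q3 y3);
  cf_size : size (Du ++ Dv ++ Q2 ++ Q3) = m }.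

Lemma config_swap23 Du x1 x2 x3 Dv y1 y2 y3 Q1 Q2 Q3 :
  config Du x1 x2 x3 Dv y1 y2 y3 Q1 Q2 Q3 ->
  config Du x1 x3 x2 Dv y1 y3 y2 Q1 Q3 Q2.
Proof.
case=> un gu gv cu cv n1 q1 q2 q3 sz; split=> //.
- have pD : perm_eq (Du ++ Dv ++ Q1 ++ Q3 ++ Q2) (Du ++ Dv ++ Q1 ++ Q2 ++ Q3).
    by perm_count.
  by rewrite (perm_uniq pD).
- by apply: good_swap23.
- by apply: good_swap23.
- by rewrite -sz !size_cat [size Q3 + _]addnC.
Qed.

Lemma config_swap Du x1 x2 x3 Dv y1 y2 y3 Q1 Q2 Q3 :
  config Du x1 x2 x3 Dv y1 y2 y3 Q1 Q2 Q3 ->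
  config Dv y1 y2 y3 Du x1 x2 x3 (rev Q1) (rev Q2) (rev Q3).
Proof.
case=> un gu gv cu cv n1 q1 q2 q3 sz; split=> //; try exact: rev_tie_path.
- have pD : perm_eq (Dv ++ Du ++ rev Q1 ++ rev Q2 ++ rev Q3) (Du ++ Dv ++ Q1 ++ Q2 ++ Q3).
    by perm_count.
  by rewrite (perm_uniq pD).
- by rewrite -size_eq0 size_rev size_eq0.
- by rewrite -sz !size_cat !size_rev addnCA.
Qed.

Section Facts.
Variables (Du Dv Q1 Q2 Q3 : seq G) (x1 x2 x3 y1 y2 y3 : G).
Hypothesis cf : config Du x1 x2 x3 Dv y1 y2 y3 Q1 Q2 Q3.
Variables (p1 p2 p3 r1 r2 r3 : G).
Hypotheses (t1 : tie x1 Q1 y1 p1 r1) (t2 : tie x2 Q2 y2 p2 r2)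
  (t3 : tie x3 Q3 y3 p3 r3).
Let L1 := tie_link t1.
Let L2 := tie_link t2.
Let L3 := tie_link t3.

Lemma no_span x y : hp x y (Du ++ Dv ++ Q1 ++ Q2 ++ Q3) -> ~~ e x y.
Proof.
move=> h; apply/negP=> xy; have yx : e y x by rewrite e_sym.
have := nolong (cf_uniq cf) h yx; have := cf_size cf; have := cf_1n cf.
by rewrite -size_eq0 !size_cat; size_lia.
Qed.

Lemma config_crossing s t : s \in Du -> t \in Dv -> e s t ->
  [\/ s = x1 /\ t = y1, s = x2 /\ t = y2 | s = x3 /\ t = y3].
Proof.
move=> sD tD st.
case: (crossing e_sym (cf_u cf) (cf_v cf) L1 L2 L3 sD tD) => // /no_span.
by rewrite st.
Qed.

Lemma config_end1 s : s \in Du -> s != x1 -> ~~ e s r1.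
Proof.
move=> sD s1; apply: no_span.
have h := good_end e_sym (good_swap12 e_sym (cf_u cf))
  (good_swap12 e_sym (cf_v cf)) L2 L1 L3 sD s1.
by apply: hpath_perm h; perm_count.
Qed.

Lemma config_end2 s : s \in Du -> s != x2 -> ~~ e s r2.
Proof.
move=> sD s2; apply: no_span.
have h := good_end e_sym (cf_u cf) (cf_v cf) L1 L2 L3 sD s2.
exact: h.
Qed.

Lemma config_ends21 : ~~ e p2 r1.
Proof.
apply: no_span.
have h := glue_ends e_sym L2 L1 L3 (good13 (cf_u cf)) (good23 (cf_v cf)).
by apply: hpath_perm h; perm_count.
Qed.

Let rest := Du ++ Dv ++ Q2 ++ Q3.

Let p1_rest : uniq (p1 :: rest).
Proof.
have [pQ _] := tie_mem t1; have un := cf_uniq cf.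
have pD : perm_eq (rest ++ Q1) (Du ++ Dv ++ Q1 ++ Q2 ++ Q3) by rewrite /rest; perm_count.
move: un; rewrite -(perm_uniq pD) cat_uniq => /and3P[ur /hasPn H _].
by rewrite cons_uniq ur H.
Qed.

Let p1_long x y : hp x y (p1 :: rest) -> ~~ e y x.
Proof.
move=> h; apply/negP=> yx; have := nolong p1_rest h yx.
by rewrite /= (cf_size cf) ltnn.
Qed.

(** Otherwise [Du] could absorb [p1], and the enlarged region with [Dv], [Q2] and [Q3] would give a
    cycle on [m + 1] vertices. *)
Lemma config_first s : s \in Du -> s != x1 -> ~~ e p1 s.
Proof.
move=> sD s1; apply/negP=> ps.
have [xp _ _] := L1; have [xp2 _ _] := L2.
have p1D : p1 \notin Du.
  by move: p1_rest => /andP[+ _]; apply: contra => pD; rewrite mem_cat pD.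
have gu' := good_extend e_sym (good_swap23 e_sym (good_swap12 e_sym (cf_u cf))) p1D xp sD s1 ps.
have h := glue_two e_sym L2 L3 (good12 gu') (good23 (cf_v cf)).
by have := p1_long h; rewrite e_sym xp2.
Qed.

Lemma config_first2 : ~~ e p1 p2.
Proof.
have [xp _ _] := L1; have px : e p1 x1 by rewrite e_sym.
have h := glue_two e_sym L2 L3 (hpath_cons px (good13 (cf_u cf))) (good23 (cf_v cf)).
by have := p1_long h; rewrite e_sym.
Qed.
End Facts.

(** If [Q2] were empty, the cycle through [Du], [Q3], [Dv] and back along [Q1] would contain the [m]
    cycle vertices and those of [Q1]. *)
Lemma config_neq0 Du x1 x2 x3 Dv y1 y2 y3 Q1 Q2 Q3 :
  config Du x1 x2 x3 Dv y1 y2 y3 Q1 Q2 Q3 -> Q2 != [::].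
Proof.
move=> cf; apply/eqP=> Q20.
have tQ x Q y : path (@adj G) x (rcons Q y) -> Q != [::] -> link e x Q y (head x Q) (last x Q).
  by move=> pQ; apply: path_link; apply: sub_path pQ.
have L1 := tQ _ _ _ (cf_1 cf) (cf_1n cf).
have sz := cf_size cf; have un := cf_uniq cf.
have [xp hQ ry] := L1; have px : e (head x1 Q1) x1 by rewrite e_sym.
have long x y : hp x y (Du ++ Dv ++ Q1 ++ Q3) -> ~~ e y x.
  move=> h; apply/negP=> yx; move: un sz; rewrite Q20 => un sz.
  have := nolong un h yx; rewrite -sz; have := cf_1n cf.
  by rewrite -size_eq0 !size_cat /=; size_lia.
have h3 : exists z, hp x1 z (Du ++ Q3) /\ e z y3.
  case: (eqVneq Q3 [::]) => [E|n3].
    by exists x3; rewrite E cats0; split; [exact: good13 (cf_u cf)|move: (cf_3 cf); rewrite E /= andbT => /adj_oadj].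
  have [xp3 hQ3 ry3] := tQ _ _ _ (cf_3 cf) n3.
  by exists (last x3 Q3); split=> //; exact: hpath_cat (good13 (cf_u cf)) xp3 hQ3.
have [z [hz zy]] := h3.
have yr : e y1 (last x1 Q1) by rewrite e_sym.
have h := hpath_cat (hpath_cat hz zy (hpath_sym e_sym (good13 (cf_v cf)))) yr (hpath_sym e_sym hQ).
suff /long : hp x1 (head x1 Q1) (Du ++ Dv ++ Q1 ++ Q3) by rewrite px.
by apply: hpath_perm h; perm_count.
Qed.

(* The regions cannot be extended along the second and third path. *)
Record saturated Du x1 x2 x3 Dv y1 y2 y3 Q1 Q2 Q3 p1 p2 p3 r1 r2 r3 : Prop :=
  Saturated {
  sat_cf : config Du x1 x2 x3 Dv y1 y2 y3 Q1 Q2 Q3;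
  sat_1 : tie x1 Q1 y1 p1 r1;
  sat_2 : tie x2 Q2 y2 p2 r2;
  sat_3 : tie x3 Q3 y3 p3 r3;
  sat_p2 : forall s, s \in Du -> s != x2 -> ~~ e p2 s;
  sat_p3 : forall s, s \in Du -> s != x3 -> ~~ e p3 s;
  sat_r2 : forall s, s \in Dv -> s != y2 -> ~~ e r2 s;
  sat_r3 : forall s, s \in Dv -> s != y3 -> ~~ e r3 s;
  sat_p : ~~ e p2 p3;
  sat_r : ~~ e r2 r3 }.

Lemma config_extend Du x1 x2 x3 Dv y1 y2 y3 Q1 Q2 Q3 p s :
  config Du x1 x2 x3 Dv y1 y2 y3 Q1 (p :: Q2) Q3 ->
  s \in Du -> s != x2 -> e p s ->
  config (p :: Du) x1 p x3 Dv y1 y2 y3 Q1 Q2 Q3.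
Proof.
case=> un gu gv cu cv n1 q1 q2 q3 sz sD s2 ps.
have pD : perm_eq ((p :: Du) ++ Dv ++ Q1 ++ Q2 ++ Q3) (Du ++ Dv ++ Q1 ++ (p :: Q2) ++ Q3).
  by perm_count.
have un' : uniq ((p :: Du) ++ Dv ++ Q1 ++ Q2 ++ Q3) by rewrite (perm_uniq pD).
have pDu : p \notin Du.
  by move: un'; rewrite cons_uniq => /andP[+ _]; apply: contra => pDu; rewrite mem_cat pDu.
have [xp pQ] : adj x2 p /\ path (@adj G) p (rcons Q2 y2) by move: q2 => /= /andP.
split=> //.
- apply: (good_swap23 e_sym); apply: good_extend (good_swap23 e_sym gu) pDu _ sD s2 ps => //.
  exact: adj_oadj.
- apply: connected_in_cons xp => //; apply: (good_sub gu).
  by rewrite !inE eqxx orbT.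
- by rewrite -sz /= !size_cat /=; size_lia.
Qed.

Lemma config_extend2 Du x1 x2 x3 Dv y1 y2 y3 Q1 Q2 Q3 p q :
  config Du x1 x2 x3 Dv y1 y2 y3 Q1 (p :: Q2) (q :: Q3) -> e p q ->
  config (p :: q :: Du) x1 p q Dv y1 y2 y3 Q1 Q2 Q3.
Proof.
case=> un gu gv cu cv n1 q1 q2 q3 sz pq.
have pD : perm_eq ((p :: q :: Du) ++ Dv ++ Q1 ++ Q2 ++ Q3)
    (Du ++ Dv ++ Q1 ++ (p :: Q2) ++ q :: Q3) by perm_count.
have un' : uniq ((p :: q :: Du) ++ Dv ++ Q1 ++ Q2 ++ Q3) by rewrite (perm_uniq pD).
have [pq' pDu qDu] : [/\ p != q, p \notin Du & q \notin Du].
  move: un'; rewrite cat_uniq => /andP[+ _]; rewrite /= inE negb_or.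
  by case/and3P=> /andP[-> ->] ->.
have [xp pQ] : adj x2 p /\ path (@adj G) p (rcons Q2 y2) by move: q2 => /= /andP.
have [xq qQ] : adj x3 q /\ path (@adj G) q (rcons Q3 y3) by move: q3 => /= /andP.
split=> //.
- exact: (good_extend2 e_sym gu pq' pDu qDu (adj_oadj xp) (adj_oadj xq) pq).
- have sub := good_sub gu.
  have x3D : x3 \in Du by apply: sub; rewrite !inE eqxx !orbT.
  have x2D : x2 \in q :: Du by rewrite inE sub ?orbT // !inE eqxx orbT.
  exact: connected_in_cons (connected_in_cons cu x3D xq) x2D xp.
- by rewrite -sz /= !size_cat /=; size_lia.
Qed.

Lemma path_tie (x : G) Q y : path (@adj G) x (rcons Q y) -> Q != [::] ->
  tie x Q y (head x Q) (last x Q).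
Proof. by []. Qed.

(** Every offending o-edge lets a region absorb end vertices of [Q2] or [Q3], which shortens these
    paths. The terminals [x1], [y1], the path [Q1] and the vertex set of the cycle do not change, so
    the facts about the outside path remain applicable. *)
Lemma saturate Du x1 x2 x3 Dv y1 y2 y3 Q1 Q2 Q3 :
  config Du x1 x2 x3 Dv y1 y2 y3 Q1 Q2 Q3 ->
  exists Du' x2' x3' Dv' y2' y3' Q2' Q3' p1 p2 p3 r1 r2 r3,
    saturated Du' x1 x2' x3' Dv' y1 y2' y3' Q1 Q2' Q3' p1 p2 p3 r1 r2 r3 /\
    Du' ++ Dv' ++ Q2' ++ Q3' =i Du ++ Dv ++ Q2 ++ Q3.
Proof.
have [n] := ubnP (size Q2 + size Q3).
elim: n Du x2 x3 Dv y2 y3 Q2 Q3 => // n IH Du x2 x3 Dv y2 y3 Q2 Q3 le cf.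
have n2 := config_neq0 cf; have n3 := config_neq0 (config_swap23 cf).
have revK' (Q : seq G) : rev (rev Q) = Q by exact: revK.
have [q2 [Q2' E2]] : exists q Q, Q2 = q :: Q by case: (Q2) n2 => // q Q; exists q, Q.
have [q3 [Q3' E3]] : exists q Q, Q3 = q :: Q by case: (Q3) n3 => // q Q; exists q, Q.
have [z2 [R2 F2]] : exists z Q, Q2 = rcons Q z by case: (lastP Q2) n2 => // Q z; exists z, Q.
have [z3 [R3 F3]] : exists z Q, Q3 = rcons Q z by case: (lastP Q3) n3 => // Q z; exists z, Q.
have sE2 : size Q2 = (size Q2').+1 by rewrite E2.
have sE3 : size Q3 = (size Q3').+1 by rewrite E3.
have sF2 : size Q2 = (size R2).+1 by rewrite F2 size_rcons.
have sF3 : size Q3 = (size R3).+1 by rewrite F3 size_rcons.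
pose goal E F P Q := exists Du' x2' x3' Dv' y2' y3' Q2' Q3' p1 p2 p3 r1 r2 r3,
    saturated Du' x1 x2' x3' Dv' y1 y2' y3' Q1 Q2' Q3' p1 p2 p3 r1 r2 r3 /\
    Du' ++ Dv' ++ Q2' ++ Q3' =i E ++ F ++ P ++ Q.
have back E F P Q : goal E F P Q -> perm_eq (E ++ F ++ P ++ Q) (Du ++ Dv ++ Q2 ++ Q3) ->
    goal Du Dv Q2 Q3.
  move=> [Du' [z2' [z3' [Dv' [w2' [w3' [Q2'' [Q3'' [p1 [p2 [p3 [r1 [r2 [r3 [sat mem]]]]]]]]]]]]]]] pD.
  exists Du', z2', z3', Dv', w2', w3', Q2'', Q3'', p1, p2, p3, r1, r2, r3.
  by split=> // x; rewrite mem (perm_mem pD).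
have [/hasP[s sD /andP[s2 ps]]|/hasPn H2] := boolP (has (fun s => (s != x2) && e q2 s) Du).
  have cf' : config Du x1 x2 x3 Dv y1 y2 y3 Q1 (q2 :: Q2') Q3 by rewrite -E2.
  apply: back (IH _ _ _ _ _ _ _ _ _ (config_extend cf' sD s2 ps)) _.
    by move: le; rewrite sE2; size_lia.
  by rewrite E2; perm_count.
have [/hasP[s sD /andP[s2 ps]]|/hasPn H3] := boolP (has (fun s => (s != x3) && e q3 s) Du).
  have cf' : config Du x1 x3 x2 Dv y1 y3 y2 Q1 (q3 :: Q3') Q2.
    by rewrite -E3; exact: config_swap23.
  apply: back (IH _ _ _ _ _ _ _ _ _ (config_swap23 (config_extend cf' sD s2 ps))) _.
    by move: le; rewrite sE3; size_lia.
  by rewrite E3; perm_count.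
have [/hasP[s sD /andP[s2 ps]]|/hasPn H2'] := boolP (has (fun s => (s != y2) && e z2 s) Dv).
  have cf' := config_swap cf; rewrite F2 rev_rcons in cf'.
  have := config_swap (config_extend cf' sD s2 ps); rewrite !revK' => cf''.
  apply: back (IH _ _ _ _ _ _ _ _ _ cf'') _; first by move: le; rewrite sF2; size_lia.
  by rewrite F2 -cats1; perm_count.
have [/hasP[s sD /andP[s2 ps]]|/hasPn H3'] := boolP (has (fun s => (s != y3) && e z3 s) Dv).
  have cf' := config_swap (config_swap23 cf); rewrite F3 rev_rcons in cf'.
  have := config_swap23 (config_swap (config_extend cf' sD s2 ps)); rewrite !revK' => cf''.
  apply: back (IH _ _ _ _ _ _ _ _ _ cf'') _; first by move: le; rewrite sF3; size_lia.
  by rewrite F3 -cats1; perm_count.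
have [pq|npq] := boolP (e q2 q3).
  have cf' : config Du x1 x2 x3 Dv y1 y2 y3 Q1 (q2 :: Q2') (q3 :: Q3') by rewrite -E2 -E3.
  apply: back (IH _ _ _ _ _ _ _ _ _ (config_extend2 cf' pq)) _.
    by move: le; rewrite sE2 sE3; size_lia.
  by rewrite E2 E3; perm_count.
have [pq|npq'] := boolP (e z2 z3).
  have cf' := config_swap cf; rewrite F2 F3 !rev_rcons in cf'.
  have := config_swap (config_extend2 cf' pq); rewrite !revK' => cf''.
  apply: back (IH _ _ _ _ _ _ _ _ _ cf'') _; first by move: le; rewrite sF2 sF3; size_lia.
  by rewrite F2 F3 -!cats1; perm_count.
exists Du, x2, x3, Dv, y2, y3, Q2, Q3.
exists (head x1 Q1), (head x2 Q2), (head x3 Q3), (last x1 Q1), (last x2 Q2), (last x3 Q3).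
have hq2 : head x2 Q2 = q2 by rewrite E2.
have hq3 : head x3 Q3 = q3 by rewrite E3.
have lz2 : last x2 Q2 = z2 by rewrite F2 last_rcons.
have lz3 : last x3 Q3 = z3 by rewrite F3 last_rcons.
rewrite hq2 hq3 lz2 lz3; split=> //; split=> //.
- exact: path_tie (cf_1 cf) (cf_1n cf).
- by rewrite -hq2 -lz2; exact: path_tie (cf_2 cf) n2.
- by rewrite -hq3 -lz3; exact: path_tie (cf_3 cf) n3.
- by move=> s sD s2; have := H2 s sD; rewrite s2.
- by move=> s sD s2; have := H3 s sD; rewrite s2.
- by move=> s sD s2; have := H2' s sD; rewrite s2.
- by move=> s sD s2; have := H3' s sD; rewrite s2.
Qed.

Lemma saturated_swap Du x1 x2 x3 Dv y1 y2 y3 Q1 Q2 Q3 p1 p2 p3 r1 r2 r3 :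
  saturated Du x1 x2 x3 Dv y1 y2 y3 Q1 Q2 Q3 p1 p2 p3 r1 r2 r3 ->
  saturated Dv y1 y2 y3 Du x1 x2 x3 (rev Q1) (rev Q2) (rev Q3) r1 r2 r3 p1 p2 p3.
Proof.
by case=> cf t1 t2 t3 *; split=> //; first exact: config_swap; exact: tie_sym.
Qed.

Lemma saturated_swap23 Du x1 x2 x3 Dv y1 y2 y3 Q1 Q2 Q3 p1 p2 p3 r1 r2 r3 :
  saturated Du x1 x2 x3 Dv y1 y2 y3 Q1 Q2 Q3 p1 p2 p3 r1 r2 r3 ->
  saturated Du x1 x3 x2 Dv y1 y3 y2 Q1 Q3 Q2 p1 p3 p2 r1 r3 r2.
Proof.
by case=> cf *; split; rewrite 1?e_sym //; exact: config_swap23.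
Qed.

End Configurations.

(** * Induced nets and wounded graphs in a region *)

Section Realization.
Variable G : sgraph.
Notation e := (@oadj G).

(* The vertices of [L] carry the edges [s], and their other pairs are not even
   o-adjacent. *)
Definition realizes (x0 : G) (s : seq (nat * nat)) (L : seq G) : bool :=
  uniq L && all (fun j => all (fun i =>
    if edge s i j then adj (nth x0 L i) (nth x0 L j)
    else ~~ e (nth x0 L i) (nth x0 L j)) (iota 0 j)) (iota 0 (size L)).

Lemma o_heavy_realizes k s x0 L : o_heavy (graph_of k s) G -> size L = k ->
  ~~ realizes x0 s L.
Proof.
move=> heavy sz; apply/negP=> /andP[uL /allP real].
pose f (i : graph_of k s) : G := nth x0 L (i : 'I_k).
have fI : injective f.
  by move=> i j /eqP; rewrite nth_uniq ?sz // => /eqP/val_inj.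
have lt_real (i j : 'I_k) : i < j ->
    if edge s i j then adj (f i) (f j) else ~~ e (f i) (f j).
  move=> ij; have := real (nat_of_ord j); rewrite mem_iota sz ltn_ord => /(_ isT).
  by move/allP/(_ (nat_of_ord i)); rewrite mem_iota => ->.
have fP (i j : 'I_k) : adj (f i) (f j) = edge s i j /\
    (i != j -> ~~ edge s i j -> ~~ e (f i) (f j)).
  have [ij|ji|/val_inj->] := ltngtP i j.
  - have := lt_real _ _ ij; case: ifP => [_ ->//|_ H]; split=> //.
    by apply: contraNF H => /adj_oadj.
  - have := lt_real _ _ ji; rewrite adj_sym oadj_sym edge_sym.
    case: ifP => [_ ->//|_ H]; split=> //.
    by apply: contraNF H => /adj_oadj.
  by rewrite adj_irrefl edge_irrefl eqxx.
have iso := induced_image _ _ f fI (fun i j => (fP i j).1).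
have [x [y [/imsetP[i _ ->] /imsetP[j _ ->] ne na le]]] := heavy _ iso.
have [E N] := fP i j; rewrite E in na.
have ij : i != j by apply: contraNneq ne => ->.
by have := N ij na; rewrite /oadj negb_or le andbF.
Qed.

Lemma connect_cross (r : rel G) (P : pred G) x y :
  connect r x y -> P x -> ~~ P y -> exists a b, [/\ r a b, P a & ~~ P b].
Proof.
case/connectP=> p; elim: p x => [|z p IH] x /=; first by move=> _ -> ->.
case/andP=> xz zp yE Px nPy; case: (boolP (P z)) => Pz; last by exists x, z.
exact: IH zp yE Pz nPy.
Qed.

Lemma sorted_cat_cons (r : rel G) X a Z :
  sorted r (X ++ a :: Z) = sorted r (rcons X a) && path r a Z.
Proof. by case: X => [|x X] //=; rewrite cat_path rcons_path /= andbA. Qed.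

Lemma shortest_path (r : rel G) x y : connect r x y ->
  exists L, [/\ sorted r L, uniq L, head y L = x, last x L = y & 
    L != [::] /\ forall X a Y b Z, L = X ++ a :: Y ++ b :: Z -> Y != [::] -> ~~ r a b].
Proof.
move=> cxy.
pose good k := [exists t : k.-tuple G, path r x t && (last x t == y)].
have goodP k p : path r x p -> last x p = y -> size p = k -> good k.
  move=> xp lp <-; apply/existsP; exists (in_tuple p).
  by rewrite xp lp eqxx.
have ex : exists k, good k.
  by case/connectP: cxy => p xp lp; exists (size p); apply: goodP xp _ _.
case: (ex_minnP ex) => k /existsP[t /andP[xt /eqP lt]] mink.
case/shortenP: xt lt mink => p xp up sub lp mink.
have lep : size p <= k.
  rewrite -(size_tuple t); apply: uniq_leq_size => //.
  by move: up => /= /andP[].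
exists (x :: p); split=> //; split=> // X a Y b Z E Yn; apply/negP=> ab.
have : sorted r (X ++ a :: b :: Z).
  have : sorted r (x :: p) by [].
  rewrite E !sorted_cat_cons /= cat_path /= => /and3P[-> _ /andP[_ ->]].
  by rewrite ab.
have hd : exists q, X ++ a :: b :: Z = x :: q /\ size q < size p.
  case: X E => [|x' X] /= [Ex Ep].
    exists (b :: Z); split; first by rewrite Ex.
    by rewrite Ep size_cat /=; case: (Y) Yn => //= *; lia.
  exists (X ++ a :: b :: Z); split; first by rewrite Ex.
  by rewrite Ep !size_cat /= size_cat /=; case: (Y) Yn => //= *; lia.
case: hd => q [Eq ltq]; rewrite Eq => xq.
have lq : last x q = y.
  rewrite -lp -[last x q]/(last x (x :: q)) -Eq -[last x p]/(last x (x :: p)) E.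
  by rewrite !last_cat /= last_cat.
have := mink (size q) (goodP _ _ xq lq erefl); rewrite leqNgt.
by rewrite (leq_trans ltq lep).
Qed.

Definition net_edges := triangle_edges ++ [:: (0, 3); (1, 4); (2, 5)].
Definition wounded_edges := triangle_edges ++ [:: (0, 3); (3, 5); (1, 4)].

Lemma realizes6 s (a0 a1 a2 a3 a4 a5 : G) :
  let r i j x y := if edge s i j then adj x y else ~~ e x y in
  uniq [:: a0; a1; a2; a3; a4; a5] ->
  [/\ r 0 1 a0 a1, r 0 2 a0 a2, r 1 2 a1 a2 & r 0 3 a0 a3] ->
  [/\ r 1 3 a1 a3, r 2 3 a2 a3, r 0 4 a0 a4 & r 1 4 a1 a4] ->
  [/\ r 2 4 a2 a4, r 3 4 a3 a4, r 0 5 a0 a5 & r 1 5 a1 a5] ->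
  [/\ r 2 5 a2 a5, r 3 5 a3 a5 & r 4 5 a4 a5] ->
  realizes a0 s [:: a0; a1; a2; a3; a4; a5].
Proof.
move=> r un [h01 h02 h12 h03] [h13 h23 h04 h14] [h24 h34 h05 h15] [h25 h35 h45].
by rewrite /realizes un /= !andbT; repeat (apply/andP; split); assumption.
Qed.

Section Region.
Variables (D : seq G) (x1 x2 x3 p1 p2 p3 : G).
Let M := p1 :: p2 :: p3 :: D.
Hypothesis claw_heavy : forall c x y z : G, uniq [:: x; y; z] ->
  adj c x -> adj c y -> adj c z -> [|| e x y, e x z | e y z].
Hypothesis uM : uniq [:: p1; p2; p3; x1; x2; x3].
Hypothesis D_conn : connected_in D.
Hypotheses (x1D : x1 \in D) (x2D : x2 \in D) (x3D : x3 \in D).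
Hypotheses (xp1 : adj x1 p1) (xp2 : adj x2 p2) (xp3 : adj x3 p3).
Hypothesis o_true : {in M &, forall x y, x != y -> e x y -> adj x y}.
Hypothesis pend1 : {in M, forall y, adj p1 y -> y = x1}.
Hypothesis pend2 : {in M, forall y, adj p2 y -> y = x2}.
Hypothesis pend3 : {in M, forall y, adj p3 y -> y = x3}.

Let noclaw c x y z : c \in M -> x \in M -> y \in M -> z \in M -> uniq [:: x; y; z] ->
  adj c x -> adj c y -> adj c z -> [|| adj x y, adj x z | adj y z].
Proof.
move=> cM xM yM zM un cx cy cz; move: (un); rewrite /= !inE negb_or => /and3P[/andP[xy xz] yz _].
case/or3P: (claw_heavy un cx cy cz).
- by move/(o_true xM yM xy) => ->.
- by move/(o_true xM zM xz) => ->; rewrite orbT.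
- by move/(o_true yM zM yz) => ->; rewrite !orbT.
Qed.

Let M_conn x y : x \in M -> y \in M -> connect (adj_in M) x y.
Proof.
have cD := connected_in_cons D_conn x3D xp3.
have cD' := connected_in_cons cD _ xp2.
have cD'' := connected_in_cons (cD' _) _ xp1.
by apply: cD''; rewrite !inE ?x2D ?x1D ?orbT.
Qed.

(** [M] induces a claw-free graph, as its o-pairs are edges. The triangle of the net sits where a
    walk from [p3] enters the neighbourhood of a shortest path from [p1] to [p2]. *)
Lemma extract :
  (exists x0 L, size L = 6 /\ realizes x0 net_edges L) /\
  (adj x1 x2 \/ exists x0 L, size L = 6 /\ realizes x0 wounded_edges L).
Proof.
have [p1M p2M p3M] : [/\ p1 \in M, p2 \in M & p3 \in M] by rewrite !inE !eqxx !orbT.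
have DM : {subset D <= M} by move=> x xD; rewrite !inE xD !orbT.
have [L [sL uL hL lL [Ln ind]]] := shortest_path (M_conn p1M p2M).
have p12 : p1 != p2 by move: uM; rewrite /= !inE !negb_or; case/andP => /andP[].
have p13 : p1 != p3 by move: uM; rewrite /= !inE !negb_or; case/andP => /and3P[].
have p23 : p2 != p3 by move: uM; rewrite /= !inE !negb_or; case/and3P=> _ /andP[].
have [x12 x13 x23] : [/\ x1 != x2, x1 != x3 & x2 != x3].
  by move: uM; rewrite /= !inE !negb_or; case/and5P=> _ _ _ /andP[-> ->] /andP[->].
have LM x : x \in L -> x \in M.
  case: (L) sL hL lL Ln => // y s /= ys Ey _ _; rewrite inE => /predU1P[->|xs].
    by rewrite Ey.
  case/splitPr: xs ys => s1 s2; rewrite cat_path /= => /and3P[_ /and3P[_ _ +] _] //.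
have step X a b Z : L = X ++ a :: b :: Z -> adj a b.
  by move=> E; move: sL; rewrite E sorted_cat_cons /= => /and3P[_ /and3P[]].
have nonadj X a Y b Z : L = X ++ a :: Y ++ b :: Z -> Y != [::] -> ~~ adj a b.
  move=> E Yn; have := ind _ _ _ _ _ E Yn; apply: contra => ab.
  by rewrite /adj_in ab !LM // E mem_cat inE ?mem_cat ?inE ?eqxx ?orbT.
have inner a : a \in L -> a != p1 -> a != p2 -> exists X b c Y, L = X ++ b :: a :: c :: Y.
  move=> aL a1 a2; case/splitPr: aL hL lL => X Y.
  case/lastP: X => [|X b] /=; first by move=> E; rewrite E eqxx in a1.
  case: Y => [|c Y]; last by move=> _ _; exists X, b, c, Y; rewrite cat_rcons.
  by rewrite last_cat /= => _ E; rewrite E eqxx in a2.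
have neq X b a c Y : L = X ++ b :: a :: c :: Y -> b != c.
  move=> E; move: uL; rewrite E cat_uniq => /and3P[_ _ /=].
  by rewrite !inE !negb_or => /andP[/and3P[]].
have p3L : p3 \notin L.
  apply/negP=> p3L; have [p31 p32] : p3 != p1 /\ p3 != p2 by rewrite ![p3 == _]eq_sym.
  have [X [b [c [Y E]]]] := inner _ p3L p31 p32.
  have bp := step _ _ _ _ E; have pc : adj p3 c.
    by apply: (step (rcons X b) _ _ Y); rewrite E cat_rcons.
  have bM : b \in M by apply: LM; rewrite E mem_cat inE eqxx orbT.
  have cM : c \in M by apply: LM; rewrite E mem_cat !inE eqxx !orbT.
  have := neq _ _ _ _ _ E; rewrite (pend3 bM) 1?adj_sym //.
  by rewrite (pend3 cM pc) eqxx.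
(* The neighbours of [x3] on an induced path are nonadjacent and would form a claw with the pendant
   vertex [p3]. *)
have x3L : x3 \notin L.
  have [x3p1 x3p2] : x3 != p1 /\ x3 != p2.
    by move: uM; rewrite /= !inE !negb_or ![x3 == _]eq_sym; case/and3P=> /and5P[_ _ _ _ ->] /and4P[_ _ _ ->].
  apply/negP=> x3L; have [X [b [c [Y E]]]] := inner _ x3L x3p1 x3p2.
  have bL : b \in L by rewrite E mem_cat inE eqxx orbT.
  have cL : c \in L by rewrite E mem_cat !inE eqxx !orbT.
  have bx := step _ _ _ _ E; have xc : adj x3 c.
    by apply: (step (rcons X b) _ _ Y); rewrite E cat_rcons.
  have bp : p3 != b by apply: contraNneq p3L => ->.
  have cp : p3 != c by apply: contraNneq p3L => ->.
  have bx3 : b != x3 by apply: contraTneq bx => ->; rewrite adj_irrefl.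
  have cx3 : c != x3 by apply: contraTneq xc => ->; rewrite adj_irrefl.
  have un : uniq [:: p3; b; c] by rewrite /= !inE negb_or bp cp (neq _ _ _ _ _ E).
  have := noclaw (LM _ x3L) p3M (LM _ bL) (LM _ cL) un xp3; rewrite adj_sym bx xc.
  move=> /(_ isT isT) /or3P[/(pend3 (LM _ bL)) E'|/(pend3 (LM _ cL)) E'|bc].
  - by rewrite E' eqxx in bx3.
  - by rewrite E' eqxx in cx3.
  by have := nonadj X b [:: x3] c Y; rewrite bc E => /(_ erefl isT).
(* A walk from [p3] to [p1] has to leave the set of far vertices: it steps from a far [z'] to some
   [z] with a neighbour on [L]. *)
pose far v := (v \in M) && (v \notin L) && ~~ has (adj v) L.
have far3 : far p3.
  rewrite /far p3M p3L /=; apply/hasPn=> y yL; apply/negP=> /(pend3 (LM _ yL)) E.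
  by rewrite -E yL in x3L.
have p1L : p1 \in L.
  by case: (L) hL Ln => // y s /= <- _; exact: mem_head.
have p2L : p2 \in L.
  by case: (L) lL Ln => // y s /= <- _; exact: mem_last.
have nfar1 : ~~ far p1 by rewrite /far p1L andbF.
have [z' [z [zz' fz' nfz]]] := connect_cross (M_conn p3M p1M) far3 nfar1.
have {zz'} [zz' z'M zM] := and3P zz'.
have [z'L z'n] : z' \notin L /\ {in L, forall y, ~~ adj z' y}.
  by move: fz' => /andP[/andP[_ ->] /hasPn].
have zL : z \notin L by apply: contraL zz' => /z'n.
have hz : has (adj z) L by move: nfz; rewrite /far zM zL /= negbK.
have x1L : x1 \in L.
  case EL : L hL lL Ln => [//|y [|y' s]] /= Ey E _; first by move: p12; rewrite -Ey -E eqxx.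
  have py := step [::] _ _ _ EL; rewrite Ey in py.
  have y'L : y' \in L by rewrite EL !inE eqxx orbT.
  by rewrite -(pend1 (LM _ y'L) py) -EL.
have x2L : x2 \in L.
  case/lastP EL : L hL lL Ln => [//|s y] hs E _; rewrite last_rcons in E.
  case/lastP: s EL hs => [|s y'] EL hs; first by move: hs p12; rewrite /= E => ->; rewrite eqxx.
  have py : adj y' y by apply: (step s _ _ [::]); rewrite EL -!cats1 -catA.
  rewrite E adj_sym in py.
  have y'L : y' \in L by rewrite EL !(mem_rcons, inE) eqxx orbT.
  by rewrite -(pend2 (LM _ y'L) py) -EL.
have ends c : c \in L -> adj z c -> c != p1 /\ c != p2.
  move=> cL zc; split; apply: contraNneq zL => Ec; rewrite Ec adj_sym in zc.
    by rewrite (pend1 zM zc).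
  by rewrite (pend2 zM zc).
have [X [c [T [EL zc nX]]]] : exists X c T, [/\ L = X ++ c :: T, adj z c & ~~ has (adj z) X].
  move EL : L hz => L' hz; case: (split_find hz) EL => c X T zc nX EL.
  by exists X, c, T; rewrite cat_rcons.
have cL : c \in L by rewrite EL mem_cat inE eqxx orbT.
have [c1 c2] := ends c cL zc.
case/lastP: X nX EL => [|X b] nX EL; first by rewrite EL /= in hL; rewrite hL eqxx in c1.
case: T EL => [|d Y] EL; first by rewrite EL last_cat /= in lL; rewrite lL eqxx in c2.
rewrite cat_rcons in EL.
have dL : d \in L by rewrite EL mem_cat !inE eqxx !orbT.
have bL : b \in L by rewrite EL mem_cat !inE eqxx !orbT.
have bc := step _ _ _ _ EL.
have cd : adj c d by apply: (step (rcons X b) _ _ Y); rewrite cat_rcons.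
have nbd : ~~ adj b d by apply: (nonadj X b [:: c] d Y).
have nzb : ~~ adj z b by move: nX; rewrite has_rcons negb_or => /andP[].
have neL w y : w \in L -> y \notin L -> w != y by move=> wL; apply: contraNneq => <-.
(* In the claw at [c] with leaves [b], [d], [z], the edge [b d] is absent because [L] is induced,
   and [z b] because [c] is the first neighbour of [z]. *)
have zd : adj z d.
  have un : uniq [:: b; d; z] by rewrite /= !inE negb_or (neq _ _ _ _ _ EL) !neL.
  have := noclaw (LM _ cL) (LM _ bL) (LM _ dL) zM un _ cd _.
  by rewrite adj_sym bc adj_sym zc (negPf nbd) [adj b z]adj_sym (negPf nzb) /= adj_sym => /(_ isT isT).
have [d1 d2] := ends d dL zd.
case: Y EL => [|f Y] EL; first by rewrite EL last_cat /= in lL; rewrite lL eqxx in d2.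
(* A neighbour of [z] beyond [d] would form a claw at [z] with [c] and [z']. *)
have nz y Y1 Y2 : Y1 ++ y :: Y2 = f :: Y -> ~~ adj z y.
  move=> E; apply/negP=> zy.
  have yL : y \in L by rewrite EL -E !(mem_cat, inE) eqxx !orbT.
  have ncy : ~~ adj c y.
    by apply: (nonadj (rcons X b) c (d :: Y1) y Y2); rewrite // EL -E cat_rcons.
  have ncy' : c != y.
    move: uL; rewrite EL -E cat_uniq => /and3P[_ _ /= /and3P[_ + _]].
    by rewrite inE negb_or mem_cat inE !negb_or => /and4P[].
  have un : uniq [:: c; y; z'].
    by rewrite /= !inE negb_or ncy' !neL.
  have := noclaw zM (LM _ cL) (LM _ yL) z'M un zc zy.
  rewrite adj_sym zz' (negPf ncy) [adj c z']adj_sym [adj y z']adj_sym.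
  by rewrite (negPf (z'n _ cL)) (negPf (z'n _ yL)) => /(_ isT).
have fL : f \in L by rewrite EL mem_cat !inE eqxx !orbT.
have nzf : ~~ adj z f by apply: (nz f [::] Y).
have df : adj d f by apply: (step (rcons (rcons X b) c) _ _ Y); rewrite !cat_rcons.
have nbf : ~~ adj b f by apply: (nonadj X b [:: c; d] f Y).
have ncf : ~~ adj c f by apply: (nonadj (rcons X b) c [:: d] f Y); rewrite ?cat_rcons.
have uall : uniq (z' :: z :: L).
  by rewrite /= inE negb_or z'L zL uL !andbT; apply: contraTneq zz' => ->; rewrite adj_irrefl.
have sub6 L' L'' : perm_eq (L' ++ L'') (z' :: z :: L) -> uniq L'.
  by move/perm_uniq; rewrite uall cat_uniq => /andP[].
have neM x y : x \in M -> y \in M -> x != y -> ~~ adj x y -> ~~ e x y.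
  by move=> xM yM xy; apply: contra; exact: o_true.
have Lz w : w \in z' :: z :: L -> w \in M.
  by rewrite !inE => /or3P[/eqP->|/eqP->|/LM].
have nzf' w : w \in L -> ~~ e w z'.
  by move=> wL; apply: neM (LM _ wL) z'M (neL _ _ wL z'L) _; rewrite adj_sym z'n.
have nLe w y : w \in L -> y \in L -> w != y -> ~~ adj w y -> ~~ e w y.
  by move=> wL yL; exact: neM (LM _ wL) (LM _ yL).
have nzL y : y \in L -> ~~ adj z y -> ~~ e z y.
  by move=> yL; apply: neM zM (LM _ yL) _; rewrite eq_sym neL.
have un : uniq [:: c; d; z; b; f; z'].
  by apply: (sub6 _ (X ++ Y)); rewrite EL; perm_count.
move: (un); rewrite /= !inE !negb_or.
case/and5P=> /and5P[cd' _ cb' cf' _] /and4P[_ db' df' _] _ /andP[bf' _] _.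
have ebd : ~~ e b d by apply: nLe => //; rewrite eq_sym.
have edb : ~~ e d b by rewrite oadj_sym.
have ecf : ~~ e c f by apply: nLe.
have ebf : ~~ e b f by apply: nLe.
have efb : ~~ e f b by rewrite oadj_sym.
have ezb : ~~ e z b by apply: nzL.
have ezf : ~~ e z f by apply: nzL.
have dz : adj d z by rewrite adj_sym.
have cz : adj c z by rewrite adj_sym.
have cb : adj c b by rewrite adj_sym.
have dc : adj d c by rewrite adj_sym.
split.
  exists c, [:: c; d; z; b; f; z']; split=> //.
  have zz : adj z z' by rewrite adj_sym.
  have [ec ed] := (nzf' _ cL, nzf' _ dL); have [eb ef] := (nzf' _ bL, nzf' _ fL).
  by apply: realizes6 un _ _ _ _.
(* A vertex of [L] before [b] or after [f] prolongs a pendant edge of the triangle [c d z], giving a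
   wounded graph. If there is neither, [L] is [p1 x1 x2 p2]. *)
case/lastP: X EL nX un => [|X g] EL nX un; last first.
  right; exists c, [:: c; d; z; b; f; g]; split=> //.
  rewrite cat_rcons in EL.
  have gL : g \in L by rewrite EL mem_cat inE eqxx orbT.
  have gb : adj g b := step _ _ _ _ EL.
  have bg : adj b g by rewrite adj_sym.
  have ung : uniq [:: c; d; z; b; f; g].
    by apply: (sub6 _ (z' :: X ++ Y)); rewrite EL; perm_count.
  move: (ung); rewrite /= !inE !negb_or.
  case/and5P=> /and5P[_ _ _ _ cg] /and4P[_ _ _ dg] _ /andP[_ bg'] /andP[fg _].
  have ecg : ~~ e c g.
    by apply: nLe => //; rewrite adj_sym; apply: (nonadj X g [:: b] c (d :: f :: Y)).
  have edg : ~~ e d g.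
    by apply: nLe => //; rewrite adj_sym; apply: (nonadj X g [:: b; c] d (f :: Y)).
  have efg : ~~ e f g.
    by apply: nLe => //; rewrite adj_sym; apply: (nonadj X g [:: b; c; d] f Y).
  have ezg : ~~ e z g.
    by apply: nzL => //; move: nX; rewrite !has_rcons !negb_or => /and3P[].
  by apply: realizes6 ung _ _ _ _.
case: Y EL nz un => [|h Y] EL nz un.
  left; rewrite /= in EL.
  have [Eb Ef] : b = p1 /\ f = p2 by move: hL lL; rewrite EL /= => -> ->.
  have Ec : c = x1 by apply: pend1 (LM _ cL) _; rewrite -Eb.
  have Ed : d = x2 by apply: pend2 (LM _ dL) _; rewrite -Ef adj_sym.
  by rewrite -Ec -Ed.
right; exists d, [:: d; c; z; f; b; h]; split=> //.
rewrite /= in EL.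
have hL' : h \in L by rewrite EL !inE eqxx !orbT.
have fh : adj f h by apply: (step [:: b; c; d] _ _ Y).
have unh : uniq [:: d; c; z; f; b; h].
  by apply: (sub6 _ (z' :: Y)); rewrite EL; perm_count.
move: (unh); rewrite /= !inE !negb_or.
case/and5P=> /and5P[_ _ _ _ dh] /and4P[_ _ _ ch] _ /andP[_ fh'] /andP[bh _].
have edh : ~~ e d h by apply: nLe => //; apply: (nonadj [:: b; c] d [:: f] h Y).
have ech : ~~ e c h by apply: nLe => //; apply: (nonadj [:: b] c [:: d; f] h Y).
have ebh : ~~ e b h by apply: nLe => //; apply: (nonadj [::] b [:: c; d; f] h Y).
have ezh : ~~ e z h by apply: nzL => //; apply: (nz h [:: f] Y).
by apply: realizes6 unh _ _ _ _.
Qed.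
End Region.
End Realization.

(** * Regions of a saturated configuration *)

Section Sides.
Variables (G : sgraph) (m : nat).
Notation e := (@oadj G).
Notation hp := (hpath (@oadj G)).
Hypothesis m_gt2 : 2 < m.
Hypothesis nolong : forall x y D, uniq D -> hp x y D -> e y x -> size D <= m.
Hypothesis claw_heavy : forall c x y z : G, uniq [:: x; y; z] ->
  adj c x -> adj c y -> adj c z -> [|| e x y, e x z | e y z].

Let e_sym := @oadj_sym G.

Definition o_true (D : seq G) : bool :=
  all (fun x => all (fun y => [|| x == y, adj x y | ~~ e x y]) D) D.

Section OneSide.
Variables (Du Dv Q1 Q2 Q3 : seq G) (x1 x2 x3 y1 y2 y3 p1 p2 p3 r1 r2 r3 : G).
Hypothesis sat : saturated m Du x1 x2 x3 Dv y1 y2 y3 Q1 Q2 Q3 p1 p2 p3 r1 r2 r3.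

Let cf := sat_cf sat.
Let t1 := sat_1 sat.
Let t2 := sat_2 sat.
Let t3 := sat_3 sat.
Let C := Du ++ Dv ++ Q2 ++ Q3.

Let usC : {subset [:: x1; x2; x3] <= Du} := good_sub (cf_u cf).
Let ux : uniq [:: x1; x2; x3] := good_uniq (cf_u cf).
Let uy : uniq [:: y1; y2; y3] := good_uniq (cf_v cf).

Lemma sat_x : [/\ x1 \in Du, x2 \in Du & x3 \in Du].
Proof. by rewrite !usC // !inE eqxx ?orbT. Qed.

Lemma sat_y : [/\ y1 \in Dv, y2 \in Dv & y3 \in Dv].
Proof. by have sub := good_sub (cf_v cf); rewrite !sub // !inE eqxx ?orbT. Qed.

Lemma ne_x : [/\ x1 != x2, x1 != x3 & x2 != x3].
Proof. by move: ux; rewrite /= !inE negb_or => /and3P[/andP[-> ->] ->]. Qed.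

Lemma ne_y : [/\ y1 != y2, y1 != y3 & y2 != y3].
Proof. by move: uy; rewrite /= !inE negb_or => /and3P[/andP[-> ->] ->]. Qed.

Lemma sat_p1 s : s \in Du -> s != x1 -> ~~ e p1 s.
Proof. exact: (config_first nolong cf t1 t2 t3). Qed.

Lemma sat_p12 : ~~ e p1 p2.
Proof. exact: (config_first2 nolong cf t1 t2 t3). Qed.

Lemma sat_p13 : ~~ e p1 p3.
Proof. exact: (config_first2 nolong (config_swap23 cf) t1 t3 t2). Qed.

Lemma sat_edges : [/\ adj x1 p1, adj x2 p2, adj x3 p3 & adj r1 y1].
Proof.
have [? ?] := tie_adj t1; have [? ?] := tie_adj t2; have [? ?] := tie_adj t3.
by [].
Qed.

Lemma sat_mem : [/\ p1 \in Q1, p2 \in Q2 & p3 \in Q3].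
Proof. by rewrite !(tie_mem t1) !(tie_mem t2) !(tie_mem t3). Qed.

Lemma sat_uniq : uniq [:: p1; p2; p3; x1; x2; x3].
Proof.
have [x1D x2D x3D] := sat_x; have [p1Q p2Q p3Q] := sat_mem.
have un := cf_uniq cf.
have dis (A B R : seq G) x y : perm_eq (A ++ B ++ R) (Du ++ Dv ++ Q1 ++ Q2 ++ Q3) ->
    x \in A -> y \in B -> x != y.
  move=> pD xA yB; move: un; rewrite -(perm_uniq pD) catA cat_uniq cat_uniq.
  case/and3P=> /and3P[_ /hasPn H _] _ _; apply: contraTneq xA => ->; exact: H.
have [n12 n13 n23] := ne_x.
have d12 : p1 != p2 by apply: (dis Q1 Q2 (Du ++ Dv ++ Q3)) => //; perm_count.
have d13 : p1 != p3 by apply: (dis Q1 Q3 (Du ++ Dv ++ Q2)) => //; perm_count.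
have d23 : p2 != p3 by apply: (dis Q2 Q3 (Du ++ Dv ++ Q1)) => //; perm_count.
have dD1 x : x \in Du -> p1 != x.
  by move=> xD; apply: (dis Q1 Du (Dv ++ Q2 ++ Q3)) => //; perm_count.
have dD2 x : x \in Du -> p2 != x.
  by move=> xD; apply: (dis Q2 Du (Dv ++ Q1 ++ Q3)) => //; perm_count.
have dD3 x : x \in Du -> p3 != x.
  by move=> xD; apply: (dis Q3 Du (Dv ++ Q1 ++ Q2)) => //; perm_count.
by rewrite /= !inE !negb_or d12 d13 d23 !dD1 // !dD2 // !dD3 // n12 n13 n23.
Qed.

Hypothesis Dtrue : o_true Du.

Let M := p1 :: p2 :: p3 :: Du.

Let o_trueM : {in M &, forall x y, x != y -> e x y -> adj x y}.
Proof.
have [a1 a2 a3 _] := sat_edges.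
have n12 := sat_p12; have n13 := sat_p13; have n23 := sat_p sat.
have D1 x : x \in Du -> e p1 x -> adj p1 x.
  move=> xD; have [->|nx] := eqVneq x x1; first by rewrite adj_sym.
  by rewrite (negPf (sat_p1 xD nx)).
have D2 x : x \in Du -> e p2 x -> adj p2 x.
  move=> xD; have [->|nx] := eqVneq x x2; first by rewrite adj_sym.
  by rewrite (negPf (sat_p2 sat xD nx)).
have D3 x : x \in Du -> e p3 x -> adj p3 x.
  move=> xD; have [->|nx] := eqVneq x x3; first by rewrite adj_sym.
  by rewrite (negPf (sat_p3 sat xD nx)).
move=> x y; rewrite !inE => /or4P[/eqP->|/eqP->|/eqP->|xD] /or4P[/eqP->|/eqP->|/eqP->|yD];
  rewrite ?eqxx // => ne.
- by rewrite (negPf n12).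
- by rewrite (negPf n13).
- exact: D1.
- by rewrite e_sym (negPf n12).
- by rewrite (negPf n23).
- exact: D2.
- by rewrite e_sym (negPf n13).
- by rewrite e_sym (negPf n23).
- exact: D3.
- by rewrite e_sym adj_sym; exact: D1.
- by rewrite e_sym adj_sym; exact: D2.
- by rewrite e_sym adj_sym; exact: D3.
move=> exy; have /allP/(_ _ xD)/allP/(_ _ yD) := Dtrue.
by rewrite exy orbF (negPf ne).
Qed.

Let pend (p q r x : G) : ~~ e p q -> ~~ e p r ->
  (forall s, s \in Du -> s != x -> ~~ e p s) ->
  {in [:: p, q, r & Du], forall y, adj p y -> y = x}.
Proof.
move=> pq pr H y; rewrite !inE => /or4P[/eqP->|/eqP->|/eqP->|yD].
- by rewrite adj_irrefl.
- by move/adj_oadj; rewrite (negPf pq).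
- by move/adj_oadj; rewrite (negPf pr).
move/adj_oadj=> py; apply/eqP; apply: contraLR py => nx; exact: H.
Qed.

(** [extract] is applied to each of the three pairs of vertices hanging off the region. *)
Lemma side : (exists (x0 : G) (L : seq G), size L = 6 /\ realizes x0 net_edges L) /\
  ([/\ adj x1 x2, adj x1 x3 & adj x2 x3] \/
   exists (x0 : G) (L : seq G), size L = 6 /\ realizes x0 wounded_edges L).
Proof.
have [x1D x2D x3D] := sat_x; have [a1 a2 a3 _] := sat_edges.
have u := sat_uniq.
have n12 := sat_p12; have n13 := sat_p13; have n23 := sat_p sat.
have n21 : ~~ e p2 p1 by rewrite e_sym.
have n31 : ~~ e p3 p1 by rewrite e_sym.
have n32 : ~~ e p3 p2 by rewrite e_sym.
have E1 := pend n12 n13 sat_p1.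
have E2 := pend n21 n23 (sat_p2 sat).
have E3 := pend n31 n32 (sat_p3 sat).
have mem (q1 q2 q3 r1' r2' r3' : G) : perm_eq [:: q1; q2; q3] [:: r1'; r2'; r3'] ->
    {subset [:: q1, q2, q3 & Du] <= [:: r1', r2', r3' & Du]}.
  move=> pq x; have := perm_mem pq x; rewrite !inE => E.
  by rewrite !orbA -(orbA (x == q1)) E -!orbA.
have ext (q1 q2 q3 z1 z2 z3 : G) : perm_eq [:: q1; q2; q3] [:: p1; p2; p3] ->
    perm_eq [:: q1; q2; q3; z1; z2; z3] [:: p1; p2; p3; x1; x2; x3] ->
    z1 \in Du -> z2 \in Du -> z3 \in Du -> adj z1 q1 -> adj z2 q2 -> adj z3 q3 ->
    {in M, forall y, adj q1 y -> y = z1} -> {in M, forall y, adj q2 y -> y = z2} ->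
    {in M, forall y, adj q3 y -> y = z3} ->
    (exists (x0 : G) (L : seq G), size L = 6 /\ realizes x0 net_edges L) /\
    (adj z1 z2 \/ exists (x0 : G) (L : seq G), size L = 6 /\ realizes x0 wounded_edges L).
  move=> pq pqz z1D z2D z3D b1 b2 b3 F1 F2 F3; have sub := mem _ _ _ _ _ _ pq.
  apply: (extract claw_heavy _ (cf_cu cf) z1D z2D z3D b1 b2 b3); first by rewrite (perm_uniq pqz).
  - by move=> x y /sub xM /sub yM; exact: o_trueM.
  - by move=> y /sub; exact: F1.
  - by move=> y /sub; exact: F2.
  - by move=> y /sub; exact: F3.
have F1 : {in M, forall y, adj p1 y -> y = x1} by [].
have F2 : {in M, forall y, adj p2 y -> y = x2}.
  by move=> y yM; apply: E2; apply: mem yM; perm_count.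
have F3 : {in M, forall y, adj p3 y -> y = x3}.
  by move=> y yM; apply: E3; apply: mem yM; perm_count.
have [net12 w12] : _ /\ _ := ext p1 p2 p3 x1 x2 x3 (perm_refl _) (perm_refl _)
  x1D x2D x3D a1 a2 a3 F1 F2 F3.
split=> //.
case: w12 => [x12|w]; last by right.
have [] : _ /\ _ := ext p1 p3 p2 x1 x3 x2 _ _ x1D x3D x2D a1 a3 a2 F1 F3 F2.
- by perm_count.
- by perm_count.
move=> _ [x13|w]; last by right.
have [] : _ /\ _ := ext p2 p3 p1 x2 x3 x1 _ _ x2D x3D x1D a2 a3 a1 F2 F3 F1.
- by perm_count.
- by perm_count.
by move=> _ [x23|w]; [left|right].
Qed.
End OneSide.

Lemma sum_degrees_common (s t : G) : s != t -> ~~ adj s t -> e s t ->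
  exists c, adj s c /\ adj t c.
Proof.
move=> st nst; rewrite /oadj (negPf nst) /= => le.
have [c /andP[sc tc]|none] := pickP (fun c => adj s c && adj t c); first by exists c.
have := @sum_degrees_path G s t [:: t] erefl; rewrite /= inE st => /(_ isT).
rewrite ltnNge le => H; suff : false by []; apply: H => [q z r|z _]; last by rewrite none.
case: q => [|q0 [|]] //= [Ez _]; by rewrite adj_sym (negPf nst).
Qed.

(* [t] is the second interior vertex of the first path; a neighbour [c] outside
   which it shares with [x2] or [p2] yields a longer cycle. *)
Section Second.
Variables (Du Dv Q1 Q2 Q3 : seq G) (x1 x2 x3 y1 y2 y3 p1 p2 p3 r1 r2 r3 : G).
Hypothesis sat : saturated m Du x1 x2 x3 Dv y1 y2 y3 Q1 Q2 Q3 p1 p2 p3 r1 r2 r3.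
Variables (t : G) (w1 : seq G).
Hypothesis EQ1 : Q1 = p1 :: t :: w1.
Let C := Du ++ Dv ++ Q2 ++ Q3.
Hypothesis tC : {in C, forall s, ~~ adj t s}.

Let cf := sat_cf sat.
Let t1 := sat_1 sat.
Let t2 := sat_2 sat.
Let t3 := sat_3 sat.

Let notC : [/\ p1 \notin C, t \notin C, t != p1 & uniq C].
Proof.
have un := cf_uniq cf.
have pD : perm_eq ([:: p1; t] ++ C ++ w1) (Du ++ Dv ++ Q1 ++ Q2 ++ Q3).
  by rewrite EQ1 /C; perm_count.
move: un; rewrite -(perm_uniq pD) /= inE !mem_cat !negb_or cat_uniq eq_sym.
by rewrite -!andbA => /and5P[? ? ? ? /and5P[? ? ? ? /and5P[? ? ? ? ?]]]; split; rewrite ?mem_cat ?negb_or; do ?[apply/andP; split].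
Qed.

Let too_long c x y D : c \notin C -> c != t -> c != p1 ->
  perm_eq D ([:: c; t; p1] ++ C) -> hp x y D -> ~~ e y x.
Proof.
move=> cC ct cp pD h; apply/negP=> yx; have [p1C t1C tp uC] := notC.
have := nolong _ h yx; rewrite (perm_uniq pD) (perm_size pD) /=.
rewrite !inE !negb_or ct cp cC tp t1C p1C uC => /(_ isT).
by rewrite (cf_size cf); clear; lia.
Qed.

Let edges : [/\ e x1 p1, e p1 t, e x2 p2 & adj p1 t].
Proof.
have [a1 a2 _ _] := sat_edges sat; have p1t : adj p1 t.
  by have := cf_1 cf; rewrite EQ1 /= => /and3P[].
by rewrite !adj_oadj.
Qed.

Lemma second_x2 : ~~ e t x2.
Proof.
have [x1D x2D x3D] := sat_x sat; have [x12 x13 x23] := ne_x sat.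
have [x1p p1t x2p _] := edges; have [p1C tnC tp _] := notC.
have x2C : x2 \in C by rewrite mem_cat x2D.
apply/negP=> tx.
have tx2 : t != x2 by apply: contraNneq tnC => ->.
have [c [tc xc]] := sum_degrees_common tx2 (tC x2C) tx.
have cC : c \notin C by apply: contraL tc => /tC.
have ct : c != t by apply: contraTneq tc => ->; rewrite adj_irrefl.
have cp : c != p1.
  apply: contraTneq xc => ->; apply/negP; rewrite adj_sym => /adj_oadj.
  by apply/negP; apply: (sat_p1 sat) => //; rewrite eq_sym.
have [A [B [hA hB pAB]]] := good2 (cf_u cf).
have e1 : e x2 c by exact: adj_oadj.
have e2 : e c t by rewrite e_sym; exact: adj_oadj.
have e3 : e t p1 by rewrite e_sym.
have e4 : e p1 x1 by rewrite e_sym.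
(* The cycle [x2 c t p1 x1], on to [x3] through the rest of [Du], then [Q3], [Dv] and back along
   [Q2], has three vertices more than [C]. *)
have h1 := hpath_cat hB e1 (hpath_cons e2 (hpath_cons e3 (hpath_cons e4 hA))).
have h2 := glue_two e_sym (tie_link t2) (tie_link t3) h1 (good23 (cf_v cf)).
have pD : perm_eq ((B ++ c :: t :: p1 :: A) ++ Dv ++ Q2 ++ Q3) ([:: c; t; p1] ++ C).
  by rewrite /C; perm_count.
by have := too_long cC ct cp pD h2; rewrite e_sym x2p.
Qed.

Lemma second_p2 : ~~ e t p2.
Proof.
have [x1p p1t x2p _] := edges; have [p1C tnC tp _] := notC.
have [_ p2Q _] := sat_mem sat.
have p2C : p2 \in C by rewrite !mem_cat p2Q !orbT.
apply/negP=> tx.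
have tp2 : t != p2 by apply: contraNneq tnC => ->.
have [c [tc pc]] := sum_degrees_common tp2 (tC p2C) tx.
have cC : c \notin C by apply: contraL tc => /tC.
have ct : c != t by apply: contraTneq tc => ->; rewrite adj_irrefl.
have cp : c != p1.
  apply: contraTneq pc => ->; apply/negP; rewrite adj_sym => /adj_oadj.
  by apply/negP; exact: (sat_p12 sat).
have e2 : e c t by rewrite e_sym; exact: adj_oadj.
have e3 : e t p1 by rewrite e_sym.
have e4 : e p1 x1 by rewrite e_sym.
have h1 := hpath_cons e2 (hpath_cons e3 (hpath_cons e4 (good13 (cf_u cf)))).
have h2 := glue_two e_sym (tie_link t2) (tie_link t3) h1 (good23 (cf_v cf)).
have pD : perm_eq ((c :: t :: p1 :: Du) ++ Dv ++ Q2 ++ Q3) ([:: c; t; p1] ++ C).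
  by rewrite /C; perm_count.
by have := too_long cC ct cp pD h2; rewrite adj_oadj.
Qed.
End Second.

End Sides.

(** * A wounded graph using the outside path *)

Section Final.
Variables (G : sgraph) (m : nat).
Notation e := (@oadj G).
Notation hp := (hpath (@oadj G)).
Hypothesis m_gt2 : 2 < m.
Hypothesis nolong : forall x y D, uniq D -> hp x y D -> e y x -> size D <= m.
Hypothesis claw_heavy : forall c x y z : G, uniq [:: x; y; z] ->
  adj c x -> adj c y -> adj c z -> [|| e x y, e x z | e y z].

Let e_sym := @oadj_sym G.

Definition has_wounded := exists (x0 : G) (L : seq G),
  size L = 6 /\ realizes x0 wounded_edges L.

(** The triangle is [x1 x2 x3], with the path [x1 p1 t] and the pendant edge [x2 p2]. *)
Lemma wounded_through_ear (Du Dv Q1 Q2 Q3 : seq G) x1 x2 x3 y1 y2 y3 p1 p2 p3 r1 r2 r3 t :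
  saturated m Du x1 x2 x3 Dv y1 y2 y3 Q1 Q2 Q3 p1 p2 p3 r1 r2 r3 ->
  [/\ adj x1 x2, adj x1 x3 & adj x2 x3] ->
  uniq [:: x1; x2; x3; p1; p2; t] -> adj p1 t ->
  ~~ e x1 t -> ~~ e x2 t -> ~~ e x3 t -> ~~ e p2 t -> has_wounded.
Proof.
move=> sat [x12 x13 x23] un p1t n1 n2 n3 n4.
have [x1D x2D x3D] := sat_x sat; have [d12 d13 d23] := ne_x sat.
have [a1 a2 _ _] := sat_edges sat.
exists x1, [:: x1; x2; x3; p1; p2; t]; split=> //.
have q1 s : s \in Du -> s != x1 -> ~~ e s p1.
  by move=> sD s1; rewrite e_sym; exact: (sat_p1 nolong sat).
have q2 s : s \in Du -> s != x2 -> ~~ e s p2.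
  by move=> sD s2; rewrite e_sym; exact: (sat_p2 sat).
have n12 := sat_p12 nolong sat.
have [b1 b2 b3 b4] : [/\ ~~ e x2 p1, ~~ e x3 p1, ~~ e x1 p2 & ~~ e x3 p2].
  by rewrite !q1 ?q2 // eq_sym.
by apply: realizes6 un _ _ _ _.
Qed.

Lemma sat_cross (Du Dv Q1 Q2 Q3 : seq G) x1 x2 x3 y1 y2 y3 p1 p2 p3 r1 r2 r3 :
  saturated m Du x1 x2 x3 Dv y1 y2 y3 Q1 Q2 Q3 p1 p2 p3 r1 r2 r3 ->
  (forall t, t \in Dv -> t != y1 -> ~~ e x1 t) /\
  (forall t, t \in Dv -> t != y2 -> ~~ e x2 t).
Proof.
move=> sat; have [x1D x2D x3D] := sat_x sat; have [d12 d13 d23] := ne_x sat.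
have cross := config_crossing nolong (sat_cf sat) (sat_1 sat) (sat_2 sat) (sat_3 sat).
split=> t tD ty; apply/negP.
  case/(cross _ _ x1D tD) => -[E F]; first by rewrite F eqxx in ty.
    by rewrite E eqxx in d12.
  by rewrite E eqxx in d13.
case/(cross _ _ x2D tD) => -[E F]; last by rewrite E eqxx in d23.
  by rewrite E eqxx in d12.
by rewrite F eqxx in ty.
Qed.

Lemma sat_p2_v (Du Dv Q1 Q2 Q3 : seq G) x1 x2 x3 y1 y2 y3 p1 p2 p3 r1 r2 r3 t :
  saturated m Du x1 x2 x3 Dv y1 y2 y3 Q1 Q2 Q3 p1 p2 p3 r1 r2 r3 ->
  t \in Dv -> t != y2 -> ~~ e t p2.
Proof.
move=> sat; have := saturated_swap sat => sat'.
exact: (config_end2 nolong (sat_cf sat') (sat_1 sat') (sat_2 sat') (sat_3 sat')).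
Qed.

Lemma sat_disjoint (Du Dv Q1 Q2 Q3 : seq G) x1 x2 x3 y1 y2 y3 p1 p2 p3 r1 r2 r3 t :
  saturated m Du x1 x2 x3 Dv y1 y2 y3 Q1 Q2 Q3 p1 p2 p3 r1 r2 r3 ->
  t \in Dv ++ Q1 -> [/\ t != x1, t != x2, t != x3 & t != p2].
Proof.
move=> sat tD; have [x1D x2D x3D] := sat_x sat; have [_ p2Q _] := sat_mem sat.
have pD : perm_eq ((Dv ++ Q1) ++ Du ++ Q2 ++ Q3) (Du ++ Dv ++ Q1 ++ Q2 ++ Q3).
  by perm_count.
have := cf_uniq (sat_cf sat); rewrite -(perm_uniq pD) cat_uniq => /and3P[_ /hasPn H _].
have ne z : z \in Du ++ Q2 ++ Q3 -> t != z by move=> /H; apply: contraNneq => <-.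
by rewrite !ne // !mem_cat ?x1D ?x2D ?x3D ?p2Q ?orbT.
Qed.

(** The triangle is [x1 y1 p1], with the path [x1 x2 p2] on one side and the pendant edge [y1 t] on
    the other. *)
Lemma wounded_across (Du Dv Q2 Q3 : seq G) x1 x2 x3 y1 y2 y3 p1 p2 p3 r2 r3 t :
  saturated m Du x1 x2 x3 Dv y1 y2 y3 [:: p1] Q2 Q3 p1 p2 p3 p1 r2 r3 ->
  adj x1 x2 -> adj x1 y1 -> t \in Dv -> adj y1 t -> t != y2 -> has_wounded.
Proof.
move=> sat x12 x1y1 tD y1t t2.
have [x1D x2D x3D] := sat_x sat; have [d12 d13 d23] := ne_x sat.
have [y1D y2D y3D] := sat_y sat; have [f12 f13 f23] := ne_y sat.
have t1 : t != y1 by apply: contraTneq y1t => ->; rewrite adj_irrefl.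
have u6 := sat_uniq sat; have [a1 a2 _ b1] := sat_edges sat.
have [c1 c2] := sat_cross sat.
have sat' := saturated_swap sat.
have y1p : adj y1 p1 by rewrite adj_sym.
have e04 := c1 _ tD t1.
have e05 : ~~ e x1 p2 by rewrite e_sym (sat_p2 sat).
have e13 : ~~ e y1 x2 by rewrite e_sym c2.
have e15 := sat_p2_v sat y1D f12.
have e23 : ~~ e p1 x2 by rewrite (sat_p1 nolong sat) // eq_sym.
have e24 : ~~ e p1 t by rewrite (sat_p1 nolong sat').
have e25 := sat_p12 nolong sat.
have e34 := c2 _ tD t2.
have e45 := sat_p2_v sat tD t2.
have un : uniq [:: x1; y1; p1; x2; t; p2].
  have tM : t \in Dv ++ [:: p1] by rewrite mem_cat tD.
  have yM : y1 \in Dv ++ [:: p1] by rewrite mem_cat y1D.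
  have [g1 g2 _ g3] := sat_disjoint sat tM; have [g4 g5 _ g6] := sat_disjoint sat yM.
  have g7 : t != p1.
    have pD : perm_eq ([:: p1] ++ Dv ++ Du ++ Q2 ++ Q3) (Du ++ Dv ++ [:: p1] ++ Q2 ++ Q3).
      by perm_count.
    have := cf_uniq (sat_cf sat); rewrite -(perm_uniq pD) => /andP[+ _].
    by apply: contraNneq => <-; rewrite mem_cat tD.
  have g8 : y1 != p1 by apply: contraTneq y1p => <-; rewrite adj_irrefl.
  have pD : perm_eq [:: x1; y1; p1; x2; t; p2] [:: t; y1; p1; p2; x1; x2] by perm_count.
  have pD' : perm_eq ([:: p1; p2; x1; x2] ++ [:: p3; x3]) [:: p1; p2; p3; x1; x2; x3].
    by perm_count.
  have u4 : uniq [:: p1; p2; x1; x2].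
    by move: u6; rewrite -(perm_uniq pD') cat_uniq => /and3P[].
  rewrite (perm_uniq pD) cons_uniq [uniq (y1 :: _)]cons_uniq u4 !inE !negb_or.
  by rewrite t1 g1 g2 g3 g4 g5 g6 g7 g8.
by exists x1, [:: x1; y1; p1; x2; t; p2]; split=> //; apply: realizes6 un _ _ _ _.
Qed.

(** The vertex after [p1] on the first path serves as sixth vertex; it is [y1] if [Q1] is a single
    vertex. This fails only when [x1] and [y1] are o-adjacent, hence adjacent, and then a neighbour
    of [y1] in [Dv] other than [y2] or [y3] as needed gives the graph across [p1]. *)
Lemma wounded_side (Du Dv Q1 Q2 Q3 : seq G) x1 x2 x3 y1 y2 y3 p1 p2 p3 r1 r2 r3 :
  saturated m Du x1 x2 x3 Dv y1 y2 y3 Q1 Q2 Q3 p1 p2 p3 r1 r2 r3 ->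
  [/\ adj x1 x2, adj x1 x3 & adj x2 x3] ->
  (Q1 = [:: p1] -> e x1 y1 -> adj x1 y1) ->
  (forall t w1, Q1 = [:: p1, t & w1] -> ~~ e x1 t /\
     (w1 != [::] -> {in Du ++ Dv ++ Q2 ++ Q3, forall s, ~~ adj t s})) ->
  has_wounded.
Proof.
move=> sat tri one two.
have [y1D y2D y3D] := sat_y sat; have [f12 f13 f23] := ne_y sat.
have [x1D x2D x3D] := sat_x sat; have [d12 d13 d23] := ne_x sat.
have [_ c2] := sat_cross sat; have [_ c3] := sat_cross (saturated_swap23 sat).
have u6 := sat_uniq sat; have t1 := sat_1 sat.
have ear t : t \in Dv ++ Q1 -> adj p1 t -> ~~ e x1 t -> ~~ e x2 t -> ~~ e x3 t ->
    ~~ e p2 t -> has_wounded.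
  move=> tD p1t; apply: (wounded_through_ear sat tri) => //.
  have [g1 g2 g3 g4] := sat_disjoint sat tD.
  have g5 : t != p1 by apply: contraTneq p1t => ->; rewrite adj_irrefl.
  have pD : perm_eq [:: x1; x2; x3; p1; p2; t] (t :: [:: x1; x2; x3; p1; p2]) by perm_count.
  have pD' : perm_eq ([:: x1; x2; x3; p1; p2] ++ [:: p3]) [:: p1; p2; p3; x1; x2; x3].
    by perm_count.
  rewrite (perm_uniq pD) cons_uniq !inE !negb_or g1 g2 g3 g4 g5 /=.
  by move: u6; rewrite -(perm_uniq pD') cat_uniq => /and3P[].
have [xp1 r1y] := tie_adj t1.
case: Q1 t1 sat one two ear => [|q [|t w1]] t1 sat one two ear; first by case: t1.
  have [_ _ /= Eq Er] := t1; subst q r1.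
  have y1M : y1 \in Dv ++ [:: p1] by rewrite mem_cat y1D.
  have [x1y1|nx1y1] := boolP (e x1 y1); last first.
    apply: (ear y1) => //; first exact: c2; first exact: c3.
    by rewrite e_sym (sat_p2_v sat).
  have [x12 x13 _] := tri; have x1y1' := one erefl x1y1.
  have [a [b [/and3P[ab aD bD] /eqP Ea nb]]] : exists a b, [/\ adj_in Dv a b, a == y1 & b != y1].
    apply: (connect_cross (P := pred1 y1)) (cf_cv (sat_cf sat) y1D y2D) _ _ => /=.
      exact: eqxx.
    by rewrite eq_sym.
  rewrite Ea in ab; have [b2|b2] := eqVneq b y2.
    by apply: (wounded_across (saturated_swap23 sat) x13 x1y1' bD ab); rewrite b2.
  exact: (wounded_across sat x12 x1y1' bD ab b2).
have [_ pQ /= Eq Er] := t1; rewrite Eq in t1 sat one two ear pQ *.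
have [n1 far] := two t w1 erefl.
have p1t : adj p1 t by move: pQ => /= /and3P[].
apply: (ear t) => //; first by rewrite mem_cat !inE eqxx !orbT.
- have [w10|w1n] := eqVneq w1 [::].
    have Et : t = r1 by rewrite -Er w10.
    rewrite Et; apply: (config_end1 nolong (sat_cf sat) (sat_1 sat) (sat_2 sat) (sat_3 sat)) => //.
    by rewrite eq_sym.
  by rewrite e_sym; apply: (second_x2 nolong sat erefl (far w1n)).
- have [w10|w1n] := eqVneq w1 [::].
    have Et : t = r1 by rewrite -Er w10.
    rewrite Et; apply: (config_end1 nolong (sat_cf sat) (sat_1 sat) (sat_2 sat) (sat_3 sat)) => //.
    by rewrite eq_sym.
  rewrite e_sym; apply: (second_x2 nolong (saturated_swap23 sat) erefl) => s sC.
  apply: (far w1n); move: sC; rewrite !mem_cat; by rewrite [(s \in Q3) || _]orbC.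
have [w10|w1n] := eqVneq w1 [::].
  have Et : t = r1 by rewrite -Er w10.
  rewrite Et; exact: (config_ends21 nolong (sat_cf sat) (sat_1 sat) (sat_2 sat) (sat_3 sat)).
by rewrite e_sym; apply: (second_p2 nolong sat erefl (far w1n)).
Qed.
End Final.

(** * Choosing the region without o-pairs *)

Section Conclusion.
Variables (G : sgraph) (m : nat).
Notation e := (@oadj G).
Notation hp := (hpath (@oadj G)).
Hypothesis m_gt2 : 2 < m.
Hypothesis nolong : forall x y D, uniq D -> hp x y D -> e y x -> size D <= m.
Hypothesis claw_heavy : forall c x y z : G, uniq [:: x; y; z] ->
  adj c x -> adj c y -> adj c z -> [|| e x y, e x z | e y z].

Let e_sym := @oadj_sym G.

Definition has_net := exists (x0 : G) (L : seq G),
  size L = 6 /\ realizes x0 net_edges L.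

(* Two o-pairs, one in each region, would give a forbidden o-pair between them
   by adding up degrees. *)
Lemma o_true_side (Du Dv Q1 Q2 Q3 : seq G) x1 x2 x3 y1 y2 y3 p1 p2 p3 r1 r2 r3 :
  saturated m Du x1 x2 x3 Dv y1 y2 y3 Q1 Q2 Q3 p1 p2 p3 r1 r2 r3 ->
  o_true Du || o_true Dv.
Proof.
move=> sat; apply/norP => -[].
have opair (D : seq G) : ~~ o_true D -> exists a b,
    [/\ a \in D, b \in D, a != b & #|G| <= deg a + deg b].
  case/allPn=> a aD /allPn[b bD] /norP[ab /norP[nab /negPn eab]].
  exists a, b; split=> //.
  by move: eab; rewrite /oadj (negPf nab).
case/opair=> a [b [aD bD ab dab]] /opair[c [d [cD dD cd dcd]]].
have cross := config_crossing nolong (sat_cf sat) (sat_1 sat) (sat_2 sat) (sat_3 sat).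
have [d12 d13 d23] := ne_x sat; have [f12 f13 f23] := ne_y sat.
have fun_r s t t' : s \in Du -> t \in Dv -> t' \in Dv -> e s t -> e s t' -> t = t'.
  move=> sD tD tD' /(cross _ _ sD tD) E /(cross _ _ sD tD').
  case: E => -[-> ->] [] [E ->] //; by move: d12 d13 d23; rewrite ?E ?eqxx // -?E ?eqxx.
have fun_l s s' t : s \in Du -> s' \in Du -> t \in Dv -> e s t -> e s' t -> s = s'.
  move=> sD sD' tD /(cross _ _ sD tD) E /(cross _ _ sD' tD).
  case: E => -[-> ->] [] [-> E] //; by move: f12 f13 f23; rewrite ?E ?eqxx // -?E ?eqxx.
have [H1 H2] : (e a c \/ e b d) /\ (e a d \/ e b c).
  have heavy s t : #|G| <= deg s + deg t -> e s t by rewrite /oadj => ->; rewrite orbT.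
  split; [case: (leqP #|G| (deg a + deg c)) | case: (leqP #|G| (deg a + deg d))] => le;
    by [left; exact: heavy|right; apply: heavy; lia].
case: H1 => h1; case: H2 => h2.
- by move: cd; rewrite (fun_r _ _ _ aD cD dD h1 h2) eqxx.
- by move: ab; rewrite (fun_l _ _ _ aD bD cD h1 h2) eqxx.
- by move: ab; rewrite (fun_l _ _ _ aD bD dD h2 h1) eqxx.
- by move: cd; rewrite (fun_r _ _ _ bD cD dD h2 h1) eqxx.
Qed.

Lemma star_connected (D : seq G) x :
  x \in D -> {in D, forall y, y != x -> adj x y} -> connected_in D.
Proof.
move=> xD star; have toX y : y \in D -> connect (adj_in D) x y.
  move=> yD; have [->|yx] := eqVneq y x; first exact: connect0.
  by apply: connect1; rewrite /adj_in star // xD.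
move=> y z yD zD; apply: connect_trans (toX _ zD).
by rewrite (sym_connect_sym (@adj_in_sym _ D)) toX.
Qed.

Lemma forbidden_side u A a a' v B b b' w p r (Du Dv Q2 Q3 : seq G) x2 x3 y2 y3 p1 p2 p3 r1 r2 r3 :
  theta m u A a a' v B b b' w p r -> shortest_ear (u :: v :: A ++ B) w ->
  saturated m Du u x2 x3 Dv v y2 y3 w Q2 Q3 p1 p2 p3 r1 r2 r3 ->
  Du ++ Dv ++ Q2 ++ Q3 =i u :: v :: A ++ B ->
  o_true Du -> has_net /\ has_wounded G.
Proof.
move=> th short sat memC tru.
have [net [tri|wnd]] := side nolong claw_heavy sat tru; last by [].
split=> //.
have [wn _ hw _] := th_w th; have [_ _ hw' _] := sat_1 sat.
have Ep : p1 = p by rewrite -hw -hw'; case: (w) wn.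
apply: (wounded_side nolong sat tri); rewrite Ep.
  exact: (second_one m_gt2 nolong claw_heavy th).
move=> t w1 Ew; split; first exact: (second_two m_gt2 nolong claw_heavy th Ew short).
by move=> w1n s; rewrite memC; exact: (short_second m_gt2 nolong claw_heavy th Ew short w1n).
Qed.

(** The initial regions are the ends of [w] with their two neighbours on the cycle, triangles of the
    o-graph by [th_chord]; the remainders of the arcs are the second and third path. *)
Lemma forbidden_of_theta (u : G) A a a' v B b b' w p r :
  theta m u A a a' v B b b' w p r -> shortest_ear (u :: v :: A ++ B) w ->
  has_net /\ has_wounded G.
Proof.
move=> th short.
have ths := theta_swap th.
have chord := th_chord nolong claw_heavy th.
have chord' := th_chord nolong claw_heavy ths.
have ab := th_ab th; have ab' := th_ab ths.
have aa := th_arc_gt1 m_gt2 nolong claw_heavy th.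
have bb := th_arc_gt1 m_gt2 nolong claw_heavy ths.
have split_tie x Q y q q' : tie x Q y q q' -> q != q' -> exists Q0 : seq G,
    [/\ Q = q :: rcons Q0 q', adj x q, adj q' y & path (@adj G) q (rcons Q0 q')].
  case=> Qn; case: Q Qn => //= q0 s _ pQ Eq ls qq; subst q0.
  case/lastP: s pQ ls => [|s z] /=; first by move=> _ E; rewrite E eqxx in qq.
  rewrite last_rcons rcons_path last_rcons => /and3P[xq qs zy] Ez; subst z.
  by exists s.
have [Q2 [EA ua a'v pA]] := split_tie _ _ _ _ _ (th_A th) aa.
have [Q3 [EB vb b'u pB]] := split_tie _ _ _ _ _ (th_B th) bb.
have un := th_uniq th.
have pD : perm_eq ([:: u; a; b'] ++ [:: v; a'; b] ++ w ++ Q2 ++ rev Q3) (u :: v :: A ++ B ++ w).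
  by rewrite EA EB -!cats1; perm_count.
have un' := un; rewrite -(perm_uniq pD) in un'.
have ub' : adj u b' by rewrite adj_sym.
have va' : adj v a' by rewrite adj_sym.
have chord'' : e a' b by rewrite e_sym.
have uDu : uniq [:: u; a; b'] by move: un'; rewrite cat_uniq => /and3P[].
have uDv : uniq [:: v; a'; b].
  by move: un'; rewrite cat_uniq => /and3P[_ _]; rewrite cat_uniq => /and3P[].
have [wn pw _ _] := th_w th.
have cf : config m [:: u; a; b'] u a b' [:: v; a'; b] v a' b w Q2 (rev Q3).
  split=> //.
  - by apply: good_triangle => //; apply: adj_oadj.
  - by apply: good_triangle => //; apply: adj_oadj.
  - apply: (@star_connected _ u); first exact: mem_head.
    by move=> y; rewrite !inE => /or3P[]/eqP->; rewrite ?eqxx.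
  - apply: (@star_connected _ v); first exact: mem_head.
    by move=> y; rewrite !inE => /or3P[]/eqP->; rewrite ?eqxx.
  - exact: rev_tie_path.
  by rewrite -(th_size th) EA EB /= !size_cat !size_rev /= !size_rcons; size_lia.
have [Du [x2 [x3 [Dv [y2 [y3 [R2 [R3 [p1 [p2 [p3 [r1 [r2 [r3 [sat mem]]]]]]]]]]]]]]] :=
  saturate nolong cf.
have memC : Du ++ Dv ++ R2 ++ R3 =i u :: v :: A ++ B.
  move=> x; rewrite mem; apply: perm_mem.
  by rewrite EA EB -!cats1; perm_count.
case/orP: (o_true_side sat) => tru; first exact: forbidden_side th short sat memC tru.
apply: forbidden_side ths _ (saturated_swap sat) _ tru.
  have memS : v :: u :: B ++ A =i u :: v :: A ++ B.
    by apply: perm_mem; perm_count.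
  move=> c d z; rewrite !memS size_rev => cC dC cd zn uz off; apply: short => //.
  by move=> x xz; rewrite -memS off.
move=> x; have : perm_eq (Dv ++ Du ++ rev R2 ++ rev R3) (Du ++ Dv ++ R2 ++ R3) by perm_count.
move/perm_mem=> ->; rewrite memC; apply: perm_mem; by perm_count.
Qed.
End Conclusion.

(** * Existence of the outside path *)

Section Existence.
Variable G : sgraph.

Lemma forbidden_of_nonhamiltonian : two_connected G ->
  (forall c x y z : G, uniq [:: x; y; z] ->
     adj c x -> adj c y -> adj c z -> [|| oadj x y, oadj x z | oadj y z]) ->
  ~ hamiltonian G -> has_net G /\ has_wounded G.
Proof.
move=> G2 claw_heavy nham.
have [m circ] := exists_circumference G2.
have [[c [uc cc szc]] [m2 _]] := circ.
have nolong x y D : uniq D -> hpath (@oadj G) x y D -> oadj y x -> size D <= m.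
  exact: no_longer_ocycle.
have [x0 x0c] : exists x, x \notin c.
  have [/forallP all|] := boolP [forall x, x \in c].
    by case: nham; exists c; rewrite szc; split=> //; rewrite /ucycle cc.
  by rewrite negb_forall => /existsP.
have [y0 y0c] : exists y, y \in c.
  by case: (c) szc m2 => [<-//|y s] _ _; exists y; rewrite mem_head.
pose ear a b z := [&& a \in c, b \in c, a != b, z != [::], uniq z,
   all (fun x => x \notin c) z & path (@adj G) a (rcons z b)].
pose earn k := [exists a, exists b, exists z : k.-tuple G, ear a b z].
have earP k : reflect (exists a b z, ear a b z /\ size z = k) (earn k).
  apply: (iffP existsP) => [[a /existsP[b /existsP[z H]]]|[a [b [z [H <-]]]]].
    by exists a, b, (tval z); rewrite size_tuple.
  by exists a; apply/existsP; exists b; apply/existsP; exists (in_tuple z).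
have ex : exists k, earn k.
  have [_ [_ con] _] := G2.
  (* An edge [w0 u] enters the cycle. From [w0] a path avoiding [u] leads to another cycle vertex,
     and its part up to the first cycle vertex [b] completes the outside path. *)
  have [|w0 [u [w0u w0c uc']]] := connect_cross (P := fun x => x \notin c) (con x0 y0) x0c.
    by rewrite negbK.
  rewrite negbK in uc'.
  have [v [vc vu]] : exists v, v \in c /\ v != u.
    case: (c) szc m2 uc => [<-//|y [<-//|y' s]] _ _ /= /andP[+ _].
    rewrite inE negb_or => /andP[yy' _].
    have [yu|yu] := eqVneq y u; last by exists y; rewrite mem_head.
    by exists y'; rewrite !inE eqxx orbT eq_sym -yu.
  have w0u' : w0 != u by apply: contraNneq w0c => ->.
  have [p [pp lp up upp]] := avoiding_path G2 w0u' vu.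
  have hp : has (mem c) p.
    apply/hasP; exists v => //; rewrite -lp.
    case: (p) lp => [E|y s _] /=; last exact: mem_last.
    by rewrite /= in E; rewrite E vc in w0c.
  case: (split_find hp) pp upp up {lp} => b X Z bc nX.
  rewrite cat_path => /andP[pX _]; rewrite -cat_cons cat_uniq => /andP[uX _] uX'.
  exists (size (w0 :: X)); apply/earP; exists u, b, (w0 :: X); split=> //.
  have ub : u != b.
    by apply: contraNneq uX' => ->; rewrite inE mem_cat mem_rcons mem_head !orbT.
  have bc' : b \in c by [].
  move: uX; rewrite -rcons_cons rcons_uniq => /andP[_ uX].
  rewrite -all_predC in nX; rewrite /ear uc' bc' ub uX.
  by rewrite [path _ _ _]/= adj_sym w0u pX /= w0c nX.
have [k /earP[u [v [w [H szw]]]] mink] := ex_minnP ex.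
case/and5P: H => uc' vc uv wn /and3P[uw wc pw].
have short z a b : ear a b z -> size w <= size z.
  by move=> H; rewrite szw; apply: mink; apply/earP; exists a, b, z.
have [i s Es] := rot_to uc'.
have memE : u :: s =i c by move=> x; rewrite -Es mem_rot.
have vs : v \in s.
  by have := memE v; rewrite vc inE eq_sym (negPf uv).
have cs : cycle (@adj G) (u :: s) by rewrite -Es rot_cycle.
have us : uniq (u :: s) by rewrite -Es rot_uniq.
have ss : size (u :: s) = m by rewrite -Es size_rot.
case/splitPr: vs memE cs us ss {Es} => A B memE cs us ss.
have pD : perm_eq (u :: A ++ v :: B) (u :: v :: A ++ B) by perm_count.
have memC : u :: v :: A ++ B =i c by move=> x; rewrite -(perm_mem pD) memE.
have [pA pB] : path (@adj G) u (rcons A v) /\ path (@adj G) v (rcons B u).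
  move: cs; rewrite /= rcons_cat rcons_cons -cat_rcons cat_path last_rcons.
  by move/andP.
have un : uniq (u :: v :: A ++ B ++ w).
  have pE : perm_eq (u :: v :: A ++ B ++ w) ((u :: A ++ v :: B) ++ w) by perm_count.
  rewrite (perm_uniq pE) cat_uniq us uw andbT; apply/hasPn => x xw.
  by rewrite memE; exact: (allP wc).
have sz : (size A + size B).+2 = m by rewrite -ss; size_lia.
have A0 : A != [::] := theta_arc_neq0 m2 nolong un pA pB pw wn sz.
have B0 : B != [::].
  have un' : uniq (u :: v :: rev B ++ rev A ++ w).
    have pE : perm_eq (u :: v :: rev B ++ rev A ++ w) (u :: v :: A ++ B ++ w) by perm_count.
    by rewrite (perm_uniq pE).
  rewrite -size_eq0 -size_rev size_eq0.
  apply: (theta_arc_neq0 m2 nolong un' (rev_tie_path pB) (rev_tie_path pA) pw wn).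
  by rewrite !size_rev addnC.
have th : theta m u A (head u A) (last u A) v B (head v B) (last v B) w (head u w) (last u w).
  by split.
apply: (forbidden_of_theta m2 nolong claw_heavy th).
move=> a b z; rewrite !memC => ac bc ab zn uz off pz; apply: (short z a b).
rewrite /ear ac bc ab zn uz pz andbT /=.
by apply/allP => x /off; rewrite memC.
Qed.

End Existence.

(** * Sufficiency and the characterisation *)

(** Each pair of leaves contains a vertex of degree at least n/2, so two of the three leaves do, and
    their degrees sum to at least n. *)
Lemma claw_o_heavy (G : sgraph) : f_heavy claw G ->
  forall c x y z : G, uniq [:: x; y; z] ->
  adj c x -> adj c y -> adj c z -> [|| oadj x y, oadj x z | oadj y z].
Proof.
move=> heavy c x y z uxyz cx cy cz; apply: contraT => /norP[nxy /norP[nxz nyz]].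
have nadj (s t : G) : ~~ oadj s t -> ~~ adj s t by apply: contra; exact: adj_oadj.
have ncx s : adj c s -> c != s by apply: contraTneq => ->; rewrite adj_irrefl.
pose L := [:: c; x; y; z].
have uL : uniq L by rewrite cons_uniq !inE !negb_or !ncx.
pose f (i : claw) : G := nth c L (i : 'I_4).
have fI : injective f.
  by move=> i j /eqP; rewrite nth_uniq ?ltn_ord // => /eqP/val_inj.
have fP (i j : claw) : adj (f i) (f j) = adj i j.
  have [xc yc zc] : [/\ adj x c, adj y c & adj z c] by rewrite !(adj_sym _ c).
  have [xy xz yz] := And3 (negPf (nadj _ _ nxy)) (negPf (nadj _ _ nxz)) (negPf (nadj _ _ nyz)).
  have [yx zx zy] : [/\ adj y x = false, adj z x = false & adj z y = false].
    by rewrite !(adj_sym z) (adj_sym y).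
  rewrite adj_graph_of /f.
  by case: i => [[|[|[|[|//]]]] ?]; case: j => [[|[|[|[|//]]]] ?];
    rewrite /= ?adj_irrefl ?(cx, cy, cz, xc, yc, zc, xy, xz, yz, yx, zx, zy).
pose A := [set f i | i : claw].
have inA s : s \in L -> s \in A.
  move=> sL; apply/imsetP; have lt : index s L < 4 by rewrite index_mem.
  by exists (Ordinal lt : claw); rewrite //= /f nth_index.
have cA : c \in A by rewrite inA ?inE ?eqxx.
have big (s t : G) : s \in L -> t \in L -> adj c s -> adj c t -> s != t ->
    ~~ adj s t -> #|G| <= 2 * maxn (deg s) (deg t).
  move=> sL tL cs ct st nst.
  pose s' : induced A := exist _ s (inA s sL); pose t' : induced A := exist _ t (inA t tL).
  pose c' : induced A := exist _ c cA.
  apply: (heavy A (induced_image _ _ f fI fP) s' t'); split.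
    exists [:: c'; t'] => //; split=> //=.
      by rewrite /induced_rel /= adj_sym cs ct.
    by rewrite !inE -!val_eqE /= negb_or eq_sym ncx // st ncx.
  case=> [|w [|w' p]] // [pp _ lp].
    by move: st; rewrite -[s]/(val s') -[t]/(val t') -lp eqxx.
  by move: pp nst; rewrite /= andbT -[w]/(last s' [:: w]) lp /induced_rel /= => ->.
move: (uxyz); rewrite /= !inE negb_or => /and3P[/andP[xy xz] yz _].
have hxy := big x y _ _ cx cy xy (nadj _ _ nxy).
have hxz := big x z _ _ cx cz xz (nadj _ _ nxz).
have hyz := big y z _ _ cy cz yz (nadj _ _ nyz).
have {hxy hxz hyz} [hxy hxz hyz] := And3 (hxy (mem_nth c (isT : 1 < size L)) (mem_nth c (isT : 2 < size L)))
  (hxz (mem_nth c (isT : 1 < size L)) (mem_nth c (isT : 3 < size L)))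
  (hyz (mem_nth c (isT : 2 < size L)) (mem_nth c (isT : 3 < size L))).
move: nxy nxz nyz; rewrite /oadj !negb_or -!ltnNge.
by case/andP=> _ ?; case/andP=> _ ?; case/andP=> _ ?; lia.
Qed.

(** Makes the argument from a nonhamiltonian graph constructive. *)
Lemma hamiltonian_decidable (G : sgraph) : decidable (hamiltonian G).
Proof.
apply: (@decP _ ((2 < #|G|) && [exists c : #|G|.-tuple G, ucycleb (@adj G) c])).
apply: (iffP andP) => [[n3 /existsP[c cyc]]|[c [c3 cyc all]]].
  exists c; rewrite size_tuple; split=> // x; have /andP[_ uc] := cyc.
  have sub : {subset c <= enum G} by move=> y _; rewrite mem_enum.
  have [|_ E] := uniq_min_size uc sub; first by rewrite -cardE size_tuple.
  by rewrite E mem_enum.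
have /andP[_ uc] := cyc.
have sz : size c = #|G| by rewrite -(card_uniqP uc); apply: eq_card => x; rewrite all.
split; first by rewrite -sz.
have sz' : size c == #|G| by rewrite sz.
by apply/existsP; exists (Tuple sz').
Qed.

Lemma embeds_graph_of m s n r :
  embeds_in (edge s) (iota 0 m) n r -> embeds (graph_of m s) (graph_of n r).
Proof.
move=> emb; apply/(@embeds_inP _ (edge s) (fun i : graph_of m s => nat_of_ord i)): emb.
- exact: edge_sym.
- exact: edge_irrefl.
- exact: val_inj.
- by [].
- exact: iota_uniq.
move=> l; rewrite mem_iota /=; split=> [lt|[i ->]]; last exact: ltn_ord.
by exists (Ordinal lt).
Qed.

Lemma sufficiency (G : sgraph) : two_connected G -> f_heavy claw G ->
  o_heavy net G \/ o_heavy wounded G -> hamiltonian G.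
Proof.
move=> G2 /claw_o_heavy Gc heavy.
have [//|nham] := hamiltonian_decidable G.
have [[x0 [L [sz real]]] [x0' [L' [sz' real']]]] := forbidden_of_nonhamiltonian G2 Gc nham.
case: heavy => /o_heavy_realizes heavy.
  by have := heavy x0 L sz; rewrite -/net_edges real.
by have := heavy x0' L' sz'; rewrite -/wounded_edges real'.
Qed.

Unset Implicit Arguments.

Theorem corollary1 (S : sgraph) (S_connected : connected S)
    (S_order : 3 <= #|S|) (S_neq_P3 : ~ isomorphic S (Pgraph 3)) :
  (forall G : sgraph, two_connected G -> f_heavy claw G ->
     o_heavy S G -> hamiltonian G) <->
  (isomorphic S (Pgraph 4) \/ isomorphic S (Pgraph 5) \/ isomorphic S C3 \/
   isomorphic S (Zgraph 1) \/ isomorphic S (Zgraph 2) \/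
   isomorphic S bull \/ isomorphic S net \/ isomorphic S wounded).
Proof.
split; first exact: necessity.
move=> S_in G G2 Gc Sheavy; apply: sufficiency => //.
suff [emb|emb] : embeds S net \/ embeds S wounded.
- by left; exact: o_heavy_of_embeds Sheavy.
- by right; exact: o_heavy_of_embeds Sheavy.
have to_wounded m s : isomorphic S (graph_of m s) ->
    embeds_in (edge s) (iota 0 m) 6 wounded_edges -> embeds S wounded.
  by move=> /isomorphic_embeds iso /embeds_graph_of; exact: embeds_trans.
(* Only the net itself fails to embed in the wounded graph. *)
case: S_in => [iso|[iso|[iso|[iso|[iso|[iso|[iso|iso]]]]]]];
  try by right; apply: to_wounded iso _; vm_compute.
by left; exact: isomorphic_embeds.
Qed.
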